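(* Let $G$ be an infinite connected planar graph with uniformly bounded vertex degrees. Then either $G$ is amenable and the random walk on $G$ is always somewhere at most diffusive, or $G$ is non-amenable and the random walk on $G$ is ballistic.
   Context: For a graph $G=(V_G,E_G)$ with graph metric $d_G$ and $S\subseteq V_G$ finite, let $\mu_G(S)=\sum_{x\in S}\deg_G(x)$, let $\partial_E S$ be the set of edges of $G$ with exactly one endpoint in $S$, and for $S\ne\emptyset$ let $\phi_G(S)=|\partial_E S|/\mu_G(S)$. $G$ is amenable if $\inf\{\phi_G(S): S\subseteq V_G\text{ finite}, S\neq\emptyset\}=0$, and non-amenable otherwise. Let $\{X_t\}$ denote simple random walk on $G$. The walk is ballistic if there is a constant $c>0$ such that for all $v\in V_G$ and all integers $t\ge 0$, $\mathbb{E}[d_G(X_0,X_t)^2\mid X_0=v]\ge ct^2$. The walk is always somewhere at most diffusive if there is a constant $c>0$ such that for all integers $t\ge 0$, $\inf_{v\in V_G}\mathbb{E}[d_G(X_0,X_t)^2\mid X_0=v]\le ct$. *)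

(* Defs.v *)
From HB Require Import structures.
From mathcomp Require Import all_boot all_order all_algebra finmap.
From mathcomp Require Import all_classical all_reals all_analysis.

Set Implicit Arguments.
Unset Strict Implicit.
Unset Printing Implicit Defensive.
Import Order.TTheory GRing.Theory Num.Theory.
Import numFieldNormedType.Exports.
Local Open Scope classical_set_scope.
Local Open Scope ring_scope.

Record sgraph := SGraph {
  vert :> choiceType;
  adj : rel vert;
  adj_sym : symmetric adj;
  adj_irr : irreflexive adj
}.

Definition neighbors (G : sgraph) (x : G) : set G := [set y | adj x y].

(* [fset_set A] is [fset0] when [A] is infinite, so [deg] is meaningful only at
   vertices with finitely many neighbors. *)
Definition deg (G : sgraph) (x : G) : nat := #|` fset_set (neighbors x)|.

Definition bounded_degree (G : sgraph) : Prop :=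
  exists D : nat, forall x : G, finite_set (neighbors x) /\ (deg x <= D)%N.

Definition walk (G : sgraph) (n : nat) (x y : G) : Prop :=
  exists p : seq G, [/\ size p = n, path (@adj G) x p & last x p = y].

Definition connected_graph (G : sgraph) : Prop :=
  forall x y : G, exists n, walk n x y.

(* The value 0 for vertices in different components is a dummy. *)
Definition gdist (G : sgraph) (x y : G) : nat :=
  match pselect (exists n, `[< walk n x y >]) with
  | left h => ex_minn h
  | right _ => 0%N
  end.

(* A drawing in the plane R * R: edges are simple arcs, which meet each other
   and the vertices only at common endpoints. *)
Record is_drawing (R : realType) (G : sgraph)
    (pos : G -> R * R) (arc : G -> G -> R -> R * R) : Prop := IsDrawing {
  drawing_pos_inj : injective pos;
  drawing_arc_continuous : forall x y, adj x y ->
    {within `[0, 1], continuous (arc x y)};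
  drawing_arc_inj : forall x y, adj x y ->
    {in `[0, 1] &, injective (arc x y)};
  drawing_arc0 : forall x y, adj x y -> arc x y 0 = pos x;
  drawing_arc1 : forall x y, adj x y -> arc x y 1 = pos y;
  (* [arc x y] and [arc y x] draw the same edge in opposite directions *)
  drawing_arc_rev : forall x y, adj x y ->
    forall s : R, s \in `[0, 1] -> arc y x s = arc x y (1 - s);
  drawing_arc_vertex : forall x y z, adj x y ->
    forall s : R, s \in `]0, 1[ -> arc x y s <> pos z;
  drawing_arc_disjoint : forall x y u v, adj x y -> adj u v ->
    forall s t : R, s \in `]0, 1[ -> t \in `]0, 1[ -> arc x y s = arc u v t ->
    (x = u /\ y = v) \/ (x = v /\ y = u)
}.

Definition planar (R : realType) (G : sgraph) : Prop :=
  exists (pos : G -> R * R) (arc : G -> G -> R -> R * R), is_drawing pos arc.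

Definition edges (G : sgraph) : set {fset G} :=
  [set A | exists x y : G, adj x y /\ A = [fset x; y]%fset].

Definition edge_boundary (G : sgraph) (S : {fset G}) : set {fset G} :=
  [set A | edges A /\ #|` (A `&` S)%fset| = 1%N].

Definition mu (G : sgraph) (S : {fset G}) : nat := (\sum_(x <- S) deg x)%N.

Definition phi (R : realType) (G : sgraph) (S : {fset G}) : R :=
  #|` fset_set (edge_boundary S)|%:R / (mu S)%:R.

Definition amenable (R : realType) (G : sgraph) : Prop :=
  inf [set phi R S | S in [set S : {fset G} | S != fset0]] = 0.

Definition srw_step (R : realType) (G : sgraph) (x y : G) : R :=
  if adj x y then (deg x)%:R^-1 else 0.

(* [P v] is the law of the walk conditioned on X_0 = v.  The first axiom is
   measurability of each [X t] for the discrete sigma-algebra on the (countable)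
   vertex set; the last one is the Markov property together with the transition
   probabilities, in product form. *)
Record is_srw (R : realType) (G : sgraph) (d : measure_display)
    (Omega : measurableType d) (P : G -> probability Omega R)
    (X : nat -> Omega -> G) : Prop := IsSRW {
  srw_measurable : forall t x, measurable (X t @^-1` [set x]);
  srw_start : forall v, P v (X 0%N @^-1` [set v]) = 1%E;
  srw_markov : forall v t (x : nat -> G),
    P v [set w | forall i, (i <= t.+1)%N -> X i w = x i] =
    (P v [set w | forall i, (i <= t)%N -> X i w = x i] *
     (srw_step R (x t) (x t.+1))%:E)%E
}.

(* E[d_G(X_0, X_t)^2 | X_0 = v] *)
Definition mean_sq_displacement (R : realType) (G : sgraph)
    (d : measure_display) (Omega : measurableType d)
    (P : G -> probability Omega R) (X : nat -> Omega -> G)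
    (v : G) (t : nat) : \bar R :=
  'E_(P v)[fun w => (gdist (X 0%N w) (X t w))%:R ^+ 2].

Definition ballistic (R : realType) (G : sgraph)
    (d : measure_display) (Omega : measurableType d)
    (P : G -> probability Omega R) (X : nat -> Omega -> G) : Prop :=
  exists c : R, 0 < c /\
    forall (v : G) (t : nat),
      ((c * t%:R ^+ 2)%:E <= mean_sq_displacement P X v t)%E.

Definition somewhere_at_most_diffusive (R : realType) (G : sgraph)
    (d : measure_display) (Omega : measurableType d)
    (P : G -> probability Omega R) (X : nat -> Omega -> G) : Prop :=
  exists c : R, 0 < c /\
    forall t : nat,
      (ereal_inf (range (fun v => mean_sq_displacement P X v t))
       <= (c * t%:R)%:E)%E.

(* Main.v *)
Require Import Defs.
From HB Require Import structures.
From mathcomp Require Import all_boot all_order all_algebra finmap.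
From mathcomp Require Import all_classical all_reals all_analysis.
From mathcomp Require Import measurable_realfun.
From mathcomp Require Import zify ring lra.

Set Implicit Arguments.
Unset Strict Implicit.
Unset Printing Implicit Defensive.
Import Order.TTheory GRing.Theory Num.Theory.
Import numFieldNormedType.Exports.
Local Open Scope classical_set_scope.
Local Open Scope ring_scope.

(** Write [avg g x] for the mean of [g] over the neighbours of [x].  By the Markov
property, the mean squared displacement after [t] steps from [v] is the
[t]-fold average of [z |-> d(v, z)^2], taken at [v]
([mean_sq_displacementE]).  Both halves of the dichotomy are therefore estimates
on the powers of the operator [avg], in the L2 space weighted by degrees.

Non-amenable graphs.  If every finite set [S] has at least [h * mu S] boundary
edges, the co-area inequality and Cauchy-Schwarz bound the quadratic form of
[avg] by [rho = sqrt (1 - h^2) < 1] times the squared norm ([cheeger]), and by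
polarisation [avg] contracts norms by [rho] ([sqnorm_avg]).  So the walk is in a
finite set [F] at time [t] with probability at most [rho^t * sqrt (mu F)]
([hit_bound]), while a ball of radius [k] has at most [(D + 1)^k] vertices, where [D]
bounds the degrees.  For a small constant [a] and all large [t], the walk is thus
outside the ball of radius [a * t] with probability at least 1/2 ([ballistic_iter]).

Amenable graphs.  Planar graph metrics have Markov type 2, hence the walk started
from the degree distribution on a Folner set [S] moves diffusively as long as it
stays in [S]; a good enough [S] makes the remaining contribution negligible
([exit_bound]), and some starting vertex does at least as well as the average
([diffusive_even]).  Markov type enters through the tail estimate [tail_bound]: the
probability that after [2 * n] steps the walk is in [S], at distance at least
[336 * k] from its start, is [O(n^2 / k^4)].  Summing this over dyadic
[k >= sqrt n] gives a second moment [O(n)].  The tail estimate combines two facts.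

- The displacement of a 1-Lipschitz function [f] along the walk has fourth moment
  [O(n^2)] ([fourth_moment]).  Conjugating two averaging steps by [exp (lam * f)]
  gives a product of two one-step operators in which the increments of [f] are
  centred; no term linear in [lam] survives, and each factor has squared norm at
  most [1 + 32 * lam^2].  Take [lam] of order [n^(-1/2)].

- A random 1-Lipschitz function separates each pair of points at distance
  at least [336 * k] by at least [k], with probability bounded below
  ([far_average]).  It comes from the random partition of Klein, Plotkin and Rao:
  three times over, each piece is cut into randomly shifted breadth-first annuli of
  width [12 * k], and replaced by the components of these.  A ball of radius [k]
  is left uncut with probability at least 1/2 ([unpadded3]); the function is the
  depth inside the piece, capped at [k], with a random sign for each piece.

Planarity bounds the diameter of the pieces ([piece_diam]).  If a piece contained
three points far from each other, the three breadth-first trees that were cut would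
each provide a connected set joined to the three points by disjoint paths
([fat_step]): a K33 minor.  To exclude it from a drawing ([drawing_no_K33]), replace
the arcs by fine polygons; those of disjoint edges of K33 stay disjoint, whereas in
every polygonal drawing of K33 the number of crossings between disjoint edges is odd
([no_polygonal_K33]). *)

(** * Walks inside a set of vertices *)

Section Walks.
Variable G : sgraph.
Implicit Types (U V : set G) (x y z : G).

Fixpoint walk_in (U : set G) (n : nat) (x y : G) : Prop :=
  if n is m.+1 then exists z, [/\ walk_in U m x z, adj z y & U y] else U x /\ x = y.

Lemma walk_in_l U n x y : walk_in U n x y -> U x.
Proof. by elim: n y => [y []|n IH y [z [/IH]]]. Qed.

Lemma walk_in_r U n x y : walk_in U n x y -> U y.
Proof. by case: n => [[? <-]|n [z []]]. Qed.

Lemma walk_in_sub U V n x y : U `<=` V -> walk_in U n x y -> walk_in V n x y.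
Proof.
move=> UV; elim: n y => [y [/UV]|n IH y [z [/IH ? ? /UV]]] //=.
by exists z.
Qed.

Lemma walk_in_cat U n m x y z : walk_in U n x y -> walk_in U m y z -> walk_in U (n + m) x z.
Proof.
move=> xy; elim: m z => [z [_ <-]|m IH z [u [/IH xu uz Uz]]]; first by rewrite addn0.
by rewrite addnS; exists u.
Qed.

Lemma walk_in1 U x y : U x -> U y -> adj x y -> walk_in U 1 x y.
Proof. by move=> Ux Uy xy; exists x. Qed.

Lemma walk_in_sym U n x y : walk_in U n x y -> walk_in U n y x.
Proof.
elim: n y => [y [Ux <-]|n IH y [z [xz zy Uy]]] //.
rewrite -add1n; apply: walk_in_cat (IH _ xz).
by apply: walk_in1 => //; [exact: walk_in_r xz|rewrite adj_sym].
Qed.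

Definition linked U x y := exists n, walk_in U n x y.

Lemma linked_refl U x : U x -> linked U x x.
Proof. by exists 0%N. Qed.

Lemma linked_sym U x y : linked U x y -> linked U y x.
Proof. by case=> n /walk_in_sym; exists n. Qed.

Lemma linked_trans U x y z : linked U x y -> linked U y z -> linked U x z.
Proof. by move=> [n xy] [m yz]; exists (n + m)%N; apply: walk_in_cat xy yz. Qed.

Lemma linked_sub U V x y : U `<=` V -> linked U x y -> linked V x y.
Proof. by move=> UV [n /(walk_in_sub UV)]; exists n. Qed.

Lemma linked_adj U x y : U x -> U y -> adj x y -> linked U x y.
Proof. by exists 1%N; apply: walk_in1. Qed.

Definition connected_in U := forall x y, U x -> U y -> linked U x y.

(** Path metric of the subgraph induced by [U]; the value 0 is a dummy outside the component of [x]. *)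
Definition dist_in U x y : nat :=
  if pselect (exists n, `[< walk_in U n x y >]) is left h then ex_minn h else 0%N.

Lemma dist_inP U x y : linked U x y ->
  walk_in U (dist_in U x y) x y /\ forall n, walk_in U n x y -> (dist_in U x y <= n)%N.
Proof.
case=> n xy; rewrite /dist_in; case: pselect => [h|[]]; last by exists n; apply/asboolP.
case: ex_minnP => m /asboolP xym min; split => // k xyk.
by apply: min; apply/asboolP.
Qed.

Lemma walk_inP n x y : walk n x y <-> walk_in setT n x y.
Proof.
split=> [[p [<-{n} + <-{y}]]|].
  elim/last_ind: p => [//|p y IH]; rewrite rcons_path last_rcons size_rcons.
  by move=> /andP[/IH xy yz]; exists (last x p).
elim: n y => [y [_ <-]|n IH y [z [/IH[p [sp pp lp]] zy _]]]; first by exists [::].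
by exists (rcons p y); rewrite rcons_path last_rcons size_rcons sp pp lp.
Qed.

Lemma gdistE x y : gdist x y = dist_in setT x y.
Proof.
rewrite /gdist /dist_in.
have E : (fun n => `[< walk n x y >]) = (fun n => `[< walk_in setT n x y >]).
  by apply/funext => n; apply: asbool_equiv_eq; exact: walk_inP.
case: pselect => [h1|n1]; case: pselect => [h2|n2] //.
- case: ex_minnP => a /asboolP wa mina; case: ex_minnP => b /asboolP wb minb.
  by apply/eqP; rewrite eqn_leq mina ?minb //; apply/asboolP/walk_inP.
- by case: n2; case: h1 => n /asboolP h; exists n; apply/asboolP/walk_inP.
- by case: n1; case: h2 => n /asboolP h; exists n; apply/asboolP/walk_inP.
Qed.

Section Conn.
Hypothesis Gc : connected_graph G.

Lemma connected_inT : connected_in setT.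
Proof. by move=> x y _ _; have [n /walk_inP] := Gc x y; exists n. Qed.

Lemma gdist_walk x y : walk_in setT (gdist x y) x y.
Proof. by rewrite gdistE; have [] := dist_inP (connected_inT I I : linked _ x y). Qed.

Lemma gdist_le n x y : walk_in setT n x y -> (gdist x y <= n)%N.
Proof. by rewrite gdistE; have [_] := dist_inP (connected_inT I I : linked _ x y); apply. Qed.

Lemma gdist_le_in U n x y : walk_in U n x y -> (gdist x y <= n)%N.
Proof. by move=> /(walk_in_sub (@subsetT _ _)) /gdist_le. Qed.

Lemma gdistxx x : gdist x x = 0%N.
Proof. by apply/eqP; rewrite -leqn0; apply: gdist_le. Qed.

Lemma gdist_sym x y : gdist x y = gdist y x.
Proof. by apply/eqP; rewrite eqn_leq !gdist_le //; apply: walk_in_sym; apply: gdist_walk. Qed.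

Lemma gdist_tri x y z : (gdist x z <= gdist x y + gdist y z)%N.
Proof. by apply: gdist_le; apply: walk_in_cat; apply: gdist_walk. Qed.

Lemma gdist_adj x y : adj x y -> (gdist x y <= 1)%N.
Proof. by move=> xy; apply: gdist_le; apply: walk_in1. Qed.

Lemma gdist_eq0 x y : gdist x y = 0%N -> x = y.
Proof. by move=> d0; have := gdist_walk x y; rewrite d0 => -[]. Qed.

End Conn.
End Walks.

(** * Parity of the crossings of polygons *)

Section Parity.
Variable R : realType.
Local Notation pt := (R * R)%type.
Implicit Types (p q u v x y : pt).

Definition seg_meet u v x y : Prop := exists s t : R,
  [/\ 0 <= s <= 1, 0 <= t <= 1,
      u.1 + s * (v.1 - u.1) = x.1 + t * (y.1 - x.1) &
      u.2 + s * (v.2 - u.2) = x.2 + t * (y.2 - x.2)].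

Lemma seg_meet_sym u v x y : seg_meet u v x y -> seg_meet x y u v.
Proof. by move=> [s [t [s01 t01 e1 e2]]]; exists t, s; split. Qed.

Lemma seg_meet_revl u v x y : seg_meet v u x y -> seg_meet u v x y.
Proof.
move=> [s [t [/andP[s0 s1] t01 e1 e2]]]; exists (1 - s), t; split => //.
- by apply/andP; split; lra.
- by rewrite -e1; ring.
- by rewrite -e2; ring.
Qed.

(** Meaningless on vertical segments, but [inx] is never true of these. *)
Definition line u v (c : R) : R := u.2 + (v.2 - u.2) * ((c - u.1) / (v.1 - u.1)).

(** Half-open form of: the abscissa of [p] lies between those of [u] and [v].  It is a sum
    of a function of [u] and a function of [v], hence telescopes along polygons. *)
Definition inx p u v : bool := (u.1 < p.1) (+) (v.1 < p.1).
Definition below p u v : bool := inx p u v && (p.2 < line u v p.1).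
Definition above p u v : bool := inx p u v && ~~ (p.2 < line u v p.1).

Lemma aboveE p u v : above p u v = inx p u v (+) below p u v.
Proof. by rewrite /above /below; case: inx; case: (_ < _). Qed.

Lemma line_rev u v c : u.1 != v.1 -> line u v c = line v u c.
Proof. by move=> uv; rewrite /line; field; rewrite !subr_eq0 uv eq_sym uv. Qed.

Lemma inx_rev p u v : inx p u v = inx p v u.
Proof. by rewrite /inx addbC. Qed.

Lemma inx_between p u v : u.1 <= v.1 -> inx p u v -> u.1 < p.1 <= v.1.
Proof. by rewrite /inx; case: (ltP u.1 p.1); case: (ltP v.1 p.1) => //=; lra. Qed.

Lemma below_rev p u v : below p u v = below p v u.
Proof.
rewrite /below inx_rev; case: (eqVneq u.1 v.1) => [e|ne]; last by rewrite line_rev.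
by rewrite /inx e addbb.
Qed.

Lemma above_rev p u v : above p u v = above p v u.
Proof. by rewrite !aboveE inx_rev below_rev. Qed.

(** The difference of the two heights is affine in the abscissa, so a change of sign
    between [l] and [r] forces a zero in between. *)
Lemma cross_line u v x y (l r : R) : u.1 < v.1 -> x.1 < y.1 ->
  u.1 <= l <= v.1 -> x.1 <= l <= y.1 -> u.1 <= r <= v.1 -> x.1 <= r <= y.1 ->
  line x y l <= line u v l -> line u v r <= line x y r -> seg_meet u v x y.
Proof.
move=> uv xy /andP[ul lv] /andP[xl ly] /andP[ur rv] /andP[xr ry] hl hr.
pose D c := line x y c - line u v c.
suff [c [Dc uc cv xc cy]] : exists c, [/\ D c = 0, u.1 <= c, c <= v.1, x.1 <= c & c <= y.1].
  exists ((c - u.1) / (v.1 - u.1)), ((c - x.1) / (y.1 - x.1)).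
  have vu0 : 0 < v.1 - u.1 by lra.
  have yx0 : 0 < y.1 - x.1 by lra.
  split.
  - by rewrite ler_pdivlMr // ler_pdivrMr // mul0r mul1r; apply/andP; split; lra.
  - by rewrite ler_pdivlMr // ler_pdivrMr // mul0r mul1r; apply/andP; split; lra.
  - by field; rewrite !gt_eqF.
  - by move: Dc; rewrite /D /line; lra.
have Dl : D l <= 0 by rewrite /D; lra.
have Dr : 0 <= D r by rewrite /D; lra.
have [e|ne] := eqVneq (D r - D l) 0; first by exists l; split => //; lra.
have gt : 0 < D r - D l by rewrite lt_neqAle eq_sym ne /=; lra.
(* the zero of the affine function [D], as a barycentre of [l] and [r] *)
pose w := D r / (D r - D l).
have w0 : 0 <= w by apply: divr_ge0 => //; exact: ltW.
have w1 : w <= 1 by rewrite ler_pdivrMr // mul1r; lra.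
exists (w * l + (1 - w) * r).
have aff : D (w * l + (1 - w) * r) = w * D l + (1 - w) * D r.
  rewrite /D /line; field; rewrite !subr_eq0 !gt_eqF //.
split; [|nra..].
rewrite aff /w; field => //.
Qed.

Definition seg_good u v x y : Prop :=
  ~ seg_meet u v x y /\
  [/\ u.1 != x.1, u.1 != y.1, v.1 != x.1 & v.1 != y.1].

(** The abscissae where both segments live form an interval, each end of which is an
    end of exactly one of the segments; [L], the order of the two heights, has the same
    value at both ends, so its two occurrences cancel. *)
Lemma overlap_parity (a b c d : R) (L : R -> bool) :
  a < b -> c < d -> a != c -> a != d -> b != c -> b != d ->
  (forall l r : R, a <= l <= b -> c <= l <= d -> a <= r <= b -> c <= r <= d -> L l = L r) ->
  ((c < a) (+) (d < a)) && L a (+) ((c < b) (+) (d < b)) && L b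
  (+) ((a < c) (+) (b < c)) && L c (+) ((a < d) (+) (b < d)) && L d = false.
Proof.
move=> ab cd ac ad bc bd H.
case: (ltgtP a c) ac => // h1 _; case: (ltgtP a d) ad => // h2 _;
case: (ltgtP b c) bc => // h3 _; case: (ltgtP b d) bd => // h4 _ /=; try by lra.
all: rewrite ?addbF.
- by have -> : L b = L c; [apply: H; apply/andP; split; rewrite ?lexx // ltW | rewrite addbb].
- by have -> : L c = L d; [apply: H; apply/andP; split; rewrite ?lexx // ltW | rewrite addbb].
- by have -> : L a = L b; [apply: H; apply/andP; split; rewrite ?lexx // ltW | rewrite addbb].
- by have -> : L a = L d; [apply: H; apply/andP; split; rewrite ?lexx // ltW | rewrite addbb].
Qed.

(** In general position the left-hand side is the number of crossings of the two segments
    modulo 2.  As each term involves an endpoint of one segment and the whole of the other,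
    its sum over two polygons telescopes to terms attached to their four ends
    ([chain_chain_parity]). *)
Lemma seg_parity u v x y : seg_good u v x y ->
  below u x y (+) below v x y (+) above x u v (+) above y u v = false.
Proof.
wlog uv : u v / u.1 <= v.1 => [H|].
  case: (leP u.1 v.1) => [/H//|/ltW vu] [nm [h1 h2 h3 h4]].
  rewrite [below u x y (+) _]addbC (above_rev x) (above_rev y).
  by apply: H => //; split=> // /seg_meet_revl.
wlog xy : x y / x.1 <= y.1 => [H|].
  case: (leP x.1 y.1) => [/H//|/ltW vu] [nm [h1 h2 h3 h4]].
  rewrite -addbA [above x _ _ (+) _]addbC addbA (below_rev u) (below_rev v).
  apply: H => //; split=> //.
  by move=> m; apply: nm; apply: seg_meet_sym; apply: seg_meet_revl; apply: seg_meet_sym.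
case=> nm [ux uy vx vy].
(* vertical segments come first: they have no point strictly between their abscissae *)
have [vv|uv'] : (u.1 = v.1) \/ (u.1 < v.1) by move: uv; rewrite le_eqVlt => /orP[/eqP|]; [left|right].
  have [xx|xy'] : (x.1 = y.1) \/ (x.1 < y.1) by move: xy; rewrite le_eqVlt => /orP[/eqP|]; [left|right].
    by rewrite /above /below /inx vv xx !addbb.
  rewrite /above /below {3 4}/inx vv !addbb /= !addbF.
  have -> : inx u x y = inx v x y by rewrite /inx vv.
  case I : (inx v x y) => //=.
  have [xv vy'] : x.1 < v.1 /\ v.1 < y.1.
    have /andP[h1 h2] := inx_between xy I; split=> //.
    by rewrite lt_neqAle vy.
  have xy0 : 0 < y.1 - x.1 by lra.
  apply/negbTE/negP => d; apply: nm.
  pose L := line x y v.1.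
  have uv2 : v.2 - u.2 != 0.
    apply/eqP => e; have e2 : v.2 = u.2 by lra.
    by move: d; rewrite e2 addbb.
  exists ((L - u.2) / (v.2 - u.2)), ((v.1 - x.1) / (y.1 - x.1)); split.
  - move: d; rewrite -/L => d.
    have [gt|lt] : (0 < v.2 - u.2) \/ (v.2 - u.2 < 0).
      by move: uv2; rewrite neq_lt => /orP[]; [right|left].
      rewrite ler_pdivlMr // ler_pdivrMr // mul0r mul1r.
      by move: d; case: (ltP u.2 L); case: (ltP v.2 L) => //=; lra.
    rewrite ler_ndivlMr // ler_ndivrMr // mul0r mul1r.
    by move: d; case: (ltP u.2 L); case: (ltP v.2 L) => //=; lra.
  - by rewrite ler_pdivlMr // ler_pdivrMr // mul0r mul1r; apply/andP; split; lra.
  - by rewrite vv; field; rewrite gt_eqF.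
  - rewrite /L /line; field; rewrite uv2 gt_eqF //.
have uv0 : 0 < v.1 - u.1 by lra.
have [xx|xy'] : (x.1 = y.1) \/ (x.1 < y.1) by move: xy; rewrite le_eqVlt => /orP[/eqP|]; [left|right].
  rewrite /above /below {1 2}/inx xx !addbb /=.
  have -> : inx x u v = inx y u v by rewrite /inx xx.
  case I : (inx y u v) => //=.
  have [xv vy'] : u.1 < y.1 /\ y.1 < v.1.
    have /andP[h1 h2] := inx_between uv I; split=> //.
    by rewrite lt_neqAle eq_sym vy.
  apply/negbTE/negP => d; apply: nm.
  pose L := line u v y.1.
  have uv2 : y.2 - x.2 != 0.
    apply/eqP => e; have e2 : y.2 = x.2 by lra.
    by move: d; rewrite e2 addbb.
  exists ((y.1 - u.1) / (v.1 - u.1)), ((L - x.2) / (y.2 - x.2)); split.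
  - by rewrite ler_pdivlMr // ler_pdivrMr // mul0r mul1r; apply/andP; split; lra.
  - move: d; rewrite -/L => d.
    have [gt|lt] : (0 < y.2 - x.2) \/ (y.2 - x.2 < 0).
      by move: uv2; rewrite neq_lt => /orP[]; [right|left].
      rewrite ler_pdivlMr // ler_pdivrMr // mul0r mul1r.
      by move: d; case: (ltP x.2 L); case: (ltP y.2 L) => //=; lra.
    rewrite ler_ndivlMr // ler_ndivrMr // mul0r mul1r.
    by move: d; case: (ltP x.2 L); case: (ltP y.2 L) => //=; lra.
  - by rewrite xx; field; rewrite ?uv2 ?gt_eqF.
  - rewrite /L /line; field; rewrite uv2 gt_eqF //.
have C (l r : R) : u.1 <= l <= v.1 -> x.1 <= l <= y.1 -> u.1 <= r <= v.1 -> x.1 <= r <= y.1 ->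
  line u v l < line x y l -> ~~ (line u v r < line x y r) -> False.
  move=> a1 a2 a3 a4 h1; rewrite -leNgt => h2; apply: nm.
  by apply: (@cross_line u v x y r l) => //; apply: ltW.
have lu a b : a.1 < b.1 -> line a b a.1 = a.2 by move=> ?; rewrite /line subrr mul0r mulr0 addr0.
have lv a b : a.1 < b.1 -> line a b b.1 = b.2.
  by move=> ab; rewrite /line; field; rewrite subr_eq0 gt_eqF.
have C2 (l r : R) : u.1 <= l <= v.1 -> x.1 <= l <= y.1 -> u.1 <= r <= v.1 -> x.1 <= r <= y.1 ->
  (line u v l < line x y l) = (line u v r < line x y r).
  move=> a1 a2 a3 a4; apply/idP/idP => h; apply/negPn/negP => h'.
    by apply: (C l r).
  by apply: (C r l).
have nle p (a b : pt) : line a b p.1 != p.2 -> ~~ (p.2 < line a b p.1) = (line a b p.1 < p.2).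
  by move=> ne; rewrite -leNgt lt_neqAle ne.
have eqx : inx x u v -> line u v x.1 != x.2.
  move=> I; apply/eqP => e; apply: nm; apply: (@cross_line u v x y x.1 x.1) => //.
  1-4: by have /andP[h1 h2] := inx_between uv I; apply/andP; split; lra.
  - by rewrite lu // e.
  - by rewrite lu // e.
have eqy : inx y u v -> line u v y.1 != y.2.
  move=> I; apply/eqP => e; apply: nm; apply: (@cross_line u v x y y.1 y.1) => //.
  1-4: by have /andP[h1 h2] := inx_between uv I; apply/andP; split; lra.
  - by rewrite lv // e.
  - by rewrite lv // e.
have -> : above x u v = inx x u v && (line u v x.1 < line x y x.1).
  by rewrite /above lu //; case: (inx x u v) eqx => //= /(_ isT)/nle.
have -> : above y u v = inx y u v && (line u v y.1 < line x y y.1).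
  by rewrite /above [line x y _]lv //; case: (inx y u v) eqy => //= /(_ isT)/nle.
have -> : below u x y = inx u x y && (line u v u.1 < line x y u.1) by rewrite /below lu.
have -> : below v x y = inx v x y && (line u v v.1 < line x y v.1).
  by rewrite /below [line u v _]lv.
by rewrite /inx; apply: (overlap_parity (L := fun c => line u v c < line x y c)).
Qed.

End Parity.

Section PolygonalK33.
Variable R : realType.
Local Notation pt := (R * R)%type.

Definition segs (T : Type) (x : T) (s : seq T) : seq (T * T) := zip (x :: s) s.

Lemma segs_head (T : eqType) (x y : T) s : (x, y) \in segs x (y :: s).
Proof. exact: mem_head. Qed.

Lemma segs_tail (T : eqType) (x y : T) s e : e \in segs y s -> e \in segs x (y :: s).
Proof. by move=> h; rewrite /segs /= inE; apply/orP; right. Qed.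

Fixpoint chain_below (p x : pt) (s : seq pt) : bool :=
  if s is y :: s' then below p x y (+) chain_below p y s' else false.

Fixpoint chain_above (p x : pt) (s : seq pt) : bool :=
  if s is y :: s' then above p x y (+) chain_above p y s' else false.

(** Passing between the counts above and below [p] costs only the position of the end
    points of the polygon, by telescoping. *)
Lemma chain_aboveE p x s : chain_above p x s = inx p x (last x s) (+) chain_below p x s.
Proof.
elim: s x => [x|y s IH x] /=; first by rewrite /inx addbb.
rewrite IH aboveE /inx; case: (_ < _); case: (_ < _); case: (_ < _);
 case: below; case: chain_below => //.
Qed.

Lemma seg_chain_parity u v x (s : seq pt) :
  (forall f : pt * pt, f \in segs x s -> seg_good u v f.1 f.2) ->
  chain_below u x s (+) chain_below v x s (+) above x u v (+) above (last x s) u v = false.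
Proof.
elim: s x => [x _|y s IH x H] /=; first by rewrite addbb.
have h1 := seg_parity (H (x, y) (segs_head _ _ _)).
have := IH y (fun f hf => H f (segs_tail _ hf)).
move: h1 => /=.
case: (above x u v); case: (above y u v); case: (above _ u v);
 case: (below u); case: (below v); case: (chain_below u); case: (chain_below v) => //.
Qed.

Lemma chain_chain_parity u (r : seq pt) x (s : seq pt) :
  (forall e f : pt * pt, e \in segs u r -> f \in segs x s -> seg_good e.1 e.2 f.1 f.2) ->
  chain_below u x s (+) chain_below (last u r) x s (+) chain_above x u r (+) chain_above (last x s) u r = false.
Proof.
elim: r u => [u _|v r IH u H] /=; first by rewrite addbb.
have := seg_chain_parity (fun f hf => H (u, v) f (segs_head _ _ _) hf).
have := IH v (fun e f he hf => H e f (segs_tail _ he) hf).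
move=> /=.
case: (above x u v); case: (above _ u v); case: (chain_above x v); case: (chain_above _ v);
 case: (chain_below u); case: (chain_below v); case: (chain_below _) => //.
Qed.

(** Boolean quantification that [vm_compute] evaluates, for tautologies with many variables. *)
Definition all_bools (f : bool -> bool) := f true && f false.

Lemma all_boolsP f : all_bools f -> forall b, f b.
Proof. by case/andP => ? ? []. Qed.

Local Notation I3 := 'I_3.
Let o0 : I3 := inord 0.
Let o1 : I3 := inord 1.
Let o2 : I3 := inord 2.

Lemma neq_o012 : [/\ o0 != o1, o0 != o2 & o1 != o2].
Proof. by rewrite /o0 /o1 /o2; split; apply/eqP => /(congr1 val); rewrite /= !inordK. Qed.

(** The variables are the relations of [parity_pair] for the two pairs of disjoint edges
    between {ai, ak} and {bj, bl}: [bjkl] is the position of bj below the polygon from ak to bl,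
    [ojk] the order of bj and ak, and so on.  In the sum of the two relations, the order of bj
    and bl occurs once in each direction, which leaves the constant 1. *)
Lemma square_parity (bjkl blkj blij bjil : bool) (aikl aikj akij akil : bool)
   (oik ojk oil olk oij ojl : bool) :
  aikl (+) bjkl (+) (oik (+) ojk (+) akij) (+) (oil (+) ojl (+) blij) = false ->
  aikj (+) blkj (+) (oik (+) olk (+) akil) (+) (oij (+) ~~ ojl (+) bjil) = false ->
  bjkl (+) blkj (+) (blij (+) bjil) =
   ~~ ((aikl (+) akil (+) olk (+) oil) (+) (aikj (+) akij (+) ojk (+) oij)).
Proof.
have H : all_bools (fun bjkl => all_bools (fun blkj => all_bools (fun blij => all_bools (fun bjil => all_bools (fun aikl => all_bools (fun aikj => all_bools (fun akij => all_bools (fun akil => all_bools (fun oik => all_bools (fun ojk => all_bools (fun oil => all_bools (fun olk => all_bools (fun oij => all_bools (fun ojl => 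
   (aikl (+) bjkl (+) (oik (+) ojk (+) akij) (+) (oil (+) ojl (+) blij) == false) ==>
   (aikj (+) blkj (+) (oik (+) olk (+) akil) (+) (oij (+) ~~ ojl (+) bjil) == false) ==>
   (bjkl (+) blkj (+) (blij (+) bjil) ==
   ~~ ((aikl (+) akil (+) olk (+) oil) (+) (aikj (+) akij (+) ojk (+) oij))))))))))))))))) by vm_compute.
move: (all_boolsP H bjkl) => {}H.
move: (all_boolsP H blkj) => {}H.
move: (all_boolsP H blij) => {}H.
move: (all_boolsP H bjil) => {}H.
move: (all_boolsP H aikl) => {}H.
move: (all_boolsP H aikj) => {}H.
move: (all_boolsP H akij) => {}H.
move: (all_boolsP H akil) => {}H.
move: (all_boolsP H oik) => {}H.
move: (all_boolsP H ojk) => {}H.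
move: (all_boolsP H oil) => {}H.
move: (all_boolsP H olk) => {}H.
move: (all_boolsP H oij) => {}H.
move: (all_boolsP H ojl) => {}H.
by move=> h1 h2; move: H; rewrite h1 h2 => /eqP.
Qed.

(** Distinctness of the points is not a consequence of the first clause when one of the
    polygons is a single point. *)
Definition chain_sep (u : pt) (r : seq pt) (x : pt) (s : seq pt) : Prop :=
  (forall e f : pt * pt, e \in segs u r -> f \in segs x s -> ~ seg_meet e.1 e.2 f.1 f.2) /\
  (forall p q : pt, p \in u :: r -> q \in x :: s -> p <> q).

Lemma mem_segs (T : eqType) (x : T) s e : e \in segs x s -> e.1 \in x :: s /\ e.2 \in x :: s.
Proof.
elim: s x => [//|y s IH x]; rewrite /segs /= inE => /orP[/eqP->|/IH[h1 h2]] /=.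
  by rewrite !inE !eqxx orbT.
by split; rewrite in_cons; apply/orP; right.
Qed.

(** [chain_chain_parity] for the edges ai bj and ak bl, with [chain_above] eliminated. *)
Lemma parity_pair (a b : I3 -> pt) (c : I3 -> I3 -> seq pt) :
  (forall i j, last (a i) (c i j) = b j) ->
  (forall i j k l, i != k -> j != l -> chain_sep (a i) (c i j) (a k) (c k l) /\
     (forall p q : pt, p \in a i :: c i j -> q \in a k :: c k l -> p.1 != q.1)) ->
  forall i j k l, i != k -> j != l ->
   chain_below (a i) (a k) (c k l) (+) chain_below (b j) (a k) (c k l)
   (+) (((a i).1 < (a k).1) (+) ((b j).1 < (a k).1) (+) chain_below (a k) (a i) (c i j))
   (+) (((a i).1 < (b l).1) (+) ((b j).1 < (b l).1) (+) chain_below (b l) (a i) (c i j)) = false.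
Proof.
move=> lc H i j k l ik jl; have [[h1 h2] h3] := H i j k l ik jl.
have := @chain_chain_parity (a i) (c i j) (a k) (c k l) _.
rewrite !lc !chain_aboveE !lc /inx; apply => e f he hf.
have [e1 e2] := mem_segs he; have [f1 f2] := mem_segs hf.
by split; [exact: h1|split; exact: h3].
Qed.

(** Let T k be the number modulo 2 of incidences in which some bj is below the edge from ak to
    another bl.  The three relations of [square_parity] for the pair i, k add up to
    T i + T k = 1, as the terms attached to each bj occur twice.  This is impossible for three
    indices. *)
Lemma no_polygonal_K33_generic (a b : I3 -> pt) (c : I3 -> I3 -> seq pt) :
  (forall i j, last (a i) (c i j) = b j) ->
  (forall i j k l, i != k -> j != l -> chain_sep (a i) (c i j) (a k) (c k l) /\
     (forall p q : pt, p \in a i :: c i j -> q \in a k :: c k l -> p.1 != q.1)) ->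
  False.
Proof.
move=> lc H; have P := parity_pair lc H.
have ob j l : j != l -> ((b l).1 < (b j).1) = ~~ ((b j).1 < (b l).1).
  move=> jl; have [n01 _ _] := neq_o012.
  have [_ h] := H o0 j o1 l n01 jl.
  have : (b j).1 != (b l).1 by apply: h; [rewrite -(lc o0 j)|rewrite -(lc o1 l)]; rewrite mem_last.
  by case: ltgtP.
pose Q k j l := chain_below (b j) (a k) (c k l) (+) chain_below (b l) (a k) (c k j).
have S i k j l (ik : i != k) (jl : j != l) :
    Q k j l (+) Q i j l = ~~ (
     (chain_below (a i) (a k) (c k l) (+) chain_below (a k) (a i) (c i l) (+) ((b l).1 < (a k).1) (+) ((a i).1 < (b l).1)) (+)
     (chain_below (a i) (a k) (c k j) (+) chain_below (a k) (a i) (c i j) (+) ((b j).1 < (a k).1) (+) ((a i).1 < (b j).1))).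
  have h1 := P i j k l ik jl.
  have h2 := P i l k j ik ltac:(by rewrite eq_sym).
  rewrite (ob _ _ jl) in h2.
  rewrite -(square_parity h1 h2) /Q.
  by congr (_ (+) _); rewrite addbC.
have [n01 n02 n12] := neq_o012.
pose T k := Q k o0 o1 (+) Q k o0 o2 (+) Q k o1 o2.
have TT i k : i != k -> T i (+) T k = true.
  move=> ik.
  have := S i k _ _ ik n01; have := S i k _ _ ik n02; have := S i k _ _ ik n12.
  rewrite /T; set z0 := (_ (+) (_ < (b o0).1)); set z1 := (_ (+) (_ < (b o1).1)).
  set z2 := (_ (+) (_ < (b o2).1)).
  case: (Q i o0 o1); case: (Q i o0 o2); case: (Q i o1 o2);
  case: (Q k o0 o1); case: (Q k o0 o2); case: (Q k o1 o2); case: z0; case: z1; case: z2 => //.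
have := TT _ _ n01; have := TT _ _ n02; have := TT _ _ n12.
by case: (T o0); case: (T o1); case: (T o2).
Qed.

Lemma exists_notin (s : seq R) : exists x, x \notin s.
Proof.
exists (1 + \sum_(y <- s) `|y|); apply/negP => h.
have : `|1 + \sum_(y <- s) `|y| | <= \sum_(y <- s) `|y|.
  by rewrite [leRHS](big_rem _ h) /= lerDl sumr_ge0.
rewrite ger0_norm ?addr_ge0 ?sumr_ge0 //; lra.
Qed.

(** A generic shear makes the abscissae of finitely many points distinct. *)
Definition shear (t : R) (p : pt) : pt := (p.1 + t * p.2, p.2).

Lemma seg_meet_shear t u v x y :
  seg_meet (shear t u) (shear t v) (shear t x) (shear t y) -> seg_meet u v x y.
Proof.
move=> [s [r [s01 r01 /= e1 e2]]]; exists s, r; split => //.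
have -> : u.1 + s * (v.1 - u.1) =
  (u.1 + t * u.2 + s * (v.1 + t * v.2 - (u.1 + t * u.2))) - t * (u.2 + s * (v.2 - u.2)) by ring.
by rewrite e1 e2; ring.
Qed.

Lemma segs_map (T U : eqType) (f : T -> U) x s e : e \in segs (f x) (map f s) ->
  exists2 e', e' \in segs x s & e = (f e'.1, f e'.2).
Proof.
elim: s x => [//|y s IH x]; rewrite /segs /= inE => /orP[/eqP->|/IH[e' h ->]] /=.
  by exists (x, y) => //; rewrite inE eqxx.
by exists e' => //; rewrite inE; apply/orP; right.
Qed.

(** The parity argument excludes polygonal drawings of K33 in which only the polygons of
    disjoint edges are asked to be disjoint; those of adjacent edges may overlap in any way,
    which allows edges of a minor to be drawn along walks. *)
Lemma no_polygonal_K33 (a b : I3 -> pt) (c : I3 -> I3 -> seq pt) :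
  (forall i j, last (a i) (c i j) = b j) ->
  (forall i j k l, i != k -> j != l -> chain_sep (a i) (c i j) (a k) (c k l)) ->
  False.
Proof.
move=> lc H.
pose pts := flatten [seq a i :: c i j | i <- enum I3, j <- enum I3].
have ptsP i j p : p \in a i :: c i j -> p \in pts.
  move=> h; apply/flattenP; exists (a i :: c i j) => //.
  by apply/allpairsP; exists (i, j); rewrite !mem_enum.
have [t ht] := exists_notin [seq (q.1 - p.1) / (p.2 - q.2) | p <- pts, q <- pts].
apply: (@no_polygonal_K33_generic (shear t \o a) (shear t \o b)
  (fun i j => map (shear t) (c i j))) => [i j|i j k l ik jl] /=.
  by rewrite last_map lc.
have [h1 h2] := H i j k l ik jl.
have ne p q : p \in shear t (a i) :: [seq shear t i0 | i0 <- c i j] ->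
  q \in shear t (a k) :: [seq shear t i0 | i0 <- c k l] -> p.1 != q.1.
  rewrite -!map_cons => /mapP[p' hp ->] /mapP[q' hq ->] /=.
  apply/eqP => e; move/negP: ht; apply; apply/allpairsP; exists (p', q').
  rewrite (ptsP _ _ _ hp) (ptsP _ _ _ hq); split => //=.
  have [e2|ne2] := eqVneq p'.2 q'.2.
    exfalso; apply: (h2 p' q') => //; move: e e2; case: p' {hp} => ? ?; case: q' {hq} => ? ? /= e e2.
    by move: e; rewrite e2 => /addIr ->.
  have ne3 : p'.2 - q'.2 != 0 by rewrite subr_eq0.
  by apply: (mulIf ne3); rewrite mulfVK //; lra.
split=> //; split => [e f|p q hp hq epq].
  move=> /segs_map[e' he ->] /segs_map[f' hf ->] /= /seg_meet_shear.
  exact: h1.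
by have := ne p q hp hq; rewrite epq eqxx.
Qed.

End PolygonalK33.

(** * From arcs to polygons *)

Section Curves.
Variable R : realType.
Local Notation pt := (R * R)%type.
Implicit Types (g h : R -> pt).

Lemma curve_modulus g (s e : R) : {within `[0, 1], continuous g} ->
  0 <= s <= 1 -> 0 < e -> exists2 d : R, 0 < d & forall s', 0 <= s' <= 1 -> `|s - s'| < d ->
    `|(g s).1 - (g s').1| < e /\ `|(g s).2 - (g s').2| < e.
Proof.
move=> /subspace_continuousP cg s01 e0.
have /cg/cvg_ballP/(_ e e0) : `[0, 1]%classic s by rewrite /= in_itv.
rewrite near_withinE => /nbhs_ballP[d /= d0 H]; exists d => // s' s'01 ss'.
by have [] := H s' ss' _; rewrite /= ?in_itv.
Qed.

Lemma seg_near (a b c d e s : R) : 0 <= s <= 1 -> `|a - b| < e -> `|a - c| < e ->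
  d = b + s * (c - b) -> `|a - d| < e.
Proof.
move=> /andP[s0 s1]; rewrite !ltr_norml => /andP[h1 h2] /andP[h3 h4] ->.
have [-> |sn0] := eqVneq s 0; first by rewrite mul0r addr0 h1.
have sp : 0 < s by rewrite lt_neqAle eq_sym sn0.
have p1 : 0 < s * (e - (a - c)) by apply: mulr_gt0 => //; lra.
have p2 : 0 < s * (e + (a - c)) by apply: mulr_gt0 => //; lra.
have p3 : 0 <= (1 - s) * (e - (a - b)) by apply: mulr_ge0; lra.
have p4 : 0 <= (1 - s) * (e + (a - b)) by apply: mulr_ge0; lra.
by apply/andP; split; lra.
Qed.

(** Fine enough samplings of two disjoint arcs have disjoint segments.  Near a pair of
    parameters, the four sampled points are close to two distinct points, and this is uniform
    because the square of parameters is compact. *)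
Lemma curves_separated g h : {within `[0, 1], continuous g} ->
  {within `[0, 1], continuous h} ->
  (forall s t, 0 <= s <= 1 -> 0 <= t <= 1 -> g s <> h t) ->
  \forall N \near \oo, forall s1 s2 t1 t2 : R, 0 <= s1 <= 1 -> 0 <= s2 <= 1 ->
    0 <= t1 <= 1 -> 0 <= t2 <= 1 ->
    `|s1 - s2| <= N.+1%:R^-1 -> `|t1 - t2| <= N.+1%:R^-1 ->
    ~ seg_meet (g s1) (g s2) (h t1) (h t2).
Proof.
move=> cg ch disj.
have K : compact (`[0 : R, 1]%classic `*` `[0 : R, 1]%classic).
  by apply: compact_setX; apply: segment_compact.
move/compact_near_coveringP/near_covering_withinP : K => /(_ nat \oo
  (fun N z => forall s2 t2 : R, 0 <= s2 <= 1 -> 0 <= t2 <= 1 ->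
    `|z.1 - s2| <= N.+1%:R^-1 -> `|z.2 - t2| <= N.+1%:R^-1 ->
    ~ seg_meet (g z.1) (g s2) (h z.2) (h t2))) H.
have {}H : \forall N \near \oo, `[0 : R, 1]%classic `*` `[0 : R, 1]%classic `<=`
  (fun z => forall s2 t2 : R, 0 <= s2 <= 1 -> 0 <= t2 <= 1 ->
    `|z.1 - s2| <= N.+1%:R^-1 -> `|z.2 - t2| <= N.+1%:R^-1 ->
    ~ seg_meet (g z.1) (g s2) (h z.2) (h t2)).
  apply: H => -[s t] /= [s01 t01]; rewrite !in_itv /= in s01 t01.
  have [e e0 he] : exists2 e : R, 0 < e &
      e + e <= `|(g s).1 - (h t).1| \/ e + e <= `|(g s).2 - (h t).2|.
    have := disj s t s01 t01; case: (g s) => a b; case: (h t) => c d /= ne.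
    have [eac|nac] := eqVneq a c.
      have nbd : b != d by apply/eqP => ebd; apply: ne; rewrite eac ebd.
      exists (`|b - d| / 2); last by right; lra.
      by rewrite divr_gt0 // normr_gt0 subr_eq0.
    exists (`|a - c| / 2); last by left; lra.
    by rewrite divr_gt0 // normr_gt0 subr_eq0.
  have [d1 d10 hd1] := curve_modulus cg s01 e0.
  have [d2 d20 hd2] := curve_modulus ch t01 e0.
  pose d := Num.min d1 d2 / 2.
  have d0 : 0 < d by rewrite divr_gt0 // lt_min d10.
  have d2d1 : d + d <= d1.
    have : Num.min d1 d2 <= d1 by rewrite ge_min lexx.
    by rewrite /d; lra.
  have d2d2 : d + d <= d2.
    have : Num.min d1 d2 <= d2 by rewrite ge_min lexx orbT.
    by rewrite /d; lra.
  exists (ball s d `*` ball t d, [set N : nat | N.+1%:R^-1 < d]).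
    split; last exact: (near_infty_natSinv_lt (PosNum d0)).
    by exists (ball s d, ball t d) => //; split; apply: nbhsx_ballx.
  move=> [[s1 t1] N] /= [[bs bt] Nd] [s101 t101] s2 t2 s201 t201 ss tt.
  rewrite !in_itv /= in s101 t101; rewrite /ball /= in bs bt; rewrite /= in ss tt.
  move: (N.+1%:R^-1 : R) Nd ss tt => r Nd ss tt.
  clearbody d.
  have s1s : `|s - s1| < d1 by lra.
  have t1t : `|t - t1| < d2 by lra.
  have s2s : `|s - s2| < d1.
    have -> : s - s2 = (s - s1) + (s1 - s2) by ring.
    by apply: le_lt_trans (ler_normD _ _) _; lra.
  have t2t : `|t - t2| < d2.
    have -> : t - t2 = (t - t1) + (t1 - t2) by ring.
    by apply: le_lt_trans (ler_normD _ _) _; lra.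
  have [a1 a2] := hd1 _ s101 s1s; have [a3 a4] := hd1 _ s201 s2s.
  have [b1 b2] := hd2 _ t101 t1t; have [b3 b4] := hd2 _ t201 t2t.
  move=> [p [q [p01 q01 e1 e2]]].
  have l1 := seg_near p01 a1 a3 erefl; have l2 := seg_near p01 a2 a4 erefl.
  have m1 := seg_near q01 b1 b3 e1; have m2 := seg_near q01 b2 b4 e2.
  case: he => he.
    have : `|(g s).1 - (h t).1| < e + e; last by lra.
    set w := (g s1).1 + _ in l1 m1.
    have -> : (g s).1 - (h t).1 = ((g s).1 - w) - ((h t).1 - w) by ring.
    by apply: le_lt_trans (ler_normB _ _) _; lra.
  have : `|(g s).2 - (h t).2| < e + e; last by lra.
  set w := (g s1).2 + _ in l2 m2.
  have -> : (g s).2 - (h t).2 = ((g s).2 - w) - ((h t).2 - w) by ring.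
  by apply: le_lt_trans (ler_normB _ _) _; lra.
near=> N => s1 s2 t1 t2 s101 s201 t101 t201 ss tt.
suff : `[0 : R, 1]%classic `*` `[0 : R, 1]%classic `<=`
  (fun z => forall s2 t2 : R, 0 <= s2 <= 1 -> 0 <= t2 <= 1 ->
    `|z.1 - s2| <= N.+1%:R^-1 -> `|z.2 - t2| <= N.+1%:R^-1 ->
    ~ seg_meet (g z.1) (g s2) (h z.2) (h t2)).
  by move=> /(_ (s1, t1)) /=; apply => //; rewrite /= !in_itv.
by near: N.
Unshelve. all: by end_near.
Qed.

End Curves.

Lemma near_all_seq (T : eqType) (I : Type) (F : set_system I) {FF : Filter F}
  (P : I -> T -> Prop) (s : seq T) :
  (forall x, x \in s -> \forall N \near F, P N x) ->
  \forall N \near F, forall x, x \in s -> P N x.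
Proof.
elim: s => [|x s IH] H; first by apply: nearW => N x.
have h1 := H x (mem_head _ _).
have h2 := IH (fun y hy => H y (mem_behead (s := x :: s) hy)).
apply: filterS2 h1 h2 => N h1 h2 y; rewrite in_cons => /orP[/eqP->//|]; exact: h2.
Qed.

Lemma segs_cat (T : Type) (x : T) s1 s2 :
  segs x (s1 ++ s2) = segs x s1 ++ segs (last x s1) s2.
Proof.
elim: s1 x => [//|y s IH x]; rewrite /segs /=; congr (_ :: _); exact: IH.
Qed.

Section Drawing.
Variables (R : realType) (G : sgraph) (pos : G -> R * R) (arc : G -> G -> R -> R * R).
Hypothesis drawing : is_drawing pos arc.
Implicit Types (x y u v : G).

(** The clauses of [is_drawing] on interiors and on endpoints, put together on closed arcs. *)
Lemma arc_disjoint x y u v s t : adj x y -> adj u v ->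
  x != u -> x != v -> y != u -> y != v ->
  0 <= s <= 1 -> 0 <= t <= 1 -> arc x y s <> arc u v t.
Proof.
move=> xy uv xu xv yu yv s01 t01 e.
have ends w z r : adj w z -> 0 <= r <= 1 ->
    [\/ arc w z r = pos w, arc w z r = pos z | r \in `]0, 1[].
  move=> wz /andP[r0 r1]; have [->|rn0] := eqVneq r 0.
    by apply: Or31; apply: (drawing_arc0 drawing).
  have [->|rn1] := eqVneq r 1; first by apply: Or32; apply: (drawing_arc1 drawing).
  by apply: Or33; rewrite in_itv /= !lt_neqAle r0 r1 rn1 eq_sym rn0.
have ne (p q : G) : p != q -> pos p <> pos q by move=> pq /(drawing_pos_inj drawing)/eqP; rewrite (negbTE pq).
have av := drawing_arc_vertex drawing.
case: (ends x y s xy s01) => hs; case: (ends u v t uv t01) => ht; rewrite ?hs ?ht in e.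
all: try by [exact: (ne _ _ _ e)|exact: (av _ _ _ _ _ _ e)|exact: (av _ _ _ _ _ _ (esym e))].
have := drawing_arc_disjoint drawing xy uv hs ht e.
by case=> -[e1 e2]; [move: xu; rewrite e1 eqxx|move: xv; rewrite e1 eqxx].
Qed.

Definition arc_sample N x y : seq (R * R) :=
  [seq arc x y (k.+1%:R / N.+1%:R) | k <- iota 0 N.+1].

Fixpoint walk_sample N x (p : seq G) : seq (R * R) :=
  if p is y :: p' then arc_sample N x y ++ walk_sample N y p' else [::].

Lemma walk_sample_cons N x y p :
  walk_sample N x (y :: p) = arc_sample N x y ++ walk_sample N y p.
Proof. by []. Qed.

Lemma last_arc_sample N x y c : adj x y -> last c (arc_sample N x y) = pos y.
Proof.
move=> xy; rewrite /arc_sample -{2}addn1 iotaD map_cat last_cat /= add0n divff ?pnatr_eq0 //.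
exact: (drawing_arc1 drawing).
Qed.

Lemma last_walk_sample N x p : path (@adj G) x p ->
  last (pos x) (walk_sample N x p) = pos (last x p).
Proof.
elim: p x => [//|y p IH x] /andP[xy yp].
by rewrite walk_sample_cons last_cat last_arc_sample // IH.
Qed.

Lemma segs_mkseq (T : eqType) (f : nat -> T) n e :
  e \in segs (f 0%N) [seq f k.+1 | k <- iota 0 n] ->
  exists2 k, (k < n)%N & e = (f k, f k.+1).
Proof.
suff H m : e \in segs (f m) [seq f k.+1 | k <- iota m n] ->
    exists2 k, (k < m + n)%N & e = (f k, f k.+1) by exact: (H 0%N).
elim: n m => [//|n IH m]; rewrite /segs /= in_cons => /orP[/eqP->|/IH[k km ->]].
  by exists m => //; rewrite addnS ltnS leq_addr.
by exists k => //; rewrite addnS -addSn.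
Qed.

Lemma segs_arc_sample N x y e : adj x y -> e \in segs (pos x) (arc_sample N x y) ->
  exists s1 s2 : R, [/\ 0 <= s1 <= 1, 0 <= s2 <= 1, `|s1 - s2| <= N.+1%:R^-1
    & e = (arc x y s1, arc x y s2)].
Proof.
move=> xy; have {1}-> : pos x = arc x y (0%:R / N.+1%:R).
  by rewrite mul0r (drawing_arc0 drawing).
move=> /(segs_mkseq (f := fun k => arc x y (k%:R / N.+1%:R)))[k kN ->].
have N0 : 0 < N.+1%:R :> R by rewrite ltr0n.
have kN' : (k%:R <= N%:R :> R) by rewrite ler_nat.
have k0 : 0 <= k%:R :> R by rewrite ler0n.
exists (k%:R / N.+1%:R), (k.+1%:R / N.+1%:R); split => //.
- by rewrite ler_pdivlMr // ler_pdivrMr // mul0r mul1r k0 -natr1 /=; lra.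
- by rewrite ler_pdivlMr // ler_pdivrMr // mul0r mul1r -!natr1; apply/andP; split; lra.
- rewrite -mulrBl -natr1 opprD addNKr mulN1r normrN ger0_norm //.
Qed.

Lemma segs_walk_sample N x p e : path (@adj G) x p -> e \in segs (pos x) (walk_sample N x p) ->
  exists2 f, f \in segs x p & exists s1 s2 : R,
   [/\ 0 <= s1 <= 1, 0 <= s2 <= 1, `|s1 - s2| <= N.+1%:R^-1
    & e = (arc f.1 f.2 s1, arc f.1 f.2 s2)].
Proof.
elim: p x => [//|y p IH x] /andP[xy yp]; rewrite walk_sample_cons segs_cat mem_cat => /orP[].
  by move=> /(segs_arc_sample xy) H; exists (x, y) => //; exact: segs_head.
rewrite last_arc_sample // => /(IH _ yp)[f fp H]; exists f => //.
exact: segs_tail.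
Qed.

Lemma mem_segs_point (T : eqType) (c : T) s q : s != [::] -> q \in c :: s ->
  exists2 e, e \in segs c s & (q = e.1 \/ q = e.2).
Proof.
elim: s c => [//|d s IH c _]; rewrite in_cons => /orP[/eqP->|qs].
  by exists (c, d); [exact: segs_head|left].
case: s IH qs => [_|d' s IH qs].
  by rewrite in_cons in_nil orbF => /eqP->; exists (c, d); [exact: segs_head|right].
by have [e he h] := IH d isT qs; exists e => //; exact: segs_tail.
Qed.

Lemma segs_adj x p f : path (@adj G) x p -> f \in segs x p -> adj f.1 f.2.
Proof.
elim: p x => [//|y p IH x] /= /andP[xy yp]; rewrite /segs /= in_cons => /orP[/eqP->//|].
exact: IH.
Qed.

Lemma walk_samples_sep x p u q : path (@adj G) x p -> path (@adj G) u q ->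
  p != [::] -> q != [::] ->
  (forall z w, z \in x :: p -> w \in u :: q -> z != w) ->
  \forall N \near \oo, chain_sep (pos x) (walk_sample N x p) (pos u) (walk_sample N u q).
Proof.
move=> xp uq p0 q0 H.
have near1 e : e \in segs x p -> \forall N \near \oo, forall f, f \in segs u q ->
    forall s1 s2 t1 t2 : R, 0 <= s1 <= 1 -> 0 <= s2 <= 1 ->
    0 <= t1 <= 1 -> 0 <= t2 <= 1 ->
    `|s1 - s2| <= N.+1%:R^-1 -> `|t1 - t2| <= N.+1%:R^-1 ->
    ~ seg_meet (arc e.1 e.2 s1) (arc e.1 e.2 s2) (arc f.1 f.2 t1) (arc f.1 f.2 t2).
  move=> he; apply: near_all_seq => f hf.
  have ae := segs_adj xp he; have af := segs_adj uq hf.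
  have [e1 e2] := mem_segs he; have [f1 f2] := mem_segs hf.
  apply: curves_separated; [exact: (drawing_arc_continuous drawing)..|].
  by move=> s t s01 t01; apply: arc_disjoint => //; apply: H.
have {near1} near2 := near_all_seq near1.
case: near2 => N0 _ HN0; exists N0 => // N /HN0 {HN0} HN.
have nonempty z r : path (@adj G) z r -> r != [::] -> walk_sample N z r != [::].
  by case: r.
split=> [e f|c d hc hd ecd].
  move=> /(segs_walk_sample xp)[e' he' [s1 [s2 [s101 s201 ss ->]]]].
  move=> /(segs_walk_sample uq)[f' hf' [t1 [t2 [t101 t201 tt ->]]]] /=.
  exact: HN.
have [e he ce] := mem_segs_point (nonempty _ _ xp p0) hc.
have [f hf df] := mem_segs_point (nonempty _ _ uq q0) hd.
have [e' he' [s1 [s2 [s101 s201 ss ee]]]] := segs_walk_sample xp he.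
have [f' hf' [t1 [t2 [t101 t201 tt ff]]]] := segs_walk_sample uq hf.
have [e1 e2] := mem_segs he'; have [f1 f2] := mem_segs hf'.
have ad s t : 0 <= s <= 1 -> 0 <= t <= 1 -> arc e'.1 e'.2 s <> arc f'.1 f'.2 t.
  move=> s01 t01; apply: arc_disjoint => //; try exact: H.
    exact: segs_adj xp he'.
  exact: segs_adj uq hf'.
subst d; rewrite ee ff /= in ce df.
by case: ce => ce; case: df => df; rewrite ce in df; apply: ad df.
Qed.

Lemma walk_in_path (U : set G) n x y : walk_in U n x y ->
  exists p, [/\ path (@adj G) x p, last x p = y & forall z, z \in x :: p -> U z].
Proof.
elim: n y => [y [Ux <-]|n IH y [z [/IH[p [xp lp Up]] zy Uy]]].
  by exists [::]; split => // z; rewrite inE => /eqP->.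
exists (rcons p y); rewrite rcons_path last_rcons xp lp; split => // w.
by rewrite -rcons_cons mem_rcons in_cons => /orP[/eqP->//|/Up].
Qed.

(** A plane drawing has no K33 minor: choose a point in each branch set and draw each edge of
    K33 along a walk in the union of its two branch sets.  Walks of disjoint edges do not share a
    vertex, so their arcs are disjoint. *)
Lemma drawing_no_K33 (A B : 'I_3 -> set G) :
  (forall i, connected_in (A i)) -> (forall j, connected_in (B j)) ->
  (forall i k z, i != k -> A i z -> A k z -> False) ->
  (forall j l z, j != l -> B j z -> B l z -> False) ->
  (forall i j z, A i z -> B j z -> False) ->
  (forall i j, exists x y, [/\ A i x, B j y & adj x y]) -> False.
Proof.
move=> cA cB AA BB AB adjAB.
have /choice[a ha] i : exists x, A i x by have [x [y []]] := adjAB i ord0; exists x.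
have /choice[b hb] j : exists x, B j x by have [y [x []]] := adjAB ord0 j; exists x.
have /choice[p hp] (ij : 'I_3 * 'I_3) : exists p, [/\ path (@adj G) (a ij.1) p, last (a ij.1) p = b ij.2 &
    forall z, z \in a ij.1 :: p -> (A ij.1 `|` B ij.2) z].
  case: ij => i j /=.
  have [x [y [Ax By xy]]] := adjAB i j.
  have [n] : linked (A i `|` B j) (a i) (b j).
    apply: (linked_trans (linked_sub (@subsetUl _ _ _) (cA i _ _ (ha i) Ax))).
    apply: (@linked_trans _ _ _ y); first by apply: linked_adj => //; [left|right].
    exact: (linked_sub (@subsetUr _ _ _) (cB j _ _ By (hb j))).
  exact: walk_in_path.
have : \forall N \near \oo, forall ijkl : ('I_3 * 'I_3) * ('I_3 * 'I_3),
   ijkl \in enum {: ('I_3 * 'I_3) * ('I_3 * 'I_3)} ->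
   ijkl.1.1 != ijkl.2.1 -> ijkl.1.2 != ijkl.2.2 ->
   chain_sep (pos (a ijkl.1.1)) (walk_sample N (a ijkl.1.1) (p ijkl.1))
    (pos (a ijkl.2.1)) (walk_sample N (a ijkl.2.1) (p ijkl.2)).
  apply: near_all_seq => -[[i j] [k l]] _ /=.
  have [ik|ik] := eqVneq i k; first by apply: nearW => N.
  have [jl|jl] := eqVneq j l; first by apply: nearW => N.
  have [p1 l1 V1] := hp (i, j); have [p2 l2 V2] := hp (k, l).
  have nonempty i' j' : p (i', j') != [::].
    have [_ e _] := hp (i', j'); apply/eqP => p0; rewrite p0 /= in e.
    by apply: (AB i' j' (a i')) => //; rewrite e.
  have [|N0 _ HN0] := walk_samples_sep p1 p2 (nonempty _ _) (nonempty _ _); last first.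
    by exists N0 => // N /HN0.
  move=> z w /V1[Az|Bz] /V2[Aw|Bw];
   apply/eqP => e; subst w.
  - exact: AA ik Az Aw.
  - exact: AB Az Bw.
  - exact: AB Aw Bz.
  - exact: BB jl Bz Bw.
case=> N _ /(_ N (leqnn _)) H.
apply: (@no_polygonal_K33 R (pos \o a) (pos \o b) (fun i j => walk_sample N (a i) (p (i, j)))).
  by move=> i j; have [p1 l1 _] := hp (i, j); rewrite /= last_walk_sample // l1.
by move=> i j k l ik jl; apply: (H ((i, j), (k, l))) => //; rewrite mem_enum.
Qed.

End Drawing.

(** * A K33 minor from breadth-first annuli *)

Section Layers.
Variables (G : sgraph) (C : set G) (x0 : G).
Hypotheses (Cc : connected_in C) (Cx0 : C x0).
Local Notation l := (dist_in C x0).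

Lemma walk_to_layer y : C y -> walk_in C (l y) x0 y.
Proof. by move=> Cy; have [] := dist_inP (Cc Cx0 Cy). Qed.

Lemma layer_le n y : walk_in C n x0 y -> (l y <= n)%N.
Proof. by move=> h; have [_] := dist_inP (Cc Cx0 (walk_in_r h)); exact. Qed.

Lemma layer_lip n y z : walk_in C n y z -> (l z <= l y + n)%N.
Proof. by move=> h; have Cy := walk_in_l h; apply: layer_le; apply: walk_in_cat h; exact: walk_to_layer. Qed.

(** A geodesic from [y] to the root, indexed by the layers that it crosses. *)
Lemma descent y : C y -> exists f : nat -> G, f (l y) = y /\
  forall j, (j <= l y)%N -> [/\ C (f j), l (f j) = j & (j < l y)%N -> adj (f j) (f j.+1)].
Proof.
move: {2}(l y) (erefl (l y)) => n; elim: n y => [|n IH] y ly Cy.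
  exists (fun=> y); rewrite ly; split => // j; rewrite leqn0 => /eqP->.
  by split.
have := walk_to_layer Cy; rewrite ly => -[z [wz zy _]].
have Cz := walk_in_r wz.
have lz : l z = n.
  apply/eqP; rewrite eqn_leq layer_le //= -ltnS -ly -addn1.
  by apply: layer_lip; apply: walk_in1.
have [f [fz fP]] := IH z lz Cz; rewrite lz in fz fP.
exists (fun j => if j == n.+1 then y else f j); rewrite eqxx; split => // j.
rewrite leq_eqVlt => /orP[/eqP->|].
  by rewrite eqxx; split => //; rewrite ltnn.
rewrite ltnS => jn; have [h1 h2 h3] := fP j jn.
rewrite ltn_eqF ?ltnS //; split => // _; rewrite eqSS.
by case: eqVneq => [->|ne]; [rewrite fz|apply: h3; rewrite ltn_neqAle ne].
Qed.

End Layers.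

Section Fat.
Variable G : sgraph.
Hypothesis Gc : connected_graph G.
Implicit Types (H : set G) (A : nat -> set G) (B : 'I_3 -> set G) (v : 'I_3 -> G).

(** A model of the complete bipartite graph between [s] sets [A] and three sets [B] inside [H],
    with a marked point [v i] in each [B i].  The ball of radius [D] about [v i] for the metric of
    [H] meets none of the other sets, and the marked points are at distance at least [L] in [G]:
    this leaves room for prolonging each [B i] by a path from [v i]. *)
Record fat (D L : nat) H (s : nat) A B v : Prop := Fat {
  fat_A : forall l, (l < s)%N -> connected_in (A l) /\ A l `<=` H;
  fat_B : forall i, [/\ connected_in (B i), B i `<=` H & B i (v i)];
  fat_AA : forall l m z, (l < s)%N -> (m < s)%N -> l != m -> A l z -> A m z -> False;
  fat_BB : forall i j z, i != j -> B i z -> B j z -> False;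
  fat_AB : forall l i z, (l < s)%N -> A l z -> B i z -> False;
  fat_adj : forall l i, (l < s)%N -> exists x y, [/\ A l x, B i y & adj x y];
  fat_ball : forall i n y, (n < D)%N -> walk_in H n (v i) y ->
    (forall l, (l < s)%N -> ~ A l y) /\ (forall j, i != j -> ~ B j y);
  fat_dist : forall i j, i != j -> (L <= gdist (v i) (v j))%N }.

Lemma walk_interval (f : nat -> G) (P : set G) n m : (n <= m)%N ->
  (forall j, (n <= j <= m)%N -> P (f j)) ->
  (forall j, (n <= j < m)%N -> adj (f j) (f j.+1)) -> walk_in P (m - n) (f n) (f m).
Proof.
move=> nm; rewrite -(subnKC nm) addKn.
elim: (m - n)%N => [|k IH] HP Hadj; first by rewrite addn0; split => //; apply: HP; rewrite addn0 !leqnn.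
rewrite addnS; exists (f (n + k)%N); split.
- apply: IH => j /andP[h1 h2]; [apply: HP|apply: Hadj]; rewrite h1 /=.
    by rewrite addnS (leq_trans h2).
  by rewrite addnS (ltn_trans h2).
- by apply: Hadj; rewrite addnS leqnn leq_addr.
- by apply: HP; rewrite addnS leqnn andbT (leq_trans (leq_addr k n)).
Qed.

Section Step.
Variables (D L : nat) (H H' : set G) (s : nat) (A : nat -> set G)
  (B : 'I_3 -> set G) (v : 'I_3 -> G) (x0 : G) (a : nat).
Local Notation l := (dist_in H x0).
Hypotheses (D0 : (0 < D)%N) (L6 : (6 * D <= L)%N) (Hc : connected_in H) (Hx0 : H x0).
Hypothesis H'H : H' `<=` H.
Hypothesis H'layer : forall y, H' y -> (a <= l y < a + D)%N.
Hypothesis H'closed : forall y z, H' y -> H z -> adj y z -> (a <= l z <= l y)%N -> H' z.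
Hypothesis F : fat D L H' s A B v.

(** Let [H'] lie in the layers [a, a + D) of [H].  From each marked point go up a geodesic
    towards the root, to layer [a - 2 * D].  Its first part stays in [H'] and has length less than
    [D], so it avoids the other sets by fatness; afterwards it has left [H'].  The layers below
    [a - 2 * D] form a ball around the root, which is the new set [A s].  Marking the point of
    the path in layer [a - D] restores fatness, as it is [D] layers away both from the old sets
    and from the new one.  Paths from distinct marked points are disjoint because these points are
    far apart in [G]. *)
Lemma fat_step : exists A' B' v', fat D (L - 4 * D) H s.+1 A' B' v'.
Proof.
have H'v i : H' (v i) by have [_ h /h] := fat_B F i.
have dfar i j : i != j -> (L <= gdist (v i) (v j))%N by exact: fat_dist F i j.
(* otherwise all marked points are close to the root *)
have aD : (2 * D < a)%N.
  rewrite ltnNge; apply/negP => aD.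
  have i01 : (ord0 : 'I_3) != ord_max by [].
  have := dfar _ _ i01.
  have /andP[_ h0] := H'layer (H'v ord0); have /andP[_ h1] := H'layer (H'v ord_max).
  have w0 := walk_to_layer Hc Hx0 (H'H (H'v ord0)); have w1 := walk_to_layer Hc Hx0 (H'H (H'v ord_max)).
  have := gdist_le_in Gc (walk_in_cat (walk_in_sym w0) w1); lia.
have /choice[f fP] i : exists f : nat -> G, f (l (v i)) = v i /\
    forall j, (j <= l (v i))%N -> [/\ H (f j), l (f j) = j & (j < l (v i))%N -> adj (f j) (f j.+1)].
  by apply: descent => //; apply: H'H.
have av i : (a <= l (v i))%N by have /andP[] := H'layer (H'v i).
have va i : (l (v i) < a + D)%N by have /andP[] := H'layer (H'v i).
have fv i : f i (l (v i)) = v i by have [] := fP i.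
have fH i j : (j <= l (v i))%N -> H (f i j) by move=> h; have [_ /(_ _ h)[]] := fP i.
have fl i j : (j <= l (v i))%N -> l (f i j) = j by move=> h; have [_ /(_ _ h)[]] := fP i.
have fadj i j : (j < l (v i))%N -> adj (f i j) (f i j.+1).
  by move=> h; have [_ /(_ _ (ltnW h))[_ _]] := fP i; apply.
pose n := (a - 2 * D)%N.
pose Q i := [set y | exists2 j, (n <= j <= l (v i))%N & y = f i j].
pose A' k := if k == s then [set y | H y /\ (l y < n)%N] else A k.
pose B' i := B i `|` Q i.
pose v' i := f i (a - D)%N.
(* the geodesic stays in [H'] as long as its layer is at least [a] *)
have up i k : (k <= l (v i) - a)%N -> walk_in H' k (v i) (f i (l (v i) - k)%N).
  elim: k => [_|k IH hk]; first by rewrite subn0 fv.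
  have h := IH (ltnW hk); exists (f i (l (v i) - k)%N); split => //.
    rewrite adj_sym; have := fadj i (l (v i) - k.+1)%N.
    by rewrite -subSn ?subSS; [apply; lia|lia].
  apply: (H'closed (walk_in_r h)).
  - by apply: fH; lia.
  - rewrite adj_sym; have := fadj i (l (v i) - k.+1)%N.
    by rewrite -subSn ?subSS; [apply; lia|lia].
  - by rewrite !fl; lia.
have inH' i j : (a <= j <= l (v i))%N -> walk_in H' (l (v i) - j) (v i) (f i j).
  move=> /andP[h1 h2]; have := up i (l (v i) - j)%N.
  by rewrite subKn //; apply; lia.
have Qgd i j : (j <= l (v i))%N -> (gdist (v i) (f i j) <= l (v i) - j)%N.
  move=> h; rewrite gdist_sym // -{1}(fv i).
  apply: (@gdist_le_in _ Gc H); apply: walk_interval => // k /andP[k1 k2].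
    by apply: fH.
  by apply: fadj.
have Qold i j : (n <= j <= l (v i))%N -> (forall k, (k < s)%N -> ~ A k (f i j)) /\
    (forall i', i != i' -> ~ B i' (f i j)).
  move=> /andP[h1 h2]; have [ja|aj] := ltnP j a.
    have lt y : H' y -> y = f i j -> False.
      by move=> /H'layer/andP[ay _] e; move: ay; rewrite e fl // leqNgt ja.
    split=> [k ks Ak|i' _ Bi'].
      by have [_ /(_ _ Ak) h] := fat_A F ks; exact: lt h erefl.
    by have [_ /(_ _ Bi') h _] := fat_B F i'; exact: lt h erefl.
  apply: (fat_ball F) (inH' i j _); last by rewrite aj.
  by have := va i; lia.
have Qfar i j y : i != j -> Q i y -> Q j y -> False.
  move=> ij [k1 /andP[a1 a2] ->] [k2 /andP[b1 b2] e].
  have := dfar _ _ ij; have := gdist_tri Gc (v i) (f i k1) (v j).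
  have := Qgd i k1 a2; have := Qgd j k2 b2; rewrite -e (gdist_sym Gc (v j)).
  by have := va i; have := va j; rewrite /n in a1 b1; lia.
have lvl i : (n <= a - D <= l (v i))%N by have := av i; rewrite /n; lia.
have old y : H' y -> (a <= l y)%N by move=> /H'layer/andP[].
have v'near i : (gdist (v i) (v' i) < 2 * D)%N.
  apply: leq_ltn_trans (Qgd i _ _) _; first by have /andP[] := lvl i.
  by have := va i; lia.
exists A', B', v'; split.
- move=> k; rewrite ltnS leq_eqVlt /A'; case: eqVneq => [_ _|_ /= ks]; last first.
    by have [h1 h2] := fat_A F ks; split => // y /h2/H'H.
  split=> [y z|y []//].
  have toroot w : [set y | H y /\ (l y < n)%N] w -> linked [set y | H y /\ (l y < n)%N] x0 w.
    move=> [Hw lw]; have [g [gw gP]] := descent Hc Hx0 Hw.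
    have e0 : g 0%N = x0.
      have [Hg lg _] := gP 0%N (leq0n _).
      by have := walk_to_layer Hc Hx0 Hg; rewrite lg => -[].
    have : walk_in [set y | H y /\ (l y < n)%N] (l w - 0) (g 0%N) (g (l w)).
      apply: walk_interval => // j /andP[_ h].
        by have [Hg lg _] := gP j h; split => //; rewrite lg; exact: leq_ltn_trans h lw.
      by have [_ _] := gP j (ltnW h); apply.
    by rewrite e0 gw; exists (l w - 0)%N.
  by move=> /toroot hy /toroot hz; apply: linked_trans hz; apply: linked_sym.
- move=> i; have [h1 h2 h3] := fat_B F i.
  have Qv j : (n <= j <= l (v i))%N -> linked (Q i) (f i j) (v i).
    move=> /andP[g1 g2]; rewrite -[X in linked _ _ X](fv i); exists (l (v i) - j)%N.
    apply: walk_interval => // k /andP[k1 k2]; last exact: fadj.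
    by exists k => //; rewrite k2 (leq_trans g1).
  have tov w : B' i w -> linked (B' i) w (v i).
    move=> [Bw|[j hj ->]]; first by apply: linked_sub (h1 _ _ Bw h3); exact: subsetUl.
    by apply: linked_sub (Qv j hj); exact: subsetUr.
  split.
  + by move=> x y /tov hx /tov hy; apply: linked_trans hx _; apply: linked_sym.
  + by move=> y [/h2/H'H//|[j /andP[_ hj] ->]]; exact: fH.
  + by right; exists (a - D)%N.
- have sA k z : (k < s)%N -> A k z -> H z /\ (l z < n)%N -> False.
    move=> ks Akz [_ lz]; have [_ /(_ _ Akz)/old] := fat_A F ks.
    by rewrite /n in lz; lia.
  move=> k m z; rewrite !ltnS => ks ms km; rewrite /A'.
  have [ek|nk] := eqVneq k s; have [em|nm] := eqVneq m s.
  + by rewrite ek em eqxx in km.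
  + have ms' : (m < s)%N by rewrite ltn_neqAle nm.
    by move=> h Amz; exact: sA ms' Amz h.
  + have ks' : (k < s)%N by rewrite ltn_neqAle nk.
    by move=> Akz; exact: sA ks' Akz.
  + by apply: (fat_AA F _ _ km); rewrite ltn_neqAle ?nk ?nm.
- move=> i j z ij [Bi|Qi] [Bj|Qj].
  + exact: (fat_BB F ij Bi Bj).
  + case: Qj Bi => k hk ->; have [_ ] := Qold j k hk; apply; by rewrite eq_sym.
  + case: Qi Bj => k hk ->; have [_ ] := Qold i k hk; exact.
  + exact: (Qfar _ _ _ ij Qi Qj).
- move=> k i z; rewrite ltnS leq_eqVlt /A'; case: eqVneq => [_ _|_ /= ks].
    move=> [_ lz] [Bi|[j /andP[h1 h2] e]].
      by have [_ /(_ _ Bi)/old + _] := fat_B F i; rewrite /n in lz; lia.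
    by move: lz; rewrite e fl // ltnNge h1.
  move=> Ak [Bi|[j hj e]]; first exact: (fat_AB F ks Ak Bi).
  by have [/(_ k ks)] := Qold i j hj; rewrite -e.
- move=> k i; rewrite ltnS leq_eqVlt /A'; case: eqVneq => [_ _|_ /= ks].
    have nl : (n.-1 < l (v i))%N by have := av i; rewrite /n; lia.
    have n1 : n.-1.+1 = n by rewrite prednK // /n; lia.
    exists (f i n.-1), (f i n); split.
    + by split; [apply: fH; exact: ltnW|rewrite fl ?(ltnW nl) // -{2}n1].
    + by right; exists n => //; rewrite leqnn -n1.
    + by rewrite -{2}n1; apply: fadj.
  have [x [y [Ax By xy]]] := fat_adj F i ks.
  by exists x, y; split => //; left.
- move=> i m y mD wy.
  have l1 := layer_lip Hc Hx0 wy; have l2 := layer_lip Hc Hx0 (walk_in_sym wy).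
  have lv' : l (v' i) = (a - D)%N by apply: fl; have /andP[] := lvl i.
  rewrite lv' in l1 l2.
  split=> [k|j ij].
    rewrite ltnS leq_eqVlt /A'; case: eqVneq => [_ _ [_]|_ /= ks Ak].
      by rewrite /n; lia.
    by have [_ /(_ _ Ak)/old] := fat_A F ks; lia.
  move=> [Bj|[k /andP[k1 k2] e]].
    by have [_ /(_ _ Bj)/old + _] := fat_B F j; lia.
  have := dfar _ _ ij; have := gdist_tri Gc (v i) (v' i) (v j).
  have := gdist_tri Gc (v' i) y (v j); have := gdist_le_in Gc wy.
  have := Qgd j k k2; rewrite -e (gdist_sym Gc (v j)).
  have := v'near i; have := va j; rewrite /n in k1; lia.
- move=> i j ij; have := dfar _ _ ij.
  have := gdist_tri Gc (v i) (v' i) (v j); have := gdist_tri Gc (v' i) (v' j) (v j).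
  have := v'near i; have := v'near j; rewrite (gdist_sym Gc (v j)); lia.
Qed.

End Step.
End Fat.

(** * Random partitions into pieces of bounded diameter *)

Section Chop.
Variables (G : sgraph) (root : set G -> G).
Hypothesis Gc : connected_graph G.
Hypothesis rootP : forall (C : set G) x, C x -> C (root C).
Implicit Types (C U : set G) (x y z : G) (rs : seq nat).

Lemma linked_component U x y : linked U x y -> linked [set z | linked U x z] x y.
Proof.
case=> n; elim: n y => [y [Ux <-]|n IH y [z [xz zy Uy]]].
  by apply: linked_refl; apply: linked_refl.
have hz : linked U x z by exists n.
apply: linked_trans (IH _ xz) _; apply: linked_adj => //.
by apply: linked_trans hz _; apply: linked_adj => //; exact: walk_in_r xz.
Qed.

Definition band_index D r C z := ((dist_in C (root C) z + r) %/ D)%N.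
Definition band D r C x := [set z | C z /\ band_index D r C z = band_index D r C x].
(** The root depends only on the set [C], so points of the same piece see the same annuli. *)
Definition chop D r C x := [set y | linked (band D r C x) x y].

Lemma chop_sub D r C x y : chop D r C x y -> band D r C x y.
Proof. by case=> n /walk_in_r. Qed.

Lemma chop_self D r C x : C x -> chop D r C x x.
Proof. by move=> Cx; exact: linked_refl. Qed.

Lemma chop_connected D r C x : connected_in (chop D r C x).
Proof.
move=> y z /linked_component hy /linked_component hz.
by apply: linked_trans hz; apply: linked_sym.
Qed.

Lemma chop_eq D r C x y : chop D r C x y -> chop D r C y = chop D r C x.
Proof.
move=> xy; have [Cy ly] := chop_sub xy.
have eb : band D r C y = band D r C x by rewrite /band ly.
apply/seteqP; split=> z; rewrite /chop /= eb => h; first exact: linked_trans h.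
by apply: linked_trans h; apply: linked_sym.
Qed.

Lemma fat_chop D L r C x s A B v : (0 < D)%N -> (6 * D <= L)%N -> connected_in C -> C x ->
  fat D L (chop D r C x) s A B v ->
  exists A' B' v', fat D (L - 4 * D) C s.+1 A' B' v'.
Proof.
move=> D0 DL Cc Cx F.
apply: (@fat_step G Gc D L C (chop D r C x) s A B v (root C) (band_index D r C x * D - r)) => //.
- exact: rootP Cx.
- by move=> y /chop_sub[].
- move=> y /chop_sub[_]; rewrite /band_index => <-.
  set w := dist_in _ _ _; have := divn_eq (w + r) D; have := ltn_pmod (w + r) D0.
  by move: (_ %/ _)%N (_ %% _)%N => q m; lia.
- move=> y z hy Cz yz /andP[h1 h2]; have [Cy ly] := chop_sub hy.
  have lz : band_index D r C z = band_index D r C x.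
    apply/eqP; rewrite eqn_leq -{1}ly {1 2}/band_index leq_div2r ?leq_add2r //=.
    by rewrite {2}/band_index leq_divRL //; lia.
  by apply: linked_trans hy _; apply: linked_adj.
Qed.

Fixpoint piece D rs x : set G :=
  if rs is r :: rs' then chop D r (piece D rs' x) x else setT.

Lemma piece_self D rs x : piece D rs x x.
Proof. by elim: rs => //= r rs IH; apply: chop_self. Qed.

Lemma piece_eq D rs x y : piece D rs x y -> piece D rs y = piece D rs x.
Proof.
elim: rs => //= r rs IH xy; have [/IH e _] := chop_sub xy.
by rewrite e; apply: chop_eq.
Qed.

Lemma piece_connected D rs x : connected_in (piece D rs x).
Proof. by case: rs => [|r rs]; [exact: connected_inT|exact: chop_connected]. Qed.

Lemma fat_piece D L rs x s A B v : (0 < D)%N -> (6 * D + 4 * D * size rs <= L + 4 * D)%N ->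
  fat D L (piece D rs x) s A B v ->
  exists A' B' v', fat D (L - 4 * D * size rs) [set: G] (s + size rs) A' B' v'.
Proof.
move=> D0; elim: rs L s A B v => [|r rs IH] L s A B v /= DL F.
  by rewrite addn0 muln0 subn0; exists A, B, v.
have [|A' [B' [v' F']]] := fat_chop D0 _ (@piece_connected D rs x) (@piece_self D rs x) F.
  by lia.
have := IH _ _ _ _ _ _ F'.
have -> : (L - 4 * D - 4 * D * size rs = L - 4 * D * (size rs).+1)%N by lia.
by rewrite addSnnS; apply; lia.
Qed.

(** A connected set containing two points at distance [28 * D] contains a third one halfway,
    so that the distances are at least [14 * D].  Three steps of [fat_step], each of which loses
    [4 * D] and needs [6 * D], turn the three points into a K33 minor. *)
Lemma piece_diam (R : realType) D rs x y z : planar R G -> (0 < D)%N -> size rs = 3%N ->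
  piece D rs x y -> piece D rs x z -> (gdist y z < 28 * D)%N.
Proof.
move=> [pos [arc dr]] D0 rs3 hy hz; rewrite ltnNge; apply/negP => far.
have [w hw yw] : exists2 w, piece D rs x w & gdist y w = (14 * D)%N.
  have [n] := piece_connected hy hz.
  elim: n z {hz} far => [z far [_ e]|n IH z far [u [yu uz hz]]].
    by move: far; rewrite -e gdistxx //; lia.
  have [lt|ge] := ltnP (gdist y u) (28 * D); last exact: IH ge yu.
  clear IH.
  have : forall m, (m <= gdist y u)%N -> exists2 w, piece D rs x w & gdist y w = m.
    move: yu; elim: n u {uz lt} => [u [_ <-] m|n IH u [t [yt tu hu]] m hm].
      by rewrite gdistxx // leqn0 => /eqP->; exists y => //; rewrite gdistxx.
    have [mt|tm] := leqP m (gdist y t); first exact: IH yt _ mt.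
    exists u => //; apply/eqP; rewrite eqn_leq hm andbT.
    have := gdist_tri Gc y t u; have := gdist_adj Gc tu; lia.
  apply; have := gdist_tri Gc y u z; have := gdist_adj Gc uz; lia.
pose v (i : 'I_3) : G := nth y [:: y; w; z] i.
have F : fat D (14 * D) (piece D rs x) 0 (fun=> set0) (fun i => [set v i]) v.
  have vc i : piece D rs x (v i) by case: i => -[|[|[|]]].
  have vd i j : i != j -> (14 * D <= gdist (v i) (v j))%N.
    have wz : (14 * D <= gdist w z)%N by have := gdist_tri Gc y w z; lia.
    have yz : (14 * D <= gdist y z)%N by lia.
    case: i j => -[|[|[|//]]] ? [[|[|[|//]]] ?] //= _; rewrite /v /= ?yw //.
    - by rewrite gdist_sym // yw.
    - by rewrite gdist_sym.
    - by rewrite gdist_sym.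
  have vne i j : i != j -> v i <> v j.
    by move=> /vd + e; rewrite e gdistxx //; lia.
  split=> //.
  - move=> i; split=> //; last by move=> _ ->; exact: vc.
    by move=> _ _ -> ->; exact: linked_refl.
  - by move=> i j u ij -> /= /(vne _ _ ij).
  - move=> i n u nD hu; split => // j ij /= e; rewrite e in hu.
    by have := gdist_le_in Gc hu; have := vd _ _ ij; lia.
have [|A' [B' [v' F']]] := fat_piece D0 _ F; first by rewrite rs3; lia.
rewrite rs3 add0n in F'.
apply: (drawing_no_K33 dr (A := fun i : 'I_3 => A' i) (B := B')).
- by move=> i; have [] := fat_A F' (ltn_ord i).
- by move=> i; have [] := fat_B F' i.
- by move=> i k u ik; apply: (fat_AA F').
- by move=> i k u ik; apply: (fat_BB F').
- by move=> i k u; apply: (fat_AB F').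
- by move=> i j; apply: (fat_adj F').
Qed.

Definition gball x (k : nat) := [set y | (gdist x y <= k)%N].

Lemma gball_walk x k y : gball x k y -> walk_in (gball x k) (gdist x y) x y.
Proof.
suff H n z : walk_in setT n x z -> (n <= gdist x z)%N -> (n <= k)%N -> walk_in (gball x k) n x z.
  by move=> xy; apply: H => //; exact: gdist_walk.
elim: n z {y} => [y [_ <-] _ _|n IH y [z [xz zy _]] ny nk].
  by split => //=; rewrite /gball /= gdistxx.
have dz := gdist_le Gc xz.
exists z; split=> //; last first.
  by rewrite /gball /=; have := gdist_tri Gc x z y; have := gdist_adj Gc zy; lia.
apply: IH => //; first by have := gdist_tri Gc x z y; have := gdist_adj Gc zy; lia.
by lia.
Qed.

(** On the ball, the layer differs from that of [x] by at most [k]; a shift that puts the layer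
    of [x] at depth at least [k] inside its annulus keeps the ball in one annulus, and the ball
    is connected. *)
Lemma gball_chop D r C x k : (0 < D)%N -> connected_in C -> gball x k `<=` C ->
  (k <= (dist_in C (root C) x + r) %% D < D - k)%N -> gball x k `<=` chop D r C x.
Proof.
move=> D0 Cc xC hr y xy; have w := gball_walk xy.
exists (gdist x y); apply: walk_in_sub w => z xz; split; first exact: xC.
have Cx : C x by apply: xC; rewrite /gball /= gdistxx.
have w := walk_in_sub xC (gball_walk xz).
have := layer_lip Cc (rootP Cx) w; have := layer_lip Cc (rootP Cx) (walk_in_sym w).
rewrite /gball /= in xz.
rewrite /band_index; move: hr; set a := dist_in _ _ x; set b := dist_in _ _ z => hr h1 h2.
have := divn_eq (a + r) D; move: hr; set q := (_ %/ D)%N; set m := (_ %% D)%N => hr e.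
have -> : (b + r = q * D + (b + m - a))%N by lia.
by rewrite divnMDl // divn_small ?addn0 //; lia.
Qed.

Lemma sum_shift_mod D c (F : nat -> nat) : (0 < D)%N ->
  (\sum_(r < D) F ((c + r) %% D) = \sum_(r < D) F r)%N.
Proof.
case: D => // D _.
rewrite [RHS](reindex (fun r : 'I_D.+1 => inord ((c + r) %% D.+1) : 'I_D.+1)) /=.
  by apply: eq_bigr => r _; rewrite inordK // ltn_mod.
apply: onW_bij; apply: injF_bij => r s /(congr1 val) /=; rewrite !inordK ?ltn_mod // => /eqP.
by rewrite eqn_modDl !modn_small // => /eqP/val_inj.
Qed.

(** A bad shift puts the layer of [x] among the first [k] or the last [k] of an annulus. *)
Lemma bad_shift_count D c k : (0 < D)%N ->
  (\sum_(r < D) ~~ (k <= (c + r) %% D < D - k)%N <= 2 * k)%N.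
Proof.
move=> D0; rewrite (sum_shift_mod c (fun m => nat_of_bool (~~ (k <= m < D - k)%N))) //.
apply: (@leq_trans (\sum_(m < D) ((m < k) + (D - k <= m)))%N).
  by apply: leq_sum => m _; rewrite negb_and -ltnNge -leqNgt; case: (m < k)%N; case: (_ <= m)%N.
have lo n : (\sum_(m < n) (m < k)%N <= k)%N.
  elim: n => [|n IH]; first by rewrite big_ord0.
  rewrite big_ord_recr /=; have [nk|kn] := ltnP n k; last by rewrite addn0.
  apply: leq_trans nk; rewrite addn1 ltnS.
  rewrite -[leqRHS]card_ord -sum1_card.
  by apply: leq_sum => i _; case: (_ < _)%N.
rewrite big_split /= mul2n -addnn; apply: leq_add; first exact: lo.
rewrite (reindex_inj rev_ord_inj) /=.
apply: leq_trans (lo D); apply: leq_sum => m _.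
have := ltn_ord m.
by case: (ltnP m k) => h1; case: (leqP (D - k) (D - m.+1)) => h2 //; lia.
Qed.

Definition unpadded D rs x k : nat := ~~ `[< gball x k `<=` piece D rs x >].

Lemma unpadded_cons D rs x k : (0 < D)%N ->
  (\sum_(r < D) unpadded D (nat_of_ord r :: rs) x k <= D * unpadded D rs x k + 2 * k)%N.
Proof.
move=> D0.
have [h|h] := boolP `[< gball x k `<=` piece D rs x >]; last first.
  rewrite {2}/unpadded h muln1; apply: leq_trans (leq_addr _ _).
  rewrite -[leqRHS](card_ord D) -sum1_card; apply: leq_sum => r _.
  by rewrite /unpadded; case: (~~ _).
apply: leq_trans (leq_addl _ _).
apply: leq_trans (bad_shift_count (dist_in (piece D rs x) (root (piece D rs x)) x) k D0).
apply: leq_sum => r _; rewrite /unpadded.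
have [g|_] := boolP (k <= _ < _)%N; last by case: (~~ _).
rewrite /=; suff -> : `[< gball x k `<=` piece D (nat_of_ord r :: rs) x >] by [].
by apply/asboolP; apply: gball_chop => //; [exact: piece_connected|exact/asboolP].
Qed.

(** A union bound: each of the three cuttings spoils at most [2 * k] of the [D] shifts,
    whatever the choice of the previous ones. *)
Lemma unpadded3 D x k : (0 < D)%N ->
  (\sum_(p < D) \sum_(q < D) \sum_(r < D)
     unpadded D [:: nat_of_ord r; nat_of_ord q; nat_of_ord p] x k <= 6 * k * D ^ 2)%N.
Proof.
move=> D0.
have u0 : unpadded D [::] x k = 0%N.
  by rewrite /unpadded; case: asboolP => // -[].
have s1 : (\sum_(p < D) unpadded D [:: nat_of_ord p] x k <= 2 * k)%N.
  by have := unpadded_cons [::] x k D0; rewrite u0 muln0.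
have s2 : (\sum_(p < D) \sum_(q < D) unpadded D [:: nat_of_ord q; nat_of_ord p] x k <= 4 * k * D)%N.
  apply: (@leq_trans (\sum_(p < D) (D * unpadded D [:: nat_of_ord p] x k + 2 * k)))%N.
    by apply: leq_sum => p _; apply: unpadded_cons.
  rewrite big_split /= -big_distrr /= sum_nat_const card_ord.
  have := leq_mul (leqnn D) s1; move: (\sum_(_ < _) _)%N => u; lia.
apply: (@leq_trans (\sum_(p < D) \sum_(q < D) (D * unpadded D [:: nat_of_ord q; nat_of_ord p] x k + 2 * k)))%N.
  by apply: leq_sum => p _; apply: leq_sum => q _; apply: unpadded_cons.
under eq_bigr do rewrite big_split /= -big_distrr /= sum_nat_const card_ord.
rewrite big_split /= -big_distrr /= sum_nat_const card_ord.
have := leq_mul (leqnn D) s2; move: (\sum_(_ < _) _)%N => u; rewrite expnS expn1; lia.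
Qed.

End Chop.

(** * The averaging operator *)

Section Averaging.
Variables (R : realType) (G : sgraph).
Hypothesis lf : forall x : G, finite_set (neighbors x).
Hypothesis deg_gt0 : forall x : G, (0 < deg x)%N.
Implicit Types (g h : G -> R) (x y z : G) (W S : {fset G}).

Definition nbr x : {fset G} := fset_set (neighbors x).

Lemma in_nbr x y : (y \in nbr x) = adj x y.
Proof. by rewrite /nbr in_fset_set //; apply/idP/idP; rewrite inE. Qed.

Definition avg g x : R := (deg x)%:R^-1 * \sum_(y <- nbr x) g y.

Lemma degR_gt0 x : 0 < (deg x)%:R :> R.
Proof. by rewrite ltr0n. Qed.
Hint Resolve degR_gt0 : core.

Lemma degR_neq0 x : (deg x)%:R != 0 :> R.
Proof. by rewrite gt_eqF. Qed.

Lemma avg_const c x : avg (fun=> c) x = c.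
Proof.
rewrite /avg big_const_seq count_predT iter_addr_0 -[nbr x]/(nbr x).
by rewrite -[c *+ _]mulr_natl mulrA mulVf ?mul1r //; exact: degR_neq0.
Qed.

Lemma avg_le g h x : (forall y, adj x y -> g y <= h y) -> avg g x <= avg h x.
Proof.
move=> gh; rewrite ler_pM2l ?invr_gt0 //.
by rewrite big_seq [leRHS]big_seq; apply: ler_sum => y; rewrite in_nbr => /gh.
Qed.

Lemma eq_avg g h x : (forall y, adj x y -> g y = h y) -> avg g x = avg h x.
Proof. by move=> gh; apply: le_anti; rewrite !avg_le // => y /gh->. Qed.

Lemma avg_ge0 g x : (forall y, adj x y -> 0 <= g y) -> 0 <= avg g x.
Proof. by move=> g0; rewrite -(avg_const 0 x); apply: avg_le. Qed.

Lemma avgD g h x : avg (fun y => g y + h y) x = avg g x + avg h x.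
Proof. by rewrite /avg big_split /= mulrDr. Qed.

Lemma avgZ c g x : avg (fun y => c * g y) x = c * avg g x.
Proof. by rewrite /avg -big_distrr /= mulrCA. Qed.

Lemma avg_sum (I : Type) (r : seq I) (F : I -> G -> R) x :
  avg (fun y => \sum_(i <- r) F i y) x = \sum_(i <- r) avg (F i) x.
Proof.
elim: r => [|i r IH].
  by rewrite big_nil -[RHS](avg_const 0 x); apply: eq_avg => y _; rewrite big_nil.
by rewrite big_cons -IH -avgD; apply: eq_avg => y _; rewrite big_cons.
Qed.

Lemma sum_sqr_le (I : Type) (r : seq I) (a b c : I -> R) :
  (forall i, 0 <= b i) -> (forall i, 0 <= c i) -> (forall i, a i ^+ 2 <= b i * c i) ->
  (\sum_(i <- r) a i) ^+ 2 <= (\sum_(i <- r) b i) * (\sum_(i <- r) c i).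
Proof.
move=> b0 c0 H; elim: r => [|i r IH]; first by rewrite !big_nil expr0n mul0r.
rewrite !big_cons.
have B0 : 0 <= \sum_(j <- r) b j by apply: sumr_ge0.
have C0 : 0 <= \sum_(j <- r) c j by apply: sumr_ge0.
move: (\sum_(j <- r) a j) (\sum_(j <- r) b j) (\sum_(j <- r) c j) B0 C0 IH (b0 i) (c0 i) (H i).
move: (a i) (b i) (c i) => x y z X Y Z Y0 Z0 XYZ y0 z0 xyz.
suff : 2 * (x * X) <= y * Z + Y * z by nra.
have pq : (x * X) ^+ 2 <= (y * Z) * (Y * z).
  rewrite exprMn (_ : y * Z * (Y * z) = (y * z) * (Y * Z)); last by ring.
  by apply: ler_pM => //; apply: sqr_ge0.
have p0 : 0 <= y * Z by apply: mulr_ge0.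
have q0 : 0 <= Y * z by apply: mulr_ge0.
move: (x * X) (y * Z) (Y * z) pq p0 q0 => w p q pq p0 q0.
rewrite leNgt; apply/negP => lt; have := sqr_ge0 (p - q); nra.
Qed.

Lemma avg_CauchySchwarz g h x : avg (fun y => g y * h y) x ^+ 2 <=
  avg (fun y => g y ^+ 2) x * avg (fun y => h y ^+ 2) x.
Proof.
rewrite /avg exprMn [leRHS]mulrACA -[X in _ <= X * _]expr2.
apply: ler_wpM2l; first exact: sqr_ge0.
by apply: sum_sqr_le => y; rewrite ?sqr_ge0 // exprMn.
Qed.

Definition nbhd W : {fset G} := (\bigcup_(x <- W) nbr x)%fset.

Lemma nbhdP W y : reflect (exists2 x, x \in W & adj x y) (y \in nbhd W).
Proof.
rewrite /nbhd; apply: (iffP (bigfcupP _ _ _ _)) => [[x /andP[xW _]]|[x xW xy]].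
  by rewrite in_nbr; exists x.
by exists x; rewrite ?xW // in_nbr.
Qed.

Lemma fsum_subset_le (F : G -> R) (A B : {fset G}) :
  (A `<=` B)%fset -> (forall x, 0 <= F x) -> \sum_(x <- A) F x <= \sum_(x <- B) F x.
Proof.
move=> AB F0; rewrite [leRHS](big_fsetID _ (mem A)) /=.
have -> : [fset x in B | x \in A]%fset = A.
  apply/fsetP => x; rewrite !inE /=; apply/andP/idP => [[]//|xA]; split => //.
  exact: (fsubsetP AB).
by rewrite lerDl; apply: sumr_ge0.
Qed.

(** Double counting of the edges from [W]; only an inequality, as [nbhd W] has further
    neighbours.  It replaces exchanging sums over an infinite vertex set. *)
Lemma exchange_nbr (F : G -> G -> R) W : (forall x y, 0 <= F x y) ->
  \sum_(x <- W) \sum_(y <- nbr x) F x y <= \sum_(y <- nbhd W) \sum_(x <- nbr y) F x y.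
Proof.
move=> F0.
have E x : x \in W -> \sum_(y <- nbr x) F x y = \sum_(y <- nbhd W) (adj x y)%:R * F x y.
  move=> xW.
  have -> : \sum_(y <- nbhd W) (adj x y)%:R * F x y = \sum_(y <- nbhd W | adj x y) F x y.
    rewrite [RHS]big_mkcond; apply: eq_bigr => y _.
    by case: ifP; rewrite ?mul1r ?mul0r.
  rewrite [RHS]big_fset_condE; suff -> : [fset y in nbhd W | adj x y]%fset = nbr x by [].
  apply/fsetP => y; rewrite !inE /= in_nbr; apply/andP/idP => [[]//|xy]; split => //.
  by apply/nbhdP; exists x.
rewrite (eq_big_seq _ E) exchange_big /=; apply: ler_sum => y _.
have -> : \sum_(x <- W) (adj x y)%:R * F x y = \sum_(x <- W | adj x y) F x y.
  rewrite [RHS]big_mkcond; apply: eq_bigr => x _.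
  by case: ifP; rewrite ?mul1r ?mul0r.
rewrite [leLHS]big_fset_condE; apply: fsum_subset_le => //.
by apply/fsubsetP => x; rewrite !inE /= in_nbr adj_sym => /andP[].
Qed.

Definition sqnorm W g : R := \sum_(x <- W) (deg x)%:R * g x ^+ 2.

(** Reversibility of the walk with respect to the degrees: mass sent along edges is received
    along edges. *)
Lemma mass_transport (F : G -> G -> R) W : (forall x y, 0 <= F x y) ->
  \sum_(x <- W) (deg x)%:R * avg (F x) x <= \sum_(y <- nbhd W) (deg y)%:R * avg (F^~ y) y.
Proof.
move=> F0; rewrite /avg.
under eq_bigr do rewrite mulrA divff ?mul1r ?degR_neq0 //.
under [leRHS]eq_bigr do rewrite mulrA divff ?mul1r ?degR_neq0 //.
exact: exchange_nbr.
Qed.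

End Averaging.

(** * Fourth moments of Lipschitz functions along the walk *)

Section Moment.
Variables (R : realType) (G : sgraph).
Hypothesis lf : forall x : G, finite_set (neighbors x).
Hypothesis deg_gt0 : forall x : G, (0 < deg x)%N.
Implicit Types (f g h : G -> R) (x y z : G) (W S : {fset G}).
Local Notation P := (@avg R G).

(** From [1 - u <= expR (- u)] by inversion. *)
Lemma expR_quadratic (u : R) : `|u| <= 2^-1 -> expR u <= 1 + u + 2 * u ^+ 2.
Proof.
rewrite ler_norml => /andP[u1 u2].
have h : 1 - u <= expR (- u) by have := expR_ge1Dx (- u).
have e : expR u * expR (- u) = 1 by rewrite expRN divff ?gt_eqF ?expR_gt0.
have p := expR_gt0 u; have h2 : expR u * (1 - u) <= expR u * expR (- u) by rewrite ler_pM2l.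
rewrite e in h2.
have h3 : 1 <= (1 + u + 2 * u ^+ 2) * (1 - u).
  have -> : (1 + u + 2 * u ^+ 2) * (1 - u) = 1 + u ^+ 2 * (1 - 2 * u) by ring.
  by rewrite lerDl; apply: mulr_ge0; [exact: sqr_ge0|lra].
have h4 : expR u * (1 - u) <= (1 + u + 2 * u ^+ 2) * (1 - u) by apply: le_trans h3.
by move: h4; rewrite ler_pM2r //; lra.
Qed.

Section Tilt.
Variables (f : G -> R) (lam : R).
Hypothesis f_lip : forall x y, adj x y -> `|f x - f y| <= 1.
Hypothesis lam_small : `|lam| <= 8^-1.
Local Notation m := (P f).
Let kap := 1 + 32 * lam ^+ 2.

Lemma kap_ge0 : 0 <= kap.
Proof. by rewrite /kap addr_ge0 // mulr_ge0 // sqr_ge0. Qed.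

Lemma mean_near x y : adj x y -> `|f y - m x| <= 2.
Proof.
move=> xy.
have near z : adj x z -> -2 <= f y - f z <= 2.
  move=> xz; have := f_lip xy; have := f_lip xz; rewrite !ler_norml => /andP[? ?] /andP[? ?].
  by apply/andP; split; lra.
have e : f y - m x = P (fun z => f y + (-1) * f z) x.
  by rewrite avgD avgZ avg_const // mulN1r.
rewrite e ler_norml; apply/andP; split.
  rewrite -[leLHS](avg_const deg_gt0 (- 2) x); apply: avg_le => // z /near; lra.
by rewrite -[leRHS](avg_const deg_gt0 2 x); apply: avg_le => // z /near; lra.
Qed.

(** The linear term of the exponential averages to zero because [m x] is the mean of [f] over
    the neighbours of [x]. *)
Lemma tilt_mean x : P (fun y => expR (lam * (f y - m x)) ^+ 2) x <= kap.
Proof.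
apply: (@le_trans _ _ (P (fun y => (1 + 32 * lam ^+ 2) + (2 * lam) * (f y + (-1) * m x)) x)).
  apply: avg_le => // y xy.
  rewrite expr2 -expRD; set u := lam * (f y - m x) + _.
  have d2 := mean_near xy.
  have lf2 : `|lam * (f y - m x)| <= 4^-1.
    rewrite normrM; apply: (@le_trans _ _ (8^-1 * 2)); last by lra.
    by apply: ler_pM.
  have hu : `|u| <= 2^-1.
    by apply: le_trans (ler_normD _ _) _; lra.
  apply: le_trans (expR_quadratic hu) _.
  have -> : u ^+ 2 = 4 * lam ^+ 2 * (f y - m x) ^+ 2 by rewrite /u; ring.
  have : (f y - m x) ^+ 2 <= 4.
    rewrite -real_normK ?num_real //; have := normr_ge0 (f y - m x); nra.
  by have := sqr_ge0 lam; rewrite /u; nra.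
rewrite avgD avgZ avgD avgZ !avg_const //.
by rewrite mulN1r subrr mulr0 addr0.
Qed.

(** One averaging step weighted by the exponential of the increment of [f], centred at the
    mean of [f] seen from the vertex [y] that the step leaves. *)
Definition forward_tilt g y := P (fun z => expR (lam * (f z - m y)) * g z) y.
(** The same weight for the reversed step: here the increment is centred at the vertex reached. *)
Definition backward_tilt g x := P (fun y => expR (lam * (m y - f x)) * g y) x.

(** Cauchy-Schwarz inside the average puts the exponential weights in one factor, which
    [tilt_mean] bounds; the other factor is moved by [mass_transport]. *)
Lemma sqnorm_forward W g : sqnorm W (forward_tilt g) <= kap * sqnorm (nbhd W) g.
Proof.
rewrite /sqnorm mulr_sumr.
apply: (@le_trans _ _ (\sum_(y <- W) (deg y)%:R * P (fun z => kap * g z ^+ 2) y)).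
  apply: ler_sum => y _; rewrite ler_wpM2l //.
  apply: (le_trans (avg_CauchySchwarz _ _ _)); rewrite avgZ.
  apply: ler_wpM2r; last exact: tilt_mean.
  by apply: avg_ge0 => // z _; exact: sqr_ge0.
apply: le_trans (mass_transport lf deg_gt0 _ _) _.
  by move=> x y; rewrite mulr_ge0 ?sqr_ge0 ?kap_ge0.
by apply: ler_sum => y _; rewrite avg_const // mulrCA.
Qed.

End Tilt.
Section Tilt2.
Variables (f : G -> R) (lam : R).
Hypothesis f_lip : forall x y, adj x y -> `|f x - f y| <= 1.
Hypothesis lam_small : `|lam| <= 8^-1.
Local Notation m := (P f).
Let kap := 1 + 32 * lam ^+ 2.

(** The increment is centred at the wrong end for a direct estimate.  After
    [mass_transport] the average runs over the starting point, and [tilt_mean] applies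
    with [- lam]. *)
Lemma sqnorm_backward W g : sqnorm W (backward_tilt f lam g) <= kap * sqnorm (nbhd W) g.
Proof.
rewrite /sqnorm mulr_sumr.
apply: (@le_trans _ _ (\sum_(x <- W) (deg x)%:R *
   P (fun y => expR (lam * (m y - f x)) ^+ 2 * g y ^+ 2) x)).
  apply: ler_sum => x _; rewrite ler_wpM2l //.
  have -> : backward_tilt f lam g x = P (fun y => 1 * (expR (lam * (m y - f x)) * g y)) x.
    by apply: eq_avg => // y _; rewrite mul1r.
  apply: (le_trans (avg_CauchySchwarz _ _ _)).
  rewrite (_ : P (fun=> 1 ^+ 2) x = 1) ?mul1r.
    by apply: avg_le => // y _; rewrite exprMn.
  by rewrite expr1n avg_const.
apply: le_trans (mass_transport lf deg_gt0 (F := fun x y => expR (lam * (m y - f x)) ^+ 2 * g y ^+ 2) _ _) _.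
  by move=> x y; rewrite mulr_ge0 ?sqr_ge0.
apply: ler_sum => y _; rewrite [leRHS]mulrCA ler_wpM2l //.
have -> : P (fun x => expR (lam * (m y - f x)) ^+ 2 * g y ^+ 2) y =
   g y ^+ 2 * P (fun x => expR (- lam * (f x - m y)) ^+ 2) y.
  rewrite -avgZ; apply: eq_avg => // x _; rewrite mulrC; congr (_ * expR _ ^+ 2); ring.
rewrite mulrC ler_wpM2r ?sqr_ge0 //.
have := @tilt_mean f (- lam) f_lip; rewrite normrN sqrrN; exact.
Qed.

(** Two steps at once, so that the weights can be centred at the mean of [f] around the
    intermediate vertex. *)
Definition tilted_step g x := expR (- lam * f x) * P (P (fun z => expR (lam * f z) * g z)) x.

(** The mean of [f] at the intermediate vertex cancels, so the conjugated operator is a product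
    of two centred ones. *)
Lemma tilted_stepE g x : tilted_step g x = backward_tilt f lam (forward_tilt f lam g) x.
Proof.
rewrite /tilted_step /backward_tilt -avgZ; apply: eq_avg => // y _.
rewrite /forward_tilt -!avgZ; apply: eq_avg => // z _.
rewrite !mulrA -!expRD; congr (expR _ * _); ring.
Qed.

Lemma sqnorm_tilted_step W g : sqnorm W (tilted_step g) <= kap ^+ 2 * sqnorm (nbhd (nbhd W)) g.
Proof.
have -> : sqnorm W (tilted_step g) = sqnorm W (backward_tilt f lam (forward_tilt f lam g)).
  by apply: eq_bigr => x _; rewrite tilted_stepE.
apply: le_trans (sqnorm_backward _ _) _.
rewrite expr2 -mulrA ler_wpM2l //; first exact: kap_ge0.
exact: sqnorm_forward.
Qed.

Lemma sqnorm_tilted_iter n W g : sqnorm W (iter n tilted_step g) <=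
  kap ^+ (2 * n) * sqnorm (iter (2 * n) (@nbhd G) W) g.
Proof.
elim: n W => [|n IH] W; first by rewrite muln0 expr0 mul1r.
apply: le_trans (sqnorm_tilted_step _ _) _.
rewrite mulnS exprD -mulrA ler_wpM2l ?sqr_ge0 //.
by rewrite addnC iterD /=; exact: IH.
Qed.

Lemma iter_tilted n g x : iter n tilted_step g x =
  expR (- lam * f x) * iter (2 * n) P (fun z => expR (lam * f z) * g z) x.
Proof.
elim: n x => [|n IH] x; first by rewrite /= mulrA -expRD mulNr addNr expR0 mul1r.
rewrite mulnS iterS /tilted_step; congr (_ * _); rewrite add2n !iterS.
apply: eq_avg => // y _; apply: eq_avg => // z _.
rewrite IH mulrA -expRD mulNr subrr expR0 mul1r //.
Qed.

Definition ind S x : R := (x \in S)%:R.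

Lemma mu_ind_le W S : sqnorm W (ind S) <= (mu S)%:R.
Proof.
rewrite /sqnorm /mu natr_sum.
have -> : \sum_(x <- W) (deg x)%:R * ind S x ^+ 2 = \sum_(x <- W | x \in S) (deg x)%:R :> R.
  rewrite [RHS]big_mkcond; apply: eq_bigr => x _; rewrite /ind.
  by case: ifP; rewrite ?expr1n ?mulr1 ?expr0n ?mulr0.
rewrite big_fset_condE; apply: fsum_subset_le => //.
by apply/fsubsetP => x; rewrite !inE => /andP[].
Qed.

(** Exponential moment of the displacement of [f] for the walk started in [S] and observed in
    [S]: pair the iterate with the indicator of [S] in L2. *)
Lemma tilted_iter_ind n S :
  \sum_(x <- S) (deg x)%:R * iter n tilted_step (ind S) x <= kap ^+ n * (mu S)%:R.
Proof.
have k1 : 0 < kap by rewrite /kap ltr_pwDl // mulr_ge0 ?sqr_ge0.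
set K := kap ^+ n; have K0 : 0 < K by apply: exprn_gt0.
have h : \sum_(x <- S) (deg x)%:R * iter n tilted_step (ind S) x <=
    \sum_(x <- S) (deg x)%:R * ((K + K^-1 * iter n tilted_step (ind S) x ^+ 2) / 2).
  apply: ler_sum => x _; rewrite ler_wpM2l //.
  move: (iter _ _ _ _) => w; rewrite ler_pdivlMr //.
  have -> : K + K^-1 * w ^+ 2 = w * 2 + K^-1 * (K - w) ^+ 2.
    by field; rewrite gt_eqF.
  by rewrite lerDl mulr_ge0 ?sqr_ge0 // invr_ge0 ltW.
apply: le_trans h _.
have -> : \sum_(x <- S) (deg x)%:R * ((K + K^-1 * iter n tilted_step (ind S) x ^+ 2) / 2) =
  (K * (mu S)%:R + K^-1 * sqnorm S (iter n tilted_step (ind S))) / 2.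
  rewrite /sqnorm /mu natr_sum !mulr_sumr -big_split /= mulr_suml; apply: eq_bigr => x _; ring.
have : sqnorm S (iter n tilted_step (ind S)) <= K ^+ 2 * (mu S)%:R.
  apply: le_trans (sqnorm_tilted_iter _ _ _) _.
  rewrite /K -exprM mulnC; apply: ler_wpM2l; last exact: mu_ind_le.
  by apply: exprn_ge0; exact: ltW.
rewrite ler_pdivrMr // => h.
have : K^-1 * sqnorm S (iter n tilted_step (ind S)) <= K * (mu S)%:R.
  by rewrite ler_pdivrMl // mulrA -expr2.
lra.
Qed.

End Tilt2.

Lemma iter_avg_le n g h x : (forall y, g y <= h y) -> iter n P g x <= iter n P h x.
Proof. by move=> gh; elim: n x => [//|n IH] x; apply: avg_le => // y _; exact: IH. Qed.

Lemma eq_iter_avg n g h x : (forall y, g y = h y) -> iter n P g x = iter n P h x.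
Proof. by move=> gh; congr (iter _ _ _ _); apply/funext. Qed.

Lemma iter_avgZ n c g x : iter n P (fun y => c * g y) x = c * iter n P g x.
Proof. by elim: n x => [//|n IH] x; rewrite !iterS -avgZ; apply: eq_avg => // y _; exact: IH. Qed.

Lemma iter_avgD n g h x : iter n P (fun y => g y + h y) x = iter n P g x + iter n P h x.
Proof. by elim: n x => [//|n IH] x; rewrite !iterS -avgD; apply: eq_avg => // y _; exact: IH. Qed.

Lemma iter_avg_ge0 n g x : (forall y, 0 <= g y) -> 0 <= iter n P g x.
Proof. by move=> g0; elim: n x => [//|n IH] x; apply: avg_ge0 => // y _; exact: IH. Qed.

Lemma iter_avg_const n c x : iter n P (fun=> c) x = c.
Proof.
elim: n x => [//|n IH] x; rewrite iterS -[RHS](avg_const deg_gt0 c x).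
by apply: eq_avg => // y _; exact: IH.
Qed.

Lemma iter_avg_sum (I : Type) (r : seq I) n (F : I -> G -> R) x :
  iter n P (fun y => \sum_(i <- r) F i y) x = \sum_(i <- r) iter n P (F i) x.
Proof.
elim: n x => [//|n IH] x; rewrite iterS -(avg_sum lf deg_gt0).
by apply: eq_avg => // y _; exact: IH.
Qed.

(** From [1 + w / 4 <= expR (w / 4)], raised to the fourth power. *)
Lemma cosh_quartic (v : R) : v ^+ 4 <= 256 * (expR v + expR (- v)).
Proof.
have H (w : R) : 0 <= w -> w ^+ 4 <= 256 * expR w.
  move=> w0; have -> : expR w = expR (w / 4) ^+ 4 by rewrite -expRM_natl; congr expR; field.
  have -> : 256 * expR (w / 4) ^+ 4 = (4 * expR (w / 4)) ^+ 4 by rewrite exprMn; congr (_ * _); ring.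
  have h := expR_ge1Dx (w / 4); have h2 : w <= 4 * expR (w / 4) by lra.
  by apply: lerXn2r => //; rewrite nnegrE // (le_trans w0).
have [v0|v0] := leP 0 v.
  by apply: le_trans (H _ v0) _; rewrite ler_pM2l ?ltr0n // lerDl expR_ge0.
have -> : v ^+ 4 = (- v) ^+ 4 by ring.
apply: le_trans (H (- v) _) _; first by lra.
by rewrite ler_pM2l ?ltr0n // lerDr expR_ge0.
Qed.

(** Exponential moments for [lam] and [- lam] with [lam] of order [n^(-1/2)], for which
    [(1 + 32 * lam^2)^n] is bounded.  In the constant, 256 comes from [cosh_quartic] and
    [4096 * n^2] is [lam^(-4)]. *)
Lemma fourth_moment f n S : (forall x y, adj x y -> `|f x - f y| <= 1) -> (0 < n)%N ->
  \sum_(x <- S) (deg x)%:R * iter (2 * n) P (fun z => ind S z * (f z - f x) ^+ 4) x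
   <= 256 * (4096 * n%:R ^+ 2) * (2 * (expR 1 * (mu S)%:R)).
Proof.
move=> f_lip n0.
have n0R : 0 < n%:R :> R by rewrite ltr0n.
(* the factor 8 makes [lam] small enough for [tilt_mean], and [32 * lam^2 = 1 / (2 * n)] *)
pose lam : R := (8 * Num.sqrt n%:R)^-1.
have s0 : 0 < Num.sqrt n%:R :> R by rewrite sqrtr_gt0.
have s1 : 1 <= Num.sqrt n%:R :> R by rewrite -[leLHS]sqrtr1; apply: ler_wsqrtr; rewrite ler1n.
have ss : Num.sqrt n%:R ^+ 2 = n%:R :> R by rewrite sqr_sqrtr // ltW.
have lam0 : 0 < lam by rewrite invr_gt0 mulr_gt0.
have lam8 : `|lam| <= 8^-1.
  rewrite ger0_norm; last exact: ltW.
  by rewrite /lam lef_pV2 ?posrE ?mulr_gt0 //; lra.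
have lam2 : lam ^+ 2 = (64 * n%:R)^-1.
  by rewrite /lam exprVn exprMn ss; congr (_^-1); congr (_ * _); ring.
have kapn : (1 + 32 * lam ^+ 2) ^+ n <= expR 1.
  have -> : expR 1 = expR (n%:R^-1) ^+ n :> R by rewrite -expRM_natl divff // gt_eqF.
  apply: lerXn2r; rewrite ?nnegrE ?expR_ge0 //.
    by rewrite addr_ge0 // mulr_ge0 // sqr_ge0.
  apply: le_trans (expR_ge1Dx _); rewrite lerD2l lam2 invfM.
  have : 0 < n%:R^-1 :> R by rewrite invr_gt0.
  lra.
have T1 := @tilted_iter_ind f lam f_lip lam8 n S.
have lamN8 : `|- lam| <= 8^-1 by rewrite normrN.
have T2 := @tilted_iter_ind f (- lam) f_lip lamN8 n S.
rewrite sqrrN in T2.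
have key : \sum_(x <- S) (deg x)%:R * iter (2 * n) P (fun z => ind S z * (f z - f x) ^+ 4) x <=
  256 * lam ^- 4 * (\sum_(x <- S) (deg x)%:R * iter n (tilted_step f lam) (ind S) x +
     \sum_(x <- S) (deg x)%:R * iter n (tilted_step f (- lam)) (ind S) x).
  rewrite -big_split /= mulr_sumr; apply: ler_sum => x _.
  rewrite -mulrDr mulrCA ler_wpM2l // !iter_tilted -!iter_avgZ -iter_avgD -iter_avgZ.
  apply: iter_avg_le => z.
  have i0 : 0 <= ind S z by rewrite /ind.
  have := cosh_quartic (lam * (f z - f x)).
  have -> : lam * (f z - f x) = - lam * f x + lam * f z by ring.
  have -> : - (- lam * f x + lam * f z) = - - lam * f x + - lam * f z by ring.
  rewrite !expRD => h.
  have {}h : (f z - f x) ^+ 4 <= 256 * lam ^- 4 * (expR (- lam * f x) * expR (lam * f z) + expR (- - lam * f x) * expR (- lam * f z)).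
    have -> : (f z - f x) ^+ 4 = lam ^- 4 * (- lam * f x + lam * f z) ^+ 4.
      by field; rewrite gt_eqF.
    have l4 : 0 <= lam ^- 4 by rewrite invr_ge0 exprn_ge0 // ltW.
    by have := ler_wpM2l l4 h; rewrite [leRHS]mulrA [lam ^- 4 * 256]mulrC.
  rewrite [leRHS](_ : _ = ind S z * (256 * lam ^- 4 * (expR (- lam * f x) * expR (lam * f z) +
    expR (- - lam * f x) * expR (- lam * f z)))); first exact: ler_wpM2l.
  by ring.
apply: le_trans key _.
have -> : lam ^- 4 = 4096 * n%:R ^+ 2.
  have -> : lam ^+ 4 = lam ^+ 2 ^+ 2 by ring.
  by rewrite lam2; field; rewrite gt_eqF.
have Smu : 0 <= (mu S)%:R :> R by [].
have X := ler_wpM2r Smu kapn.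
set A := \sum_(x <- S) _ in T1 *; set B := \sum_(x <- S) _ in T2 *.
have AB : A + B <= 2 * (expR 1 * (mu S)%:R) by lra.
apply: ler_wpM2l; last exact: AB.
apply: mulr_ge0; first exact: ler0n.
by apply: mulr_ge0; [exact: ler0n|exact: sqr_ge0].
Qed.

End Moment.

(** * Random Lipschitz functions that separate distant points *)

Lemma sum_constT (R : pzSemiRingType) (I : finType) (c : R) : \sum_(i : I) c = #|{: I}|%:R * c.
Proof. by rewrite sumr_const mulr_natl. Qed.

Section SeparatingFunction.
Variables (R : realType) (G : sgraph) (root : set G -> G).
Hypothesis Gc : connected_graph G.
Hypothesis rootP : forall (C : set G) x, C x -> C (root C).
Hypothesis Gp : planar R G.
Variables (k : nat) (S : {fset G}).
Hypothesis k0 : (0 < k)%N.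
Let D := (12 * k)%N.

Section OnePartition.
Variable rs : seq nat.
Local Notation cl := (piece root D rs).

Lemma cl_sym x y : cl x y -> cl y x.
Proof. by move=> xy; rewrite (piece_eq xy); exact: piece_self. Qed.

Lemma cl_trans y x z : cl x y -> cl y z -> cl x z.
Proof. by move=> xy; rewrite (piece_eq xy). Qed.

(** One less than the distance from [x] to the complement of its piece, capped at [k]. *)
Definition pad x : nat := \max_(j < k.+1 | `[< gball x j `<=` cl x >]) j.

Lemma pad_ball x : gball x (pad x) `<=` cl x.
Proof.
rewrite /pad; apply: (big_ind (fun j => gball x j `<=` cl x)).
- move=> y; rewrite /gball /= leqn0 => /eqP/(gdist_eq0 Gc) <-; exact: piece_self.
- by move=> i j hi hj; rewrite /maxn; case: ifP.
- by move=> j /asboolP.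
Qed.

Lemma le_pad x j : (j <= k)%N -> gball x j `<=` cl x -> (j <= pad x)%N.
Proof.
move=> jk h; have jk' : (j < k.+1)%N by [].
by rewrite /pad; apply: (leq_bigmax_cond (Ordinal jk')); apply/asboolP.
Qed.

Lemma pad_le x : (pad x <= k)%N.
Proof. by apply/bigmax_leqP => j _; rewrite -ltnS. Qed.

Lemma pad_cut x y : adj x y -> ~ cl x y -> pad x = 0%N.
Proof.
move=> xy ncl; apply/eqP; rewrite -leqn0 leqNgt; apply/negP => p0; apply: ncl.
by apply: pad_ball; rewrite /gball /=; apply: leq_trans (gdist_adj Gc xy) p0.
Qed.

Lemma pad_lip x y : adj x y -> cl x y -> (pad x <= pad y + 1)%N.
Proof.
move=> xy clxy; case p : (pad x) => [//|j]; rewrite addn1 ltnS.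
apply: le_pad; first by have := pad_le x; rewrite p; exact: ltnW.
move=> z; rewrite /gball /= => yz; rewrite (piece_eq clxy); apply: pad_ball.
rewrite p /gball /=; apply: leq_trans (gdist_tri Gc x y z) _.
by have := gdist_adj Gc xy; lia.
Qed.

(** Finite labelling of the pieces, faithful on those that meet [S]. *)
Definition piece_index x : 'I_(size S).+1 := inord (find (fun s => `[< cl s x >]) S).

Lemma piece_index_eq x y : cl x y -> piece_index x = piece_index y.
Proof.
move=> xy; congr inord; apply: eq_find => s; apply: asbool_equiv_eq; split=> h.
  exact: cl_trans h xy.
by apply: cl_trans h _; exact: cl_sym.
Qed.

Lemma piece_index_inj x y : x \in S -> y \in S -> piece_index x = piece_index y -> cl x y.
Proof.
have fS z : z \in S -> has (fun s => `[< cl s z >]) S.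
  by move=> zS; apply/hasP; exists z => //; apply/asboolP; exact: piece_self.
move=> xS yS /(congr1 val); rewrite /= !inordK ?ltnS ?find_size // => e.
have /asboolP hx := nth_find x (fS x xS); have /asboolP hy := nth_find x (fS y yS).
rewrite -e in hy; apply: cl_trans hy; exact: cl_sym.
Qed.

Local Notation sign := {ffun 'I_(size S).+1 -> bool}.

Definition sep (sg : sign) x : R := (-1) ^+ sg (piece_index x) * (pad x)%:R.

(** Inside a piece the sign is constant and the depth is 1-Lipschitz; where an edge leaves a
    piece, the depth vanishes at both ends. *)
Lemma sep_lip sg x y : adj x y -> `|sep sg x - sep sg y| <= 1.
Proof.
move=> xy; have yx : adj y x by rewrite adj_sym.
rewrite /sep; have [clxy|ncl] := pselect (cl x y); last first.
  have ncl' : ~ cl y x by move=> /cl_sym.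
  rewrite (pad_cut xy ncl) (pad_cut yx ncl').
  by rewrite !mulr0 subrr normr0.
rewrite (piece_index_eq clxy) -mulrBr normrM normrX normrN1 expr1n mul1r.
have := pad_lip xy clxy; have := pad_lip yx (cl_sym clxy).
rewrite -!(ler_nat R) !natrD => h1 h2.
by rewrite ler_norml; apply/andP; split; lra.
Qed.

(** Flip the sign of the piece of [x].  As [z] is in another piece, the two values of the
    difference are [a - c] and [a + c] with [c] the signed depth of [x], and
    [(a - c)^4 + (a + c)^4 >= 2 * c^4]. *)
Lemma sep_average x z : x \in S -> z \in S -> ~ cl x z ->
  #|{: sign}|%:R * (pad x)%:R ^+ 4 <= \sum_(sg : sign) (sep sg z - sep sg x) ^+ 4.
Proof.
move=> xS zS ncl.
have ne : piece_index z != piece_index x.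
  by apply/eqP => /esym/(piece_index_inj xS zS).
pose flip (sg : sign) : sign := [ffun i => if i == piece_index x then ~~ sg i else sg i].
have flipK : involutive flip.
  by move=> sg; apply/ffunP => i; rewrite !ffunE; case: eqP => // _; rewrite negbK.
have e : \sum_(sg : sign) (sep sg z - sep sg x) ^+ 4 = \sum_(sg : sign) (sep (flip sg) z - sep (flip sg) x) ^+ 4.
  by rewrite (reindex_inj (inv_inj flipK)).
suff : 2 * (#|{: sign}|%:R * (pad x)%:R ^+ 4) <=
    \sum_(sg : sign) ((sep sg z - sep sg x) ^+ 4 + (sep (flip sg) z - sep (flip sg) x) ^+ 4).
  rewrite big_split /= -e; lra.
rewrite mulrCA -sum1_card natr_sum mulr_suml; apply: ler_sum => sg _.
rewrite mul1r /sep !ffunE eqxx (negbTE ne).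
have -> : (-1) ^+ (~~ sg (piece_index x)) = - (-1) ^+ sg (piece_index x) :> R.
  by case: (sg _); rewrite ?expr0 ?expr1 ?opprK.
have s2 : (-1) ^+ sg (piece_index x) ^+ 2 = 1 :> R by rewrite sqrr_sign.
set s := (-1) ^+ sg (piece_index x) in s2 *.
move: ((-1) ^+ sg (piece_index z) * (pad z)%:R) ((pad x)%:R : R) => a b.
have -> : b ^+ 4 = (s * b) ^+ 4.
  have s4 : s ^+ 4 = 1 by rewrite (exprM s 2 2) s2 expr1n.
  by rewrite exprMn s4 mul1r.
have -> : - s * b = - (s * b) by rewrite mulNr.
move: (s * b) => c.
have -> : (a - c) ^+ 4 + (a - - c) ^+ 4 = 2 * c ^+ 4 + (2 * (a ^+ 2) ^+ 2 + 12 * (a * c) ^+ 2) by ring.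
by rewrite lerDl addr_ge0 // mulr_ge0 // sqr_ge0.
Qed.

End OnePartition.

Definition shifts := ('I_D * 'I_D * 'I_D)%type.
Definition shift_seq (p : shifts) : seq nat := [:: nat_of_ord p.2; nat_of_ord p.1.2; nat_of_ord p.1.1].

Lemma card_shifts : #|{: shifts}| = (D ^ 3)%N.
Proof. by rewrite !card_prod !card_ord; lia. Qed.

Lemma D_gt0 : (0 < D)%N.
Proof. by rewrite muln_gt0. Qed.

(** For at least half of the shifts the ball of radius [k] is uncut, and then the depth is [k]. *)
Lemma pad_average x : (k%:R ^+ 4 * (D%:R ^+ 3 / 2) : R) <= \sum_(p : shifts) (pad (shift_seq p) x)%:R ^+ 4.
Proof.
have bad : (\sum_(p : shifts) unpadded root D (shift_seq p) x k <= 6 * k * D ^ 2)%N.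
  apply: leq_trans (unpadded3 Gc rootP x k D_gt0).
  by rewrite [leqRHS]pair_bigA [leqRHS]pair_bigA /=.
apply: (@le_trans _ _ (\sum_(p : shifts) k%:R ^+ 4 * (1 - (unpadded root D (shift_seq p) x k)%:R))).
  rewrite -mulr_sumr; apply: ler_wpM2l; first exact: exprn_ge0.
  rewrite sumrB sum_constT mulr1 -natr_sum card_shifts.
  have : (2 * \sum_(p : shifts) unpadded root D (shift_seq p) x k <= D ^ 3)%N.
    by rewrite (_ : D ^ 3 = 2 * (6 * k * D ^ 2))%N ?leq_mul2l // /D; lia.
  rewrite -(ler_nat R) natrM natrX; lra.
apply: ler_sum => p _; rewrite /unpadded; case: asboolP => h /=; last first.
  by rewrite subrr mulr0 exprn_ge0.
rewrite subr0 mulr1 lerXn2r ?nnegrE ?ler0n // ler_nat.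
exact: le_pad.
Qed.

Hypothesis lf : forall x : G, finite_set (neighbors x).
Hypothesis deg_gt0 : forall x : G, (0 < deg x)%N.

(** The constant 336 is [28 * 12]: pieces cut with width [12 * k] have diameter below [336 * k]. *)
Lemma far_average x z : x \in S -> z \in S -> (336 * k <= gdist x z)%N ->
  #|{: {ffun 'I_(size S).+1 -> bool}}|%:R * (k%:R ^+ 4 * (D%:R ^+ 3 / 2)) <=
  \sum_(p : shifts) \sum_(sg : {ffun 'I_(size S).+1 -> bool})
    (sep (shift_seq p) sg z - sep (shift_seq p) sg x) ^+ 4.
Proof.
move=> xS zS far; apply: (le_trans (ler_wpM2l _ (pad_average x))) => //.
rewrite mulr_sumr; apply: ler_sum => p _; apply: sep_average => // clxz.
have := piece_diam Gc rootP Gp D_gt0 (erefl : size (shift_seq p) = 3%N)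
  (piece_self root D (shift_seq p) x) clxz.
by rewrite /D; lia.
Qed.

Local Notation P := (@avg R G).

(** Average [fourth_moment] over the shifts and signs, and bound the average of the fourth
    powers below by [far_average] at pairs of distant points. *)
Lemma tail_bound n : (0 < n)%N ->
  \sum_(x <- S) (deg x)%:R * iter (2 * n) P (fun z => ind R S z * (336 * k <= gdist x z)%N%:R) x
  <= 2 * (256 * 4096 * (2 * expR 1)) * (n%:R ^+ 2 / k%:R ^+ 4) * (mu S)%:R.
Proof.
move=> n0; set K := 256 * 4096 * _.
pose N : R := #|{: {ffun 'I_(size S).+1 -> bool}}|%:R.
have N0 : 0 < N by rewrite ltr0n card_ffun expn_gt0 card_bool.
have kR : 0 < k%:R :> R by rewrite ltr0n.
have DR : 0 < D%:R :> R by rewrite ltr0n D_gt0.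
set T := \sum_(x <- S) _.
pose M f := \sum_(x <- S) (deg x)%:R * iter (2 * n) P (fun z => ind R S z * (f z - f x) ^+ 4) x.
have up : \sum_(p : shifts) \sum_(sg : {ffun 'I_(size S).+1 -> bool}) M (sep (shift_seq p) sg)
    <= D%:R ^+ 3 * N * (K * n%:R ^+ 2 * (mu S)%:R).
  apply: (@le_trans _ _ (\sum_(p : shifts) \sum_(sg : {ffun 'I_(size S).+1 -> bool}) (K * n%:R ^+ 2 * (mu S)%:R))).
    apply: ler_sum => p _; apply: ler_sum => sg _.
    apply: (le_trans (fourth_moment lf deg_gt0 S (@sep_lip (shift_seq p) sg) n0)).
    rewrite le_eqVlt; apply/orP; left; apply/eqP; rewrite /K.
    move: (256 : R) (4096 : R) (expR 1 : R) => a b c; ring.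
  by rewrite !sum_constT card_shifts natrX mulrA.
have low : N * (k%:R ^+ 4 * (D%:R ^+ 3 / 2)) * T <=
    \sum_(p : shifts) \sum_(sg : {ffun 'I_(size S).+1 -> bool}) M (sep (shift_seq p) sg).
  have -> : \sum_(p : shifts) \sum_(sg : {ffun 'I_(size S).+1 -> bool}) M (sep (shift_seq p) sg) =
     \sum_(x <- S) (deg x)%:R * iter (2 * n) P (fun z => ind R S z *
       \sum_(p : shifts) \sum_(sg : {ffun 'I_(size S).+1 -> bool})
          (sep (shift_seq p) sg z - sep (shift_seq p) sg x) ^+ 4) x.
    rewrite pair_bigA /= exchange_big /=; apply: eq_bigr => x _.
    rewrite -mulr_sumr -iter_avg_sum //; congr (_ * _); apply: eq_iter_avg => z.
    by rewrite pair_bigA /= mulr_sumr.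
  rewrite /T mulr_sumr big_seq [leRHS]big_seq; apply: ler_sum => x xS.
  rewrite mulrCA; apply: ler_wpM2l => //; rewrite -iter_avgZ //; apply: iter_avg_le => // z.
  rewrite /ind; have [zS|zS] := boolP (z \in S); last by rewrite !mul0r mulr0.
  rewrite !mul1r; case: leqP => far; first by rewrite mulr1; apply: far_average.
  rewrite mulr0; apply: sumr_ge0 => p _; apply: sumr_ge0 => sg _.
  by rewrite (exprM _ 2 2); exact: sqr_ge0.
have {up low} := le_trans low up.
have -> : N * (k%:R ^+ 4 * (D%:R ^+ 3 / 2)) * T = (N * D%:R ^+ 3 / 2) * (k%:R ^+ 4 * T) by ring.
have -> : D%:R ^+ 3 * N * (K * n%:R ^+ 2 * (mu S)%:R) = (N * D%:R ^+ 3 / 2) * (2 * K * n%:R ^+ 2 * (mu S)%:R).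
  by field.
rewrite ler_pM2l ?divr_gt0 ?mulr_gt0 ?exprn_gt0 // => h.
have -> : 2 * K * (n%:R ^+ 2 / k%:R ^+ 4) * (mu S)%:R = (2 * K * n%:R ^+ 2 * (mu S)%:R) / k%:R ^+ 4.
  by field; rewrite gt_eqF // exprn_gt0.
by rewrite ler_pdivlMr ?exprn_gt0 // mulrC.
Qed.

End SeparatingFunction.

(** * Edge boundaries and amenability *)

Section Boundary.
Variables (R : realType) (G : sgraph).
Hypothesis lf : forall x : G, finite_set (neighbors x).
Hypothesis deg_gt0 : forall x : G, (0 < deg x)%N.
Implicit Types (g h : G -> R) (x y z : G) (W S F : {fset G}).

Definition bdry S : nat := \sum_(x <- S) \sum_(y <- nbr x) (y \notin S).

Lemma fset2_inj_cut S x y x' y' : x \in S -> y \notin S -> x' \in S -> y' \notin S ->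
  [fset x; y]%fset = [fset x'; y']%fset -> x = x' /\ y = y'.
Proof.
move=> xS yS x'S y'S /fsetP e; split.
  have := e x; rewrite !inE eqxx /= => /esym/orP[/eqP//|/eqP ex].
  by rewrite ex (negbTE y'S) in xS.
have := e y; rewrite !inE eqxx orbT => /esym/orP[/eqP ey|/eqP//].
by rewrite ey x'S in yS.
Qed.

(** An edge with exactly one endpoint in [S] has a single orientation that leaves [S]. *)
Lemma card_edge_boundary S : #|` fset_set (edge_boundary S)| = bdry S.
Proof.
pose s := [seq (x, y) | x <- S, y <- [seq y <- nbr x | y \notin S]].
have sP p : (p \in s) = [&& p.1 \in S, p.2 \notin S & adj p.1 p.2].
  apply/allpairsPdep/idP => [[x [y [xS]]]|].
    by rewrite mem_filter in_nbr // => /andP[yS xy] -> /=; rewrite xS yS.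
  move=> /and3P[p1 p2 pa]; exists p.1, p.2; split => //; last by case: p {p1 p2 pa}.
  by rewrite mem_filter in_nbr // p2.
have us : uniq s.
  apply: allpairs_uniq_dep => [|x _|]; [exact: fset_uniq|by rewrite filter_uniq ?fset_uniq|].
  by move=> [x y] [x' y'] _ _ /= [-> ->].
pose e := [seq [fset p.1; p.2]%fset | p <- s].
have ue : uniq e.
  rewrite map_inj_in_uniq // => -[x y] [x' y'].
  rewrite !sP /= => /and3P[a1 a2 _] /and3P[b1 b2 _] /(fset2_inj_cut a1 a2 b1 b2)[-> ->] //.
have -> : fset_set (edge_boundary S) = [fset A in e]%fset.
  rewrite -[RHS]set_fsetK; congr fset_set.
  apply/seteqP; split => A /=; rewrite !inE /=.
    move=> [[x [y [xy ->]]] /eqP c1]; apply/mapP.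
    have : (x \in S) (+) (y \in S).
      have nxy : x != y by apply/eqP => exy; rewrite exy adj_irr in xy.
      have [xS|xS] := boolP (x \in S); have [yS|yS] := boolP (y \in S) => //.
        exfalso; move: c1; rewrite (_ : _ `&` _ = [fset x; y])%fset ?cardfs2 ?nxy //.
        by apply/fsetIidPl; apply/fsubsetP => z; rewrite !inE => /orP[]/eqP->.
      exfalso; move: c1; rewrite (_ : _ `&` _ = fset0)%fset ?cardfs0 //.
      apply/fsetP => z; rewrite !inE; apply/negbTE/negP => /andP[/orP[]/eqP-> h].
        by rewrite h in xS.
      by rewrite h in yS.
    case xS : (x \in S) => /= yS; [exists (x, y)|exists (y, x)]; rewrite ?sP /= ?xS ?yS //.
      by rewrite adj_sym.
    by rewrite fsetUC.
  move=> /mapP[[x y]]; rewrite sP /= => /and3P[xS yS xy] ->; split; first by exists x, y.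
  rewrite (_ : _ `&` _ = [fset x])%fset ?cardfs1 //.
  apply/fsetP => z; rewrite !inE; apply/andP/eqP => [[/orP[]/eqP->//]|->].
    by rewrite (negbTE yS).
  by rewrite eqxx.
rewrite card_fseq undup_id // size_map size_allpairs_dep sumnE big_map /bdry.
apply: eq_bigr => x _; rewrite size_filter -sum1_count big_mkcond /=.
by apply: eq_bigr => y _; case: (y \in S).
Qed.

Lemma mu_gt0 S : S != fset0 -> (0 < mu S)%N.
Proof.
move=> /fset0Pn[x xS]; rewrite /mu (big_fsetD1 x xS) /=.
by rewrite addn_gt0 deg_gt0.
Qed.

Lemma phiE S : phi R S = (bdry S)%:R / (mu S)%:R.
Proof. by rewrite /phi card_edge_boundary. Qed.

Lemma phi_ge0 S : 0 <= phi R S.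
Proof. by rewrite /phi divr_ge0. Qed.

(** Capping the isoperimetric constant at 1/2 keeps [1 - h^2] positive. *)
Lemma nonamenable_gap : ~ amenable R G ->
  exists h : R, [/\ 0 < h, h <= 2^-1 & forall S, h * (mu S)%:R <= (bdry S)%:R].
Proof.
rewrite /amenable; set A := [set phi R S | S in _] => na.
have lbA : lbound A 0 by move=> _ [S _ <-]; exact: phi_ge0.
have hlb : has_lbound A by exists 0.
have [Ane|A0] := pselect (A !=set0); last first.
  exfalso; apply: na; rewrite (_ : A = set0) ?inf0 //.
  by apply/eqP; case: eqVneq => // /set0P.
have i0 : 0 < inf A.
  by rewrite lt_neqAle eq_sym; apply/andP; split; [apply/eqP|apply: lb_le_inf].
exists (Num.min (inf A) 2^-1); split.
- by rewrite lt_min i0 /= invr_gt0.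
- by rewrite ge_min lexx orbT.
move=> S; have [->|S0] := eqVneq S fset0.
  by rewrite /mu big_nil mulr0.
have m0 : 0 < (mu S)%:R :> R by rewrite ltr0n mu_gt0.
rewrite -ler_pdivlMr // -phiE; apply: (@le_trans _ _ (inf A)).
  by rewrite ge_min lexx.
by apply: ge_inf => //; exists S.
Qed.

Lemma amenable_small : amenable R G -> (exists x : G, True) -> forall e : R, 0 < e ->
  exists S, S != fset0 /\ (bdry S)%:R <= e * (mu S)%:R.
Proof.
rewrite /amenable; set A := [set phi R S | S in _] => am [x _] e e0.
have [|_ [S S0 <-]] := @inf_adherent _ A e e0.
  split; first by exists (phi R [fset x]%fset), [fset x]%fset => //=; rewrite -cardfs_gt0 cardfs1.
  by exists 0 => _ [S _ <-]; exact: phi_ge0.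
rewrite am add0r phiE ltr_pdivrMr ?ltr0n ?mu_gt0 // => h.
by exists S; split => //; exact: ltW.
Qed.

End Boundary.

(** * Diffusive displacement in amenable graphs *)

Section Exit.
Variables (R : realType) (G : sgraph).
Hypothesis lf : forall x : G, finite_set (neighbors x).
Hypothesis deg_gt0 : forall x : G, (0 < deg x)%N.
Implicit Types (g h : G -> R) (x y z : G) (S : {fset G}).
Local Notation P := (@avg R G).

Lemma iter_avg_le_reach t g h x : (forall z, walk_in setT t x z -> g z <= h z) ->
  iter t P g x <= iter t P h x.
Proof.
elim: t x => [|t IH] x gh; first by apply: gh.
rewrite !iterS; apply: avg_le => // y xy; apply: IH => z yz.
by apply: gh; rewrite -add1n; apply: walk_in_cat yz; apply: walk_in1.
Qed.

Lemma ind_le1 S x : ind R S x <= 1.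
Proof. by rewrite /ind; case: (_ \in _). Qed.

Lemma ind_ge0 S x : 0 <= ind R S x.
Proof. by rewrite /ind. Qed.

Lemma iter_avg_ind_le1 t S x : iter t P (ind R S) x <= 1.
Proof.
rewrite -[leRHS](iter_avg_const lf deg_gt0 t 1 x); apply: iter_avg_le => // y; exact: ind_le1.
Qed.

(** The walk started from the degree distribution on [S] uses a given boundary edge at each
    step with at most its stationary weight; add up over [t] steps. *)
Lemma exit_bound t S :
  \sum_(x <- S) (deg x)%:R * (1 - iter t P (ind R S) x) <= t%:R * (bdry S)%:R.
Proof.
elim: t => [|t IH].
  rewrite mul0r big_seq big1 // => x xS; rewrite /= /ind xS subrr mulr0 //.
pose a y := 1 - iter t P (ind R S) y.
have a0 y : 0 <= a y by rewrite subr_ge0 iter_avg_ind_le1.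
have a1 y : a y <= 1 by rewrite gerBl iter_avg_ge0 // => z; exact: ind_ge0.
have E x : 1 - iter t.+1 P (ind R S) x = P a x.
  rewrite iterS (_ : P a x = P (fun y => 1 + -1 * iter t P (ind R S) y) x).
    by rewrite avgD avgZ avg_const // mulN1r.
  by apply: eq_avg => // y _; rewrite mulN1r.
apply: (@le_trans _ _ (\sum_(x <- S) \sum_(y <- nbr x) (ind R S y * a y) + (bdry S)%:R)).
  rewrite /bdry natr_sum -big_split /=; apply: ler_sum => x _.
  rewrite E /avg mulrA divff ?mul1r; last exact: degR_neq0.
  rewrite natr_sum -big_split /=; apply: ler_sum => y _.
  rewrite /ind; case: (y \in S) => /=; first by rewrite mul1r addr0.
  by rewrite mul0r add0r.
rewrite -natr1 mulrDl mul1r lerD2r; apply: le_trans IH.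
apply: le_trans (exchange_nbr lf _ _) _.
  by move=> x y; rewrite mulr_ge0 // ind_ge0.
apply: (@le_trans _ _ (\sum_(y <- nbhd S | y \in S) (deg y)%:R * a y)).
  rewrite [leRHS]big_mkcond; apply: ler_sum => y _.
  rewrite big_const_seq count_predT iter_addr_0 -[(_ * _) *+ _]mulr_natl /ind.
  by case: (y \in S) => /=; rewrite ?mul1r ?mul0r ?mulr0.
rewrite big_fset_condE; apply: fsum_subset_le => [|x]; last by rewrite mulr_ge0.
by apply/fsubsetP => x; rewrite !inE => /andP[].
Qed.

End Exit.

(** Layer-cake bound: the square of [d] is controlled by the last dyadic threshold that [d]
    exceeds. *)
Lemma dyadic_sqr (A J d : nat) : (d < A * 2 ^ J)%N ->
  (d ^ 2 <= A ^ 2 + \sum_(j < J) (A * 2 ^ j.+1) ^ 2 * (A * 2 ^ j <= d))%N.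
Proof.
elim: J => [|J IH]; first by rewrite big_ord0 addn0 muln1 => /ltnW; rewrite leq_exp2r.
rewrite big_ord_recr /= addnA => dJ; have [lt|ge] := ltnP d (A * 2 ^ J).
  by apply: leq_trans (IH lt) _; exact: leq_addr.
by rewrite muln1; apply: leq_trans (leq_addl _ _); rewrite leq_exp2r // ltnW.
Qed.

Section Diffusive.
Variables (R : realType) (G : sgraph).
Hypothesis Gc : connected_graph G.
Hypothesis Gp : planar R G.
Hypothesis lf : forall x : G, finite_set (neighbors x).
Hypothesis deg_gt0 : forall x : G, (0 < deg x)%N.
Variable root : set G -> G.
Hypothesis rootP : forall (C : set G) x, C x -> C (root C).
Implicit Types (x y z : G) (S : {fset G}).
Local Notation P := (@avg R G).

Lemma geometric_quarter J : \sum_(j < J) (4^-1 : R) ^+ j <= 2.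
Proof.
suff : \sum_(j < J) (4^-1 : R) ^+ j <= 2 - 2 * 4^-1 ^+ J.
  by move=> h; apply: le_trans h _; rewrite gerBl mulr_ge0 // exprn_ge0 // invr_ge0.
elim: J => [|J IH]; first by rewrite big_ord0 expr0; lra.
rewrite big_ord_recr /= exprS.
have : 0 <= (4^-1 : R) ^+ J by rewrite exprn_ge0 // invr_ge0.
lra.
Qed.

Lemma near_sqrt n : (0 < n)%N -> exists s : nat, [/\ (0 < s)%N, (n <= s ^ 2)%N & (s ^ 2 <= 4 * n)%N].
Proof.
move=> n0; have ex : exists s, (n <= s ^ 2)%N by exists n; nia.
case: (ex_minnP ex) => s ns smin; exists s.
have s0 : (0 < s)%N by case: s ns {smin} => //; rewrite leqNgt n0.
split=> //; case: s ns smin s0 => [//|[|s]] ns smin _; first by lia.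
rewrite leqNgt; apply/negP => lt; have := smin s.+1; rewrite ltnn; nia.
Qed.

(** The constant of [tail_bound]. *)
Let K : R := 2 * (256 * 4096 * (2 * expR 1)).

Lemma K_ge0 : 0 <= K.
Proof.
rewrite /K; apply: mulr_ge0; first exact: ler0n.
apply: mulr_ge0; first by apply: mulr_ge0; exact: ler0n.
by apply: mulr_ge0; [exact: ler0n|exact: expR_ge0].
Qed.

Let K2 : R := 336%:R ^+ 2 * (4 + 8 * K).

(** Split the distance at the thresholds [336 * s * 2^j] with [s] of order [sqrt n].  Below
    the first one the square is [O(n)]; the [j]-th one contributes [O(n * 4^(- j))] by
    [tail_bound], as [4^j] from the square meets [16^(- j)] from the tail. *)
Lemma second_moment_inside n S : (0 < n)%N ->
  \sum_(x <- S) (deg x)%:R * iter (2 * n) P (fun z => ind R S z * (gdist x z)%:R ^+ 2) x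
   <= K2 * n%:R * (mu S)%:R.
Proof.
move=> n0; have [s [s0 ns sn]] := near_sqrt n0.
have K0 := K_ge0.
(* large enough for [2^J] to exceed all distances within [S] *)
pose J := (\sum_(x <- S) \sum_(z <- S) gdist x z)%N.
pose A := (336 * s)%N.
have far x z : x \in S -> z \in S -> (gdist x z < A * 2 ^ J)%N.
  move=> xS zS; have dJ : (gdist x z <= J)%N.
    rewrite /J (big_fsetD1 x xS) (big_fsetD1 z zS) /= -addnA; exact: leq_addr.
  apply: (@leq_trans (2 ^ J)%N); first exact: leq_ltn_trans dJ (ltn_expl _ _).
  by rewrite leq_pmull // muln_gt0.
pose tl j x := iter (2 * n) P (fun z => ind R S z * (336 * (s * 2 ^ j) <= gdist x z)%N%:R) x.
have step x : x \in S -> iter (2 * n) P (fun z => ind R S z * (gdist x z)%:R ^+ 2) x <=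
   A%:R ^+ 2 + \sum_(j < J) ((A * 2 ^ j.+1)%:R ^+ 2 * tl j x).
  move=> xS.
  apply: (@le_trans _ _ (iter (2 * n) P (fun z => A%:R ^+ 2 * ind R S z +
     \sum_(j < J) (A * 2 ^ j.+1)%:R ^+ 2 * (ind R S z * (336 * (s * 2 ^ j) <= gdist x z)%N%:R)) x)).
    apply: iter_avg_le => // z; rewrite /ind; have [zS|zS] := boolP (z \in S); last first.
      by rewrite !mul0r mulr0 add0r; apply: sumr_ge0 => j _; rewrite mul0r mulr0.
    rewrite mul1r mulr1; have := dyadic_sqr (far x z xS zS).
    rewrite -(ler_nat R) natrD !natrX natr_sum => h; apply: le_trans h _.
    rewrite lerD2l; apply: ler_sum => j _; rewrite mul1r natrM natrX /A mulnA //.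
  rewrite iter_avgD // iter_avgZ // iter_avg_sum //; apply: lerD.
    by rewrite ler_piMr ?sqr_ge0 // iter_avg_ind_le1.
  by apply: ler_sum => j _; rewrite iter_avgZ.
apply: (@le_trans _ _ (\sum_(x <- S) (deg x)%:R * (A%:R ^+ 2 + \sum_(j < J) ((A * 2 ^ j.+1)%:R ^+ 2 * tl j x)))).
  by rewrite big_seq [leRHS]big_seq; apply: ler_sum => x xS; apply: ler_wpM2l => //; exact: step.
have -> : \sum_(x <- S) (deg x)%:R * (A%:R ^+ 2 + \sum_(j < J) ((A * 2 ^ j.+1)%:R ^+ 2 * tl j x)) =
   A%:R ^+ 2 * (mu S)%:R + \sum_(j < J) (A * 2 ^ j.+1)%:R ^+ 2 * \sum_(x <- S) (deg x)%:R * tl j x.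
  under [in RHS]eq_bigr do rewrite mulr_sumr.
  rewrite exchange_big /= /mu natr_sum mulr_sumr -big_split /=; apply: eq_bigr => x _.
  rewrite mulrDr [_ * A%:R ^+ 2]mulrC mulr_sumr; congr (_ + _).
  by apply: eq_bigr => j _; rewrite mulrCA.
have nR : 0 < n%:R :> R by rewrite ltr0n.
have sR : 0 < s%:R :> R by rewrite ltr0n.
have m0 : 0 <= (mu S)%:R :> R by [].
have ns' : n%:R <= s%:R ^+ 2 :> R by rewrite -natrX ler_nat.
have sn' : s%:R ^+ 2 <= 4 * n%:R :> R by rewrite -natrX -natrM ler_nat.
have b0 : 0 <= 336%:R ^+ 2 :> R by exact: sqr_ge0.
have t1 : A%:R ^+ 2 * (mu S)%:R <= 336%:R ^+ 2 * (4 * n%:R) * (mu S)%:R :> R.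
  by apply: ler_wpM2r => //; rewrite /A natrM exprMn; apply: ler_wpM2l.
have t2 : \sum_(j < J) (A * 2 ^ j.+1)%:R ^+ 2 * (\sum_(x <- S) (deg x)%:R * tl j x) <=
   \sum_(j < J) (336%:R ^+ 2 * 4 * K * n%:R * (mu S)%:R) * 4^-1 ^+ j.
  apply: ler_sum => j _.
  have s2j : (0 < s * 2 ^ j)%N by rewrite muln_gt0 s0 expn_gt0.
  have tb := tail_bound Gc rootP Gp S s2j lf deg_gt0 n0.
  rewrite -/K in tb; rewrite -/(tl j _) in tb.
  apply: (le_trans (ler_wpM2l (sqr_ge0 _) tb)).
  have -> : (A * 2 ^ j.+1)%:R ^+ 2 * (K * (n%:R ^+ 2 / (s * 2 ^ j)%:R ^+ 4) * (mu S)%:R) =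
     336%:R ^+ 2 * 4 * K * (n%:R * (n%:R / s%:R ^+ 2)) * (mu S)%:R * 4^-1 ^+ j :> R.
    rewrite /A !natrM !natrX [2 ^+ j.+1]exprS exprVn.
    have -> : 4 ^+ j = (2 ^+ j) ^+ 2 :> R by rewrite -exprM mulnC exprM; congr (_ ^+ j); rewrite expr2 -natrM.
    have p0 : 2 ^+ j != 0 :> R by rewrite expf_neq0 // pnatr_eq0.
    move: (2 ^+ j : R) p0 (336%:R : R) => u u0 v.
    by field; rewrite u0 gt_eqF.
  apply: ler_wpM2r; first by rewrite exprn_ge0 // invr_ge0.
  apply: ler_wpM2r => //; rewrite -[leRHS]mulrA -[leLHS]mulrA.
  apply: ler_wpM2l; first by apply: mulr_ge0 => //; apply: mulr_ge0.
  apply: ler_wpM2l => //; apply: ler_piMr; first exact: ltW.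
  by rewrite ler_pdivrMr ?exprn_gt0 // mul1r.
rewrite -mulr_sumr in t2.
have t3 := geometric_quarter J.
have c0 : 0 <= 336%:R ^+ 2 * 4 * K * n%:R * (mu S)%:R.
  by apply: mulr_ge0 => //; apply: mulr_ge0; last exact: ltW; apply: mulr_ge0 => //; apply: mulr_ge0.
have t4 := ler_wpM2l c0 t3.
apply: le_trans (lerD t1 (le_trans t2 t4)) _.
by rewrite /K2 le_eqVlt; apply/orP; left; apply/eqP; move: (336%:R : R) => u; ring.
Qed.

Lemma sum_le_exists S (a : G -> R) (c : R) : S != fset0 ->
  \sum_(x <- S) (deg x)%:R * a x <= c * (mu S)%:R -> exists2 x, x \in S & a x <= c.
Proof.
move=> S0 h; apply: contrapT => nex.
have gt x : x \in S -> c < a x.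
  by move=> xS; rewrite ltNge; apply/negP => le; apply: nex; exists x.
have /fset0Pn[x xS] := S0.
suff : c * (mu S)%:R < \sum_(x <- S) (deg x)%:R * a x by rewrite ltNge h.
rewrite /mu natr_sum mulr_sumr.
rewrite (big_fsetD1 x xS) [ltRHS](big_fsetD1 x xS) /=; apply: ltr_leD.
  by rewrite mulrC ltr_pM2l ?gt // ltr0n.
rewrite big_seq [leRHS]big_seq; apply: ler_sum => y; rewrite !inE => /andP[_ yS].
by rewrite mulrC ler_wpM2l // ltW // gt.
Qed.

Hypothesis am : amenable R G.
Hypothesis inhabited : exists x : G, True.

(** Take a Folner set whose relative boundary is [1 / (8 * n^2)].  Outside of it, bound the
    distance by the number of steps: this costs [(2 * n)^2] times the probability of exit,
    that is [n] in total. *)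
Lemma diffusive_even n : (0 < n)%N -> exists x,
  iter (2 * n) P (fun z => (gdist x z)%:R ^+ 2) x <= (K2 + 1) * n%:R.
Proof.
move=> n0; have nR : 0 < n%:R :> R by rewrite ltr0n.
have e0 : 0 < ((2 * n)%:R ^+ 2 * 2)^-1 :> R by rewrite invr_gt0 mulr_gt0 // exprn_gt0 // ltr0n muln_gt0.
have [S [S0 small]] := amenable_small lf deg_gt0 am inhabited e0.
have [|x _ hx] := @sum_le_exists S (fun x => iter (2 * n) P (fun z => (gdist x z)%:R ^+ 2) x) ((K2 + 1) * n%:R) S0; last by exists x.
apply: (@le_trans _ _ (\sum_(x <- S) (deg x)%:R * (iter (2 * n) P (fun z => ind R S z * (gdist x z)%:R ^+ 2) x
   + (2 * n)%:R ^+ 2 * (1 - iter (2 * n) P (ind R S) x)))).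
  apply: ler_sum => x _; apply: ler_wpM2l => //.
  have -> : iter (2 * n) P (fun z => ind R S z * (gdist x z)%:R ^+ 2) x
     + (2 * n)%:R ^+ 2 * (1 - iter (2 * n) P (ind R S) x) =
     iter (2 * n) P (fun z => ind R S z * (gdist x z)%:R ^+ 2 + (2 * n)%:R ^+ 2 * (1 + -1 * ind R S z)) x.
    by rewrite iter_avgD // iter_avgZ // iter_avgD // iter_avgZ // iter_avg_const // mulN1r.
  apply: iter_avg_le_reach => // z /(gdist_le Gc) dz.
  rewrite /ind; case: (z \in S); first by rewrite mul1r mulr1 subrr mulr0 addr0.
  by rewrite mul0r add0r mulr0 addr0 mulr1 ler_sqr ?nnegrE ?ler0n // ler_nat.
under eq_bigr do rewrite mulrDr.
rewrite big_split /=; under [X in _ + X]eq_bigr do rewrite mulrCA.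
rewrite -mulr_sumr mulrDl mulrDl mul1r; apply: lerD; first exact: second_moment_inside.
have hb := exit_bound R lf deg_gt0 (2 * n)%N S.
apply: (le_trans (ler_wpM2l (sqr_ge0 _) hb)).
apply: (@le_trans _ _ ((2 * n)%:R ^+ 2 * ((2 * n)%:R * (((2 * n)%:R ^+ 2 * 2)^-1 * (mu S)%:R)))).
  apply: ler_wpM2l; first exact: sqr_ge0.
  by apply: ler_wpM2l.
rewrite le_eqVlt; apply/orP; left; apply/eqP; rewrite natrM; field.
by rewrite gt_eqF.
Qed.

(** An odd time is one step after an even one, which changes the distance by at most 1. *)
Lemma diffusive_iter : exists2 c : R, 0 < c & forall t, exists x,
  iter t P (fun z => (gdist x z)%:R ^+ 2) x <= c * t%:R.
Proof.
have K20 : 0 <= K2.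
  apply: mulr_ge0; first exact: sqr_ge0.
  by apply: addr_ge0 => //; apply: mulr_ge0 => //; exact: K_ge0.
exists (2 * (K2 + 1) + 2); first lra.
move=> t; have [x0 _] := inhabited.
have -> : t = (odd t + 2 * t./2)%N by rewrite mul2n odd_double_half.
case: (odd t); move: (t./2) => n; rewrite ?add0n ?add1n.
  have sq x z : P (fun y => (gdist x y)%:R ^+ 2) z <= 2 * (gdist x z)%:R ^+ 2 + 2.
    rewrite -[leRHS](avg_const deg_gt0 _ z); apply: avg_le => // y zy.
    have : (gdist x y)%:R <= (gdist x z)%:R + 1 :> R.
      rewrite natr1 ler_nat; have := gdist_tri Gc x z y; have := gdist_adj Gc zy; lia.
    move: ((gdist x y)%:R : R) ((gdist x z)%:R : R) (ler0n R (gdist x y)) => a b a0 ab.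
    have : a ^+ 2 <= (b + 1) ^+ 2 by rewrite lerXn2r ?nnegrE // (le_trans a0).
    have := sqr_ge0 (b - 1); lra.
  have [->|n0] := posnP n.
    exists x0; rewrite muln0 /=; apply: le_trans (sq x0 x0) _.
    by rewrite gdistxx // expr0n mulr0 add0r; lra.
  have [x hx] := diffusive_even n0; exists x.
  rewrite iterSr; apply: (@le_trans _ _ (iter (2 * n) P (fun z => 2 * (gdist x z)%:R ^+ 2 + 2) x)).
    by apply: iter_avg_le.
  rewrite iter_avgD // iter_avgZ // iter_avg_const // -[((2 * n)%N.+1)%:R]natr1 natrM.
  have nR : 0 <= n%:R :> R by [].
  nra.
have [->|n0] := posnP n.
  by exists x0; rewrite muln0 /= gdistxx // expr0n mulr0.
have [x hx] := diffusive_even n0; exists x; rewrite natrM.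
have nR : 0 <= n%:R :> R by [].
nra.
Qed.

End Diffusive.

(** * Cheeger's inequality *)

Section Cheeger.
Variables (R : realType) (G : sgraph).
Hypothesis lf : forall x : G, finite_set (neighbors x).
Hypothesis deg_gt0 : forall x : G, (0 < deg x)%N.
Variable h : R.
Hypothesis h0 : 0 < h.
Hypothesis gap : forall S : {fset G}, h * (mu S)%:R <= (bdry S)%:R.
Implicit Types (f g u : G -> R) (x y z : G) (W S F : {fset G}).
Local Notation P := (@avg R G).

Definition supported F g := forall x, x \notin F -> g x = 0.

Definition pos_part (a : R) : R := Num.max a 0.

Lemma fset_argmin (u : G -> R) S : S != fset0 -> exists2 x, x \in S & forall y, y \in S -> u x <= u y.
Proof.
suff H (s : seq G) x0 : x0 \in s -> exists2 x, x \in s & forall y, y \in s -> u x <= u y.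
  by move=> /fset0Pn[x0 x0S]; exact: (H (enum_fset S) x0).
elim: s x0 => [//|x s IH] x0 _.
case: s IH => [_|y s IH]; first by exists x; rewrite ?inE // => z; rewrite inE => /eqP->.
have [z zs zmin] := IH y (mem_head _ _).
have [le|lt] := leP (u x) (u z).
  exists x; first exact: mem_head.
  by move=> w; rewrite in_cons => /orP[/eqP->//|/zmin]; exact: le_trans.
exists z; first by rewrite in_cons zs orbT.
move=> w; rewrite in_cons => /orP[/eqP->|/zmin//]; exact: ltW.
Qed.

(** Induction on the support: subtracting the least positive value [m] from [u] on its support
    [S] lowers the sum of gradients by [m] times the boundary of [S], and the left-hand sum by
    [m * mu S]. *)
Lemma coarea F u : (forall x, 0 <= u x) -> supported F u ->
  h * \sum_(x <- F) (deg x)%:R * u x <= \sum_(x <- F) \sum_(y <- nbr x) pos_part (u x - u y).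
Proof.
move: {2}(#|` [fset x in F | (0 < u x)%R]%fset|) (leqnn #|` [fset x in F | (0 < u x)%R]%fset|) => n.
elim: n u => [|n IH] u.
  rewrite leqn0 cardfs_eq0 => /eqP e u0 su.
  rewrite big1_seq => [|x /andP[_ xF]]; last first.
    have : x \notin [fset x in F | (0 < u x)%R]%fset by rewrite e.
    rewrite !inE xF /= -leNgt => ux; have -> : u x = 0 by apply: le_anti; rewrite ux u0.
    by rewrite mulr0.
  rewrite mulr0; apply: sumr_ge0 => x _; apply: sumr_ge0 => y _.
  by rewrite /pos_part le_max lexx orbT.
set S := [fset x in F | (0 < u x)%R]%fset => cS u0 su.
have [S0|Sn0] := eqVneq S fset0.
  by apply: IH => //; rewrite -/S S0 cardfs0.
have [x0 x0S min] := fset_argmin u Sn0.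
have inS x : (x \in S) = (0 < u x).
  rewrite !inE /=; apply/andP/idP => [[]//|ux]; split => //.
  by apply/negPn/negP => /su ux0; rewrite ux0 ltxx in ux.
have nS x : x \notin S -> u x = 0 by rewrite inS -leNgt => ux; apply: le_anti; rewrite ux u0.
pose m := u x0.
have m0 : 0 < m by rewrite -inS.
pose u' x := u x - m * ind R S x.
have u'S x : x \in S -> u' x = u x - m by move=> xS; rewrite /u' /ind xS mulr1.
have u'N x : x \notin S -> u' x = 0 by move=> xS; rewrite /u' /ind (negbTE xS) mulr0 subr0 nS.
have u'0 x : 0 <= u' x.
  by have [xS|xS] := boolP (x \in S); [rewrite u'S // subr_ge0 min|rewrite u'N].
have su' : supported F u'.
  by move=> x xF; rewrite u'N // !inE (negbTE xF).
have := IH u' _ u'0 su'; have -> : (#|` [fset x in F | (0 < u' x)%R]%fset| <= n)%N.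
  rewrite -ltnS; apply: leq_trans cS; apply: fproper_ltn_card.
  rewrite fproperE; apply/andP; split.
    apply/fsubsetP => x; rewrite !inE /= => /andP[xF u'x]; rewrite xF /=.
    have [xS|xS] := boolP (x \in S); first by rewrite -inS.
    by rewrite u'N ?ltxx in u'x.
  apply/negP => /fsubsetP/(_ x0 x0S); rewrite !inE /= u'S // subrr ltxx andbF //.
move=> /(_ isT) H.
have muS : \sum_(x <- F) (deg x)%:R * u x = \sum_(x <- F) (deg x)%:R * u' x + m * (mu S)%:R.
  have -> : (mu S)%:R = \sum_(x <- F) (deg x)%:R * ind R S x.
    rewrite /mu natr_sum; have SF : (S `<=` F)%fset by apply/fsubsetP => x; rewrite !inE => /andP[].
    rewrite -(big_fset_incl _ SF) /= => [|x _ xS]; last by rewrite /ind (negbTE xS) mulr0.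
    by apply: eq_big_seq => x xS; rewrite /ind xS mulr1.
  rewrite mulr_sumr -big_split /=; apply: eq_bigr => x _; rewrite /u'; ring.
have bS : \sum_(x <- F) \sum_(y <- nbr x) pos_part (u x - u y) =
   \sum_(x <- F) \sum_(y <- nbr x) pos_part (u' x - u' y) + m * (bdry S)%:R.
  rewrite /bdry natr_sum.
  have -> : \sum_(x <- S) (\sum_(y <- nbr x) (y \notin S))%:R =
      \sum_(x <- F) \sum_(y <- nbr x) (x \in S)%:R * (y \notin S)%:R :> R.
    have SF : (S `<=` F)%fset by apply/fsubsetP => x; rewrite !inE => /andP[].
    rewrite -(big_fset_incl _ SF) /= => [|x _ xS]; last first.
      by rewrite big1 // => y _; rewrite (negbTE xS) mul0r.
    by apply: eq_big_seq => x xS; rewrite natr_sum; apply: eq_bigr => y _; rewrite xS mul1r.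
  rewrite mulr_sumr -big_split /=; apply: eq_bigr => x _.
  rewrite mulr_sumr -big_split /=; apply: eq_bigr => y _.
  rewrite /pos_part /u' /ind; have [xS|xS] := boolP (x \in S); have [yS|yS] := boolP (y \in S) => /=.
  - by rewrite ?(mulr1, mulr0, mul1r, mul0r, addr0); congr Num.max; ring.
  - rewrite (nS y) // ?(mulr1, mulr0, mul1r, mul0r, subr0, addr0).
    have xm : m <= u x by exact: min.
    by rewrite !max_l //; lra.
  - have := u'0 y; rewrite u'S // (nS x) // ?(mulr1, mulr0, mul1r, mul0r, subr0, addr0) => uy.
    by rewrite !max_r //; have := u0 y; lra.
  - by rewrite ?(mulr1, mulr0, mul1r, mul0r, subr0, addr0).
rewrite muS bS mulrDr; apply: lerD; first exact: H.
rewrite mulrCA; apply: ler_wpM2l; [exact: ltW|exact: gap].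
Qed.

(** Each edge counts twice, once for each orientation. *)
Definition pairsum W (k : G -> G -> R) : R :=
  \sum_(x <- W) \sum_(y <- W) (adj x y)%:R * k x y.

Lemma pairsum_nbr W F k : (F `<=` W)%fset -> (nbhd F `<=` W)%fset ->
  (forall x y, x \notin F -> k x y = 0) ->
  pairsum W k = \sum_(x <- F) \sum_(y <- nbr x) k x y.
Proof.
move=> FW NW k0; rewrite /pairsum -(big_fset_incl _ FW) /=; last first.
  by move=> x _ xF; rewrite big1 // => y _; rewrite k0 // mulr0.
apply: eq_big_seq => x xF.
have nW : (nbr x `<=` W)%fset.
  apply/fsubsetP => y; rewrite in_nbr // => xy; apply: (fsubsetP NW).
  by apply/nbhdP => //; exists x.
rewrite -(big_fset_incl _ nW) /=; last first.
  by move=> y _; rewrite in_nbr // => /negbTE->; rewrite mul0r.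
by apply: eq_big_seq => y; rewrite in_nbr // => ->; rewrite mul1r.
Qed.

Lemma pairsum_le W k l : (forall x y, k x y <= l x y) -> pairsum W k <= pairsum W l.
Proof.
by move=> kl; apply: ler_sum => x _; apply: ler_sum => y _; rewrite ler_wpM2l.
Qed.

Lemma pairsum_swap W k : pairsum W k = pairsum W (fun x y => k y x).
Proof.
rewrite /pairsum exchange_big /=; apply: eq_bigr => x _; apply: eq_bigr => y _.
by rewrite adj_sym.
Qed.

Lemma pairsumD W k l : pairsum W (fun x y => k x y + l x y) = pairsum W k + pairsum W l.
Proof.
rewrite /pairsum -big_split /=; apply: eq_bigr => x _; rewrite -big_split /=.
by apply: eq_bigr => y _; rewrite mulrDr.
Qed.

Lemma pairsumZ W c k : pairsum W (fun x y => c * k x y) = c * pairsum W k.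
Proof.
rewrite /pairsum mulr_sumr; apply: eq_bigr => x _; rewrite mulr_sumr.
by apply: eq_bigr => y _; rewrite mulrCA.
Qed.

Lemma eq_pairsum W k l : (forall x y, k x y = l x y) -> pairsum W k = pairsum W l.
Proof. by move=> kl; apply: le_anti; rewrite !pairsum_le // => x y; rewrite kl. Qed.

Lemma pairsum_CS W (k l m : G -> G -> R) : (forall x y, 0 <= l x y) -> (forall x y, 0 <= m x y) ->
  (forall x y, k x y ^+ 2 <= l x y * m x y) ->
  pairsum W k ^+ 2 <= pairsum W l * pairsum W m.
Proof.
move=> l0 m0 klm; rewrite /pairsum; apply: sum_sqr_le => x.
- by apply: sumr_ge0 => y _; rewrite mulr_ge0.
- by apply: sumr_ge0 => y _; rewrite mulr_ge0.
apply: sum_sqr_le => y; rewrite ?mulr_ge0 //.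
by rewrite exprMn [leRHS]mulrACA -[X in _ <= X * _]expr2; apply: ler_wpM2l; rewrite ?sqr_ge0.
Qed.

Definition qform W f g : R := pairsum W (fun x y => f x * g y).

Lemma qform_avg W F f g : (F `<=` W)%fset -> (nbhd F `<=` W)%fset -> supported F f ->
  qform W f g = \sum_(x <- F) (deg x)%:R * (f x * P g x).
Proof.
move=> FW NW sf; rewrite /qform (pairsum_nbr FW NW); last by move=> x y /sf->; rewrite mul0r.
apply: eq_bigr => x _; rewrite -mulr_sumr /avg [RHS]mulrCA; congr (_ * _).
by rewrite mulrA divff ?mul1r //; exact: degR_neq0.
Qed.

Lemma pairsum_sqr W F f : (F `<=` W)%fset -> (nbhd F `<=` W)%fset -> supported F f ->
  pairsum W (fun x y => f x ^+ 2) = sqnorm F f.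
Proof.
move=> FW NW sf; rewrite (pairsum_nbr FW NW); last by move=> x y /sf->; rewrite expr0n.
apply: eq_bigr => x _; rewrite big_const_seq count_predT iter_addr_0.
by rewrite -[f x ^+ 2 *+ _]mulr_natl.
Qed.

(** With [u = g^2], the gradient of [u] along an edge is the product of [g x - g y] and
    [g x + g y].  Cauchy-Schwarz bounds the co-area sum by the product of the two Dirichlet
    sums, that is by [n - q] times [n + q] for [n] the squared norm and [q] the
    quadratic form. *)
Lemma cheeger W F g : (F `<=` W)%fset -> (nbhd F `<=` W)%fset -> supported F g ->
  qform W g g ^+ 2 <= (1 - h ^+ 2) * sqnorm F g ^+ 2.
Proof.
move=> FW NW sg.
(* [D] selects one orientation of each edge along which [g^2] varies *)
pose D x y : R := (g y ^+ 2 < g x ^+ 2)%R%:R.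
pose T := pairsum W (fun x y => D x y * (g x ^+ 2 - g y ^+ 2)).
have hT : h * sqnorm F g <= T.
  apply: (le_trans (coarea (u := fun x => g x ^+ 2) (F := F) _ _)).
  - by move=> x; exact: sqr_ge0.
  - by move=> x /sg->; rewrite expr0n.
  rewrite /T (pairsum_nbr FW NW); last first.
    move=> x y xF; rewrite /D (sg _ xF) expr0n /= ltNge sqr_ge0 /= mul0r //.
  apply: ler_sum => x _; apply: ler_sum => y _; rewrite /pos_part /D.
  have [lt|ge] := ltP (g y ^+ 2) (g x ^+ 2); first by rewrite mul1r max_l // subr_ge0 ltW.
  by rewrite mul0r max_r // subr_le0.
have n0 : 0 <= sqnorm F g by apply: sumr_ge0 => x _; rewrite mulr_ge0 ?sqr_ge0.
have T2 : T ^+ 2 <= pairsum W (fun x y => D x y * (g x - g y) ^+ 2) *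
                   pairsum W (fun x y => D x y * (g x + g y) ^+ 2).
  apply: pairsum_CS => x y.
  - by apply: mulr_ge0; [exact: ler0n|exact: sqr_ge0].
  - by apply: mulr_ge0; [exact: ler0n|exact: sqr_ge0].
  by rewrite le_eqVlt; apply/orP; left; apply/eqP; move: (D x y) => c; ring.
have sym (k : G -> G -> R) : (forall x y, k x y = k y x) -> (forall x y, 0 <= k x y) ->
    2 * pairsum W (fun x y => D x y * k x y) <= pairsum W k.
  move=> ks k0; rewrite mulr_natl mulr2n {2}pairsum_swap -pairsumD; apply: pairsum_le => x y.
  rewrite (ks y x) -mulrDl ler_piMl // /D.
  by case: (ltgtP (g x ^+ 2) (g y ^+ 2)) => _; rewrite ?addr0 ?add0r // ler01.
have E (s : R) : pairsum W (fun x y => (g x + s * g y) ^+ 2) =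
    (1 + s ^+ 2) * sqnorm F g + 2 * s * qform W g g.
  rewrite (@eq_pairsum _ (fun x y => (g x + s * g y) ^+ 2) (fun x y => (g x ^+ 2 + s ^+ 2 * g y ^+ 2) + (2 * s) * (g x * g y))).
    rewrite pairsumD pairsumD !pairsumZ -/(qform W g g) (pairsum_sqr FW NW sg).
    by rewrite [pairsum W (fun x y => g y ^+ 2)]pairsum_swap (pairsum_sqr FW NW sg); ring.
  by move=> x y; ring.
have m1 : pairsum W (fun x y => D x y * (g x - g y) ^+ 2) <= sqnorm F g - qform W g g.
  have := sym (fun x y => (g x - g y) ^+ 2) _ _; have := E (-1).
  rewrite (@eq_pairsum _ (fun x y => (g x + -1 * g y) ^+ 2) (fun x y => (g x - g y) ^+ 2)); last by move=> x y; ring.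
  move=> -> H; have {}H := H _ (fun x y => sqr_ge0 _).
  suff : 2 * pairsum W (fun x y => D x y * (g x - g y) ^+ 2) <=
    (1 + (-1) ^+ 2) * sqnorm F g + 2 * -1 * qform W g g by lra.
  by apply: H => x y; ring.
have m2 : pairsum W (fun x y => D x y * (g x + g y) ^+ 2) <= sqnorm F g + qform W g g.
  have := sym (fun x y => (g x + g y) ^+ 2) _ _; have := E 1.
  rewrite (@eq_pairsum _ (fun x y => (g x + 1 * g y) ^+ 2) (fun x y => (g x + g y) ^+ 2)); last by move=> x y; ring.
  move=> -> H; have {}H := H _ (fun x y => sqr_ge0 _).
  suff : 2 * pairsum W (fun x y => D x y * (g x + g y) ^+ 2) <=
    (1 + 1 ^+ 2) * sqnorm F g + 2 * 1 * qform W g g by lra.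
  by apply: H => x y; ring.
have p1 : 0 <= pairsum W (fun x y => D x y * (g x - g y) ^+ 2).
  apply: sumr_ge0 => x _; apply: sumr_ge0 => y _; apply: mulr_ge0; first exact: ler0n.
  by apply: mulr_ge0; [exact: ler0n|exact: sqr_ge0].
have p2 : 0 <= pairsum W (fun x y => D x y * (g x + g y) ^+ 2).
  apply: sumr_ge0 => x _; apply: sumr_ge0 => y _; apply: mulr_ge0; first exact: ler0n.
  by apply: mulr_ge0; [exact: ler0n|exact: sqr_ge0].
have T3 : (h * sqnorm F g) ^+ 2 <= T ^+ 2.
  have a0 : 0 <= h * sqnorm F g by apply: mulr_ge0 => //; exact: ltW.
  by apply: lerXn2r => //; rewrite nnegrE // (le_trans a0).
have T4 := ler_pM p1 p2 m1 m2.
move: T2 T3 T4; move: (qform W g g) (sqnorm F g) => q n.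
set a := _ * pairsum _ _; move=> T2 T3 T4.
have : (h * n) ^+ 2 <= (n - q) * (n + q) by apply: le_trans T3 (le_trans T2 T4).
have -> : (n - q) * (n + q) = n ^+ 2 - q ^+ 2 by ring.
rewrite exprMn mulrBl mul1r; lra.
Qed.

End Cheeger.

(** * Ballistic displacement in non-amenable graphs *)

Section Ballistic.
Variables (R : realType) (G : sgraph).
Hypothesis lf : forall x : G, finite_set (neighbors x).
Hypothesis deg_gt0 : forall x : G, (0 < deg x)%N.
Variable h : R.
Hypothesis h0 : 0 < h.
Hypothesis h2 : h <= 2^-1.
Hypothesis gap : forall S : {fset G}, h * (mu S)%:R <= (bdry S)%:R.
Implicit Types (f g u : G -> R) (x y z : G) (W S F : {fset G}).
Local Notation P := (@avg R G).

Let rho : R := Num.sqrt (1 - h ^+ 2).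

Lemma h_sqr : 0 < h ^+ 2 < 1.
Proof.
by rewrite exprn_gt0 //= exprn_ilt1 //; [exact: ltW|apply: le_lt_trans h2 _; rewrite invf_lt1 ?ltr1n].
Qed.

Lemma rho_sqr : rho ^+ 2 = 1 - h ^+ 2.
Proof. by have /andP[a b] := h_sqr; rewrite sqr_sqrtr // subr_ge0 ltW. Qed.

Lemma rho_gt0 : 0 < rho.
Proof. by have /andP[a b] := h_sqr; rewrite sqrtr_gt0 subr_gt0. Qed.

Lemma rho_lt1 : rho < 1.
Proof.
have /andP[a _] := h_sqr; have r0 := rho_gt0.
rewrite ltNge; apply/negP => r1; have : 1 <= rho ^+ 2 by rewrite exprn_ege1.
by rewrite rho_sqr; lra.
Qed.

Lemma sqnorm_ge0 W g : 0 <= sqnorm W g.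
Proof. by apply: sumr_ge0 => x _; rewrite mulr_ge0 ?sqr_ge0. Qed.

Lemma qform_bound W F g : (F `<=` W)%fset -> (nbhd F `<=` W)%fset -> supported F g ->
  - (rho * sqnorm F g) <= qform W g g <= rho * sqnorm F g.
Proof.
move=> FW NW sg; rewrite -ler_norml -[leRHS]ger0_norm; last first.
  by rewrite mulr_ge0 ?sqnorm_ge0 // ltW // rho_gt0.
rewrite -ler_sqr ?nnegrE // !real_normK ?num_real // exprMn rho_sqr.
exact: (cheeger lf h0 gap).
Qed.

Lemma supported_avg F g : supported F g -> supported (nbhd F) (P g).
Proof.
move=> sg x xF; rewrite -(avg_const deg_gt0 0 x); apply: eq_avg => // y xy.
apply: sg; apply/negP => yF; move/negP: xF; apply; apply/nbhdP => //.
by exists y => //; rewrite adj_sym.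
Qed.

Lemma supported_sub F F' g : (F `<=` F')%fset -> supported F g -> supported F' g.
Proof. by move=> /fsubsetP FF' sg x xF'; apply: sg; apply: contra xF'; exact: FF'. Qed.

Lemma sqnorm_supported F F' g : (F `<=` F')%fset -> supported F g -> sqnorm F' g = sqnorm F g.
Proof.
move=> FF' sg; rewrite /sqnorm -(big_fset_incl _ FF') //= => x _ /sg->.
by rewrite expr0n mulr0.
Qed.

(** A symmetric operator whose quadratic form is at most [rho] times the squared norm has
    norm at most [rho]: polarise with [f = rho^-1 * avg g]. *)
Lemma sqnorm_avg F g : supported F g -> sqnorm (nbhd F) (P g) <= rho ^+ 2 * sqnorm F g.
Proof.
move=> sg; pose F1 := (F `|` nbhd F)%fset; pose W := (F1 `|` nbhd F1)%fset.
have FF1 : (F `<=` F1)%fset by apply: fsubsetUl.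
have NF1 : (nbhd F `<=` F1)%fset by apply: fsubsetUr.
have F1W : (F1 `<=` W)%fset by apply: fsubsetUl.
have N1W : (nbhd F1 `<=` W)%fset by apply: fsubsetUr.
have sg1 := supported_sub FF1 sg.
have sP1 := supported_sub NF1 (supported_avg sg).
rewrite -(sqnorm_supported NF1 (supported_avg sg)) -(sqnorm_supported FF1 sg).
have r0 := rho_gt0; set c := rho^-1.
have c0 : 0 < c by rewrite invr_gt0.
pose f x := c * P g x.
pose a x := f x + g x; pose b x := f x - g x.
have sa : supported F1 a by move=> x xF; rewrite /a /f sP1 // sg1 // mulr0 addr0.
have sb : supported F1 b by move=> x xF; rewrite /b /f sP1 // sg1 // mulr0 subr0.
have /andP[_ qa] := qform_bound F1W N1W sa.
have /andP[qb _] := qform_bound F1W N1W sb.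
have nn : sqnorm F1 a + sqnorm F1 b = 2 * (c ^+ 2 * sqnorm F1 (P g) + sqnorm F1 g).
  rewrite /sqnorm mulr_sumr -!big_split mulr_sumr /=; apply: eq_bigr => x _.
  by rewrite /a /b /f; ring.
have qq : qform W a a - qform W b b = 4 * c * sqnorm F1 (P g).
  have -> : qform W a a = pairsum W (fun x y => f x * f y + g x * g y) + (qform W f g + qform W g f).
    rewrite /qform -!pairsumD; apply: eq_pairsum => x y; rewrite /a; ring.
  have -> : qform W b b = pairsum W (fun x y => f x * f y + g x * g y) - (qform W f g + qform W g f).
    rewrite -mulN1r /qform -!pairsumD -pairsumZ -pairsumD; apply: eq_pairsum => x y; rewrite /b; ring.
  have -> : qform W g f = qform W f g.
    by rewrite /qform pairsum_swap; apply: eq_pairsum => x y; rewrite mulrC.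
  have sf : supported F1 f by move=> x xF; rewrite /f sP1 // mulr0.
  rewrite (qform_avg lf deg_gt0 _ F1W N1W sf).
  have -> : \sum_(x <- F1) (deg x)%:R * (f x * P g x) = c * sqnorm F1 (P g).
    by rewrite /sqnorm mulr_sumr; apply: eq_bigr => x _; rewrite /f; ring.
  ring.
have key : 4 * c * sqnorm F1 (P g) <= rho * (2 * (c ^+ 2 * sqnorm F1 (P g) + sqnorm F1 g)).
  by rewrite -qq -nn mulrDr; lra.
have e1 : rho * (2 * (c ^+ 2 * sqnorm F1 (P g) + sqnorm F1 g)) = 2 * c * sqnorm F1 (P g) + 2 * rho * sqnorm F1 g.
  by rewrite /c; field; rewrite gt_eqF.
rewrite e1 in key.
have : 2 * c * sqnorm F1 (P g) <= 2 * rho * sqnorm F1 g by lra.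
move: (sqnorm F1 (P g)) (sqnorm F1 g) => p q le.
have : rho * (2 * c * p) <= rho * (2 * rho * q) by rewrite ler_pM2l.
have -> : rho * (2 * c * p) = 2 * p by rewrite /c; field; rewrite gt_eqF.
rewrite expr2; lra.
Qed.

Lemma sqnorm_iter_avg n F g : supported F g ->
  supported (iter n (@nbhd G) F) (iter n P g) /\
  sqnorm (iter n (@nbhd G) F) (iter n P g) <= rho ^+ (2 * n) * sqnorm F g.
Proof.
move=> sg; elim: n => [|n [s IH]]; first by rewrite muln0 expr0 mul1r.
split; first by rewrite !iterS; apply: supported_avg.
rewrite !iterS; apply: le_trans (sqnorm_avg s) _.
rewrite mulnS exprD -mulrA ler_wpM2l // sqr_ge0 //.
Qed.

(** The value at [v] is one term of the squared norm. *)
Lemma hit_bound n F v :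
  (deg v)%:R * iter n P (ind R F) v ^+ 2 <= rho ^+ (2 * n) * (mu F)%:R.
Proof.
have sF : supported F (ind R F) by move=> x xF; rewrite /ind (negbTE xF).
have [s hn] := sqnorm_iter_avg n sF.
have m0 : sqnorm F (ind R F) <= (mu F)%:R by apply: mu_ind_le.
have r0 := rho_gt0.
have rp : 0 <= rho ^+ (2 * n) by rewrite exprn_ge0 // ltW.
apply: (@le_trans _ _ (rho ^+ (2 * n) * sqnorm F (ind R F))); last exact: ler_wpM2l.
apply: le_trans hn.
have [vW|vW] := boolP (v \in iter n (@nbhd G) F); last first.
  by rewrite s // expr0n mulr0 sqnorm_ge0.
rewrite /sqnorm (big_fsetD1 v vW) /= lerDl; apply: sumr_ge0 => x _.
by rewrite mulr_ge0 // sqr_ge0.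
Qed.

Section Degree.
Variable D : nat.
Hypothesis deg_le : forall x : G, (deg x <= D)%N.

Definition fball v k : {fset G} := iter k (fun W => W `|` nbhd W)%fset [fset v]%fset.

Lemma fball_walk v k n x : (n <= k)%N -> walk_in setT n v x -> x \in fball v k.
Proof.
elim: k n x => [|k IH] n x; first by rewrite leqn0 => /eqP-> [_ <-]; rewrite inE.
rewrite /fball iterS -/(fball v k) inE => nk.
case: n nk => [_ [_ <-]|n nk [z [vz zx _]]].
  by rewrite (IH 0%N).
apply/orP; right; apply/nbhdP => //; exists z => //; exact: IH vz.
Qed.

Lemma card_nbhd W : (#|` nbhd W| <= D * #|` W|)%N.
Proof.
rewrite /nbhd -[#|` W|]/(size W); elim: (enum_fset W) => [|x s IH].
  by rewrite big_nil cardfs0.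
rewrite big_cons cardfsU; apply: leq_trans (leq_subr _ _) _.
by rewrite /= mulnS leq_add // deg_le.
Qed.

Lemma card_fball v k : (#|` fball v k| <= D.+1 ^ k)%N.
Proof.
elim: k => [|k IH]; first by rewrite /= cardfs1.
rewrite /fball iterS -/(fball v k) cardfsU; apply: leq_trans (leq_subr _ _) _.
apply: (@leq_trans (D.+1 * #|` fball v k|)%N); first by rewrite mulSn leq_add2l card_nbhd.
by rewrite expnS leq_mul2l IH orbT.
Qed.

Lemma mu_fball v k : (mu (fball v k) <= D * D.+1 ^ k)%N.
Proof.
apply: leq_trans (leq_mul (leqnn D) (card_fball v k)).
rewrite /mu -[#|` fball v k|]/(size (fball v k)) -sum1_size big_distrr /=.
by apply: leq_sum => x _; rewrite muln1 deg_le.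
Qed.

(** Decay at rate [rho] over [M] steps beats the growth of balls when the radius grows
    by one. *)
Lemma ball_growth_rate : exists2 M : nat, (0 < M)%N & rho ^+ M * D.+1%:R <= 1.
Proof.
have r0 := rho_gt0; have r1 := rho_lt1.
have /cvgrPdist_lt/(_ (D.+1%:R^-1)) : rho ^+ n @[n --> \oo] --> (0 : R).
  by apply: cvg_expr; rewrite ger0_norm // ltW.
rewrite invr_gt0 ltr0n => /(_ isT)[N _ /(_ N.+1 (leqnSn N))].
rewrite sub0r normrN ger0_norm; last by rewrite exprn_ge0 // ltW.
move=> lt; exists N.+1 => //.
by rewrite -ler_pdivlMr ?ltr0n // mul1r ltW.
Qed.

Lemma decay_time (e : R) : 0 < e -> exists T : nat, forall t, (T <= t)%N -> rho ^+ t <= e.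
Proof.
have r0 := rho_gt0; have r1 := rho_lt1 => e0.
have /cvgrPdist_lt/(_ e e0)[T _ H] : rho ^+ n @[n --> \oo] --> (0 : R).
  by apply: cvg_expr; rewrite ger0_norm // ltW.
exists T => t /H; rewrite sub0r normrN ger0_norm; last by rewrite exprn_ge0 // ltW.
exact: ltW.
Qed.

Hypothesis Gc : connected_graph G.

(** Markov's inequality: outside the ball of radius [k] the distance is at least [k + 1]. *)
Lemma escape_sqr v t k : (k.+1%:R : R) ^+ 2 * (1 - iter t P (ind R (fball v k)) v) <=
  iter t P (fun y => (gdist v y)%:R ^+ 2) v.
Proof.
rewrite -[X in X - _](iter_avg_const lf deg_gt0 t 1 v).
have -> : iter t P (fun=> 1) v - iter t P (ind R (fball v k)) v =
  iter t P (fun y => 1 + -1 * ind R (fball v k) y) v.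
  by rewrite iter_avgD // iter_avgZ // mulN1r.
rewrite -iter_avgZ //; apply: iter_avg_le => // y.
rewrite /ind; have [yb|yb] := boolP (y \in fball v k).
  by rewrite mulr1 subrr mulr0 sqr_ge0.
rewrite mulr0 addr0 mulr1 ler_sqr ?nnegrE ?ler0n // ler_nat ltnNge.
apply: contra yb => yk; apply: (fball_walk yk); exact: gdist_walk.
Qed.

(** For large [t], the ball of radius [t / M] is hit with probability at most 1/2.  For the
    finitely many remaining [t > 0], the probability of being away from [v] is at least
    [1 - rho]. *)
Lemma ballistic_iter : exists2 c : R, 0 < c & forall v t,
  c * t%:R ^+ 2 <= iter t P (fun y => (gdist v y)%:R ^+ 2) v.
Proof.
have r0 := rho_gt0; have r1 := rho_lt1.
have [M M0 HM] := ball_growth_rate.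
have D0 : 0 < D.+1%:R :> R by rewrite ltr0n.
have [T HT] := @decay_time ((4 * D.+1%:R)^-1) ltac:(by rewrite invr_gt0 mulr_gt0).
have M0R : 0 < M%:R :> R by rewrite ltr0n.
have T0R : 0 < T.+1%:R :> R by rewrite ltr0n.
pose c1 : R := (2 * M%:R ^+ 2)^-1.
pose c2 : R := (1 - rho) / T.+1%:R ^+ 2.
have c10 : 0 < c1 by rewrite invr_gt0 mulr_gt0 // exprn_gt0.
have c20 : 0 < c2 by rewrite divr_gt0 ?exprn_gt0 // subr_gt0.
exists (Num.min c1 c2); first by rewrite lt_min c10.
move=> v t; have t2 : 0 <= (t%:R : R) ^+ 2 by exact: sqr_ge0.
have degv : 1 <= (deg v)%:R :> R by rewrite ler1n.
have [tT|Tt] := ltnP t T.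
  have [->|tn0] := eqVneq t 0%N.
    by rewrite expr0n mulr0; apply: iter_avg_ge0 => // y; exact: sqr_ge0.
  apply: (@le_trans _ _ (c2 * t%:R ^+ 2)).
    by apply: ler_wpM2r => //; rewrite ge_min lexx orbT.
  apply: (@le_trans _ _ (1 - rho)).
    rewrite /c2 mulrAC ler_pdivrMr ?exprn_gt0 //; apply: ler_wpM2l; first by rewrite subr_ge0 ltW.
    rewrite ler_sqr ?nnegrE ?ler0n // ler_nat; exact: leqW (ltnW tT).
  apply: le_trans (escape_sqr v t 0); rewrite expr1n mul1r lerD2l lerN2.
  have := hit_bound t [fset v]%fset v; rewrite /mu big_seq_fset1.
  rewrite mulrC ler_pM2r ?ltr0n // mulnC exprM => le.
  have i0 : 0 <= iter t P (ind R [fset v]%fset) v by apply: iter_avg_ge0 => // y; rewrite /ind.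
  have rt : rho ^+ t <= rho.
    by case: (t) tn0 => // s _; rewrite exprS ler_piMr ?(ltW r0) // exprn_ile1 ?ltW.
  apply: le_trans rt.
  by rewrite -ler_sqr ?nnegrE // exprn_ge0 // ltW.
apply: (@le_trans _ _ (c1 * t%:R ^+ 2)).
  by apply: ler_wpM2r => //; rewrite ge_min lexx.
pose k := (t %/ M)%N.
apply: le_trans (escape_sqr v t k).
have tk : t%:R <= M%:R * k.+1%:R :> R.
  by rewrite -natrM ler_nat mulnC ltnW // ltn_ceil.
set q := iter t P _ v.
have q0 : 0 <= q by apply: iter_avg_ge0 => // y; rewrite /ind.
have hq : q ^+ 2 <= rho ^+ (2 * t) * (D%:R * D.+1%:R ^+ k).
  have mu_le : (mu (fball v k))%:R <= D%:R * D.+1%:R ^+ k :> R.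
    by rewrite -natrX -natrM ler_nat mu_fball.
  have := hit_bound t (fball v k) v; rewrite -/q => hb.
  apply: (@le_trans _ _ ((deg v)%:R * q ^+ 2)); first by rewrite ler_peMl // sqr_ge0.
  apply: le_trans hb _; apply: ler_wpM2l => //.
  by rewrite exprn_ge0 // ltW.
(* half of the decay is spent on the growth of the ball; the other half remains *)
have grow : rho ^+ t * D.+1%:R ^+ k <= 1.
  have -> : t = (M * k + t %% M)%N by rewrite mulnC -divn_eq.
  have z0 : 0 <= rho ^+ M * D.+1%:R by apply: mulr_ge0 => //; apply: exprn_ge0; exact: ltW.
  rewrite exprD exprM mulrAC -exprMn -[leRHS]mulr1; apply: ler_pM.
  - exact: exprn_ge0.
  - by apply: exprn_ge0; exact: ltW.
  - exact: exprn_ile1.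
  - by apply: exprn_ile1; exact: ltW.
have q14 : q ^+ 2 <= 2^-1 ^+ 2.
  apply: le_trans hq _; rewrite mulnC exprM expr2.
  have := HT t Tt; rewrite -[_^-1]mul1r ler_pdivlMr ?mulr_gt0 // => hT.
  have rt0 : 0 <= rho ^+ t by rewrite exprn_ge0 // ltW.
  have DD : D%:R <= D.+1%:R :> R by rewrite ler_nat.
  have d0 : 0 <= D%:R :> R by [].
  have x1 : rho ^+ t * D%:R <= 4^-1.
    apply: (@le_trans _ _ (rho ^+ t * D.+1%:R)); first exact: ler_wpM2l.
    lra.
  rewrite [leLHS](_ : _ = (rho ^+ t * D%:R) * (rho ^+ t * D.+1%:R ^+ k)); last by ring.
  have -> : (2^-1 ^+ 2 : R) = 4^-1 * 1 by field.
  by apply: ler_pM => //; rewrite mulr_ge0 // exprn_ge0 // ltW.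
have q12 : q <= 2^-1 by rewrite -ler_sqr ?nnegrE // invr_ge0.
have tk2 : t%:R ^+ 2 <= (M%:R * k.+1%:R) ^+ 2 :> R.
  by rewrite ler_sqr ?nnegrE // ?mulr_ge0.
apply: (@le_trans _ _ (c1 * (M%:R * k.+1%:R) ^+ 2)); first by apply: ler_wpM2l => //; exact: ltW.
have -> : c1 * (M%:R * k.+1%:R) ^+ 2 = k.+1%:R ^+ 2 * 2^-1 :> R.
  by rewrite /c1; field; rewrite gt_eqF.
by apply: ler_wpM2l; [exact: sqr_ge0|lra].
Qed.

End Degree.
End Ballistic.

(** * The law of the walk *)

Section Countable.
Variable G : sgraph.
Hypothesis lf : forall x : G, finite_set (neighbors x).
Hypothesis Gc : connected_graph G.

Lemma iter_nbhd_walk n (v x : G) : walk_in setT n v x -> x \in iter n (@nbhd G) [fset v]%fset.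
Proof.
elim: n x => [x [_ <-]|n IH x [y [/IH hy yx _]]]; first by rewrite inE.
by rewrite iterS; apply/nbhdP => //; exists y.
Qed.

Lemma countable_vertices : countable [set: G].
Proof.
have [[v _]|/set0P/negP/negPn/eqP->//] := pselect ([set: G] !=set0).
have -> : [set: G] = \bigcup_(n in setT) [set` iter n (@nbhd G) [fset v]%fset].
  apply/seteqP; split => // x _.
  have [n hn] := connected_inT Gc (I : setT v) (I : setT x).
  by exists n => //=; exact: iter_nbhd_walk.
apply: bigcup_countable => // n _; apply: finite_set_countable; exact: finite_fset.
Qed.

End Countable.

Section Law.
Variables (R : realType) (G : sgraph).
Hypothesis lf : forall x : G, finite_set (neighbors x).
Hypothesis deg_gt0 : forall x : G, (0 < deg x)%N.
Hypothesis Gc : connected_graph G.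
Variables (d : measure_display) (Omega : measurableType d)
    (P : G -> probability Omega R) (X : nat -> Omega -> G).
Hypothesis srw : is_srw P X.
Variable v : G.
Local Open Scope ereal_scope.

(** Only the preimages of points are assumed measurable, whence the countability of [U]. *)
Lemma discrete_measurable (U : Type) (Z : Omega -> U) (h : U -> \bar R) (D : set Omega) :
  countable [set: U] -> (forall u, measurable (Z @^-1` [set u])) ->
  measurable_fun D (fun w => h (Z w)).
Proof.
move=> cU mZ mD B mB; apply: measurableI => //.
pose F u := if pselect (B (h u)) then Z @^-1` [set u] else set0.
have -> : (fun w => h (Z w)) @^-1` B = \bigcup_u F u.
  apply/seteqP; split => [w /= Bw|w [u _]]; rewrite /F /=.
    by exists (Z w) => //; rewrite /F; case: pselect.
  by case: pselect => // Bu /= ->.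
apply: countable_bigcupT_measurable => // u; rewrite /F; case: pselect => ?; [exact: mZ|exact: measurable0].
Qed.

Lemma integral_split_values (A : set Omega) (f : Omega -> \bar R) (Z : Omega -> G) (s : seq G) :
  measurable A -> (forall z, measurable (Z @^-1` [set z])) -> uniq s ->
  measurable_fun setT f -> (forall w, 0 <= f w) ->
  \int[P v]_(w in A `&` [set w | Z w \in s]) f w = \sum_(z <- s) \int[P v]_(w in A `&` Z @^-1` [set z]) f w.
Proof.
move=> mA mZ + mf f0.
have ms (r : seq G) : measurable [set w | Z w \in r].
  elim: r => [|z r IH]; first by rewrite (_ : [set _ | _] = set0) //; apply/seteqP; split.
  rewrite (_ : [set _ | _] = Z @^-1` [set z] `|` [set w | Z w \in r]); first exact: measurableU.
  apply/seteqP; split => w /=; rewrite in_cons.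
    by move=> /orP[/eqP->|]; [left|right].
  by move=> [->|->]; rewrite ?eqxx ?orbT.
elim: s => [_|z s IH /= /andP[zs us]].
  rewrite big_nil (_ : _ `&` _ = set0) ?integral_set0 //.
  by apply/seteqP; split => // w [].
rewrite big_cons -IH //.
rewrite -ge0_integral_setU //.
- congr (integral _ _ _); apply/seteqP; split => w /=; rewrite in_cons.
    by move=> [Aw /orP[/eqP zw|zw]]; [left|right].
  by move=> [[Aw ->]|[Aw ->]]; rewrite ?eqxx ?orbT.
- by apply: measurableI.
- by apply: measurableI.
- by apply: (measurable_funS _ _ mf) => //; exact: measurableT.
- apply/disj_setPS => w [[_ /= e] [_ /=]]; rewrite e => h; by rewrite h in zs.
Qed.

Definition cyl t (x : nat -> G) := [set w | forall i, (i <= t)%N -> X i w = x i].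

Lemma cylS t x : cyl t.+1 x = cyl t x `&` X t.+1 @^-1` [set x t.+1].
Proof.
apply/seteqP; split => w /=.
  by move=> h; split => [i it|]; apply: h => //; exact: leqW.
by move=> [h e] i; rewrite leq_eqVlt => /orP[/eqP->//|]; exact: h.
Qed.

Lemma measurable_cyl t x : measurable (cyl t x).
Proof.
elim: t => [|t IH]; last by rewrite cylS; apply: measurableI => //; exact: (srw_measurable srw).
rewrite (_ : cyl 0 x = X 0%N @^-1` [set x 0%N]); first exact: (srw_measurable srw).
apply/seteqP; split => w /=; first by move=> h; exact: h.
by move=> e i; rewrite leqn0 => /eqP->.
Qed.

Lemma cyl_extend t x z : P v (cyl t x `&` X t.+1 @^-1` [set z]) =
  P v (cyl t x) * (srw_step R (x t) z)%:E.
Proof.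
pose x' i := if i == t.+1 then z else x i.
have e i : (i <= t)%N -> x' i = x i by move=> it; rewrite /x' ltn_eqF.
have cx : cyl t x' = cyl t x.
  by apply/seteqP; split => w /= h i it; rewrite h ?e.
have := srw_markov srw v t x'; rewrite -/(cyl _ _) -/(cyl _ _) cx cylS cx.
by rewrite (e t) // (_ : x' t.+1 = z) // /x' eqxx.
Qed.

Lemma step_nbr (x z : G) : z \in nbr x -> srw_step R x z = ((deg x)%:R^-1)%R.
Proof. by rewrite in_nbr // /srw_step => ->. Qed.

(** The transition probabilities to the neighbours already add up to 1. *)
Lemma cyl_leaves_null t x : P v (cyl t x `\` [set w | X t.+1 w \in nbr (x t)]) = 0.
Proof.
have mc := measurable_cyl t x.
have mX z : measurable (X t.+1 @^-1` [set z]) by exact: (srw_measurable srw).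
have := integral_split_values (f := cst 1) mc mX (fset_uniq (nbr (x t)))
  (measurable_cst _) (fun=> lee01).
have mN : measurable [set w | X t.+1 w \in nbr (x t)].
  rewrite (_ : [set _ | _] = \bigcup_(z in [set` nbr (x t)]) X t.+1 @^-1` [set z]).
    by apply: fin_bigcup_measurable => //; exact: finite_fset.
  apply/seteqP; split => w /=; first by exists (X t.+1 w).
  by move=> [z /= zn ->].
have E B : measurable B -> \int[P v]_(w in cyl t x `&` B) cst 1 w = P v (cyl t x `&` B).
  by move=> mB; rewrite integral_cst ?mul1e //; exact: measurableI.
rewrite E //; under eq_bigr => z _ do rewrite E //.
move=> e.
have fin : P v (cyl t x) \is a fin_num by exact: fin_num_measure.
have es : P v (cyl t x `&` [set w | X t.+1 w \in nbr (x t)]) = P v (cyl t x).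
  rewrite e (eq_big_seq (fun=> P v (cyl t x) * (((deg (x t))%:R^-1)%R)%:E)); last first.
    by move=> z zn; rewrite -(step_nbr zn); exact: cyl_extend.
  rewrite -(fineK fin); under eq_bigr do rewrite -EFinM.
  rewrite sumEFin big_const_seq count_predT iter_addr_0.
  rewrite -[((_ * _) *+ _)%R]mulr_natr -mulrA mulVf ?mulr1 //.
  by rewrite pnatr_eq0 -lt0n.
rewrite measureD //; last by rewrite ltey_eq fin.
by transitivity (P v (cyl t x) - P v (cyl t x)); [congr (_ - _); exact: es|rewrite subee].
Qed.

(** The Markov property, by induction on the number of remaining steps. *)
Lemma integral_cyl n t x (h : G -> R) : (forall y, (0 <= h y)%R) ->
  \int[P v]_(w in cyl t x) (h (X (t + n)%N w))%:E =
  P v (cyl t x) * (iter n (@avg R G) h (x t))%:E.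
Proof.
move=> h0; elim: n t x => [|n IH] t x.
  rewrite addn0 (eq_integral (cst (h (x t))%:E)); last first.
    by move=> w; rewrite inE /= => -> .
  rewrite integral_cst; last exact: measurable_cyl.
  by rewrite muleC.
have mc := measurable_cyl t x.
have mX s z : measurable (X s @^-1` [set z]) by exact: (srw_measurable srw).
have mN : measurable [set w | X t.+1 w \in nbr (x t)].
  rewrite (_ : [set _ | _] = \bigcup_(z in [set` nbr (x t)]) X t.+1 @^-1` [set z]).
    by apply: fin_bigcup_measurable => //; exact: finite_fset.
  apply/seteqP; split => w /=; first by exists (X t.+1 w).
  by move=> [z /= zn ->].
have mf D : measurable_fun D (fun w => (h (X (t + n.+1)%N w))%:E).
  by apply: (@discrete_measurable G (X (t + n.+1)%N) (EFin \o h)) => //; exact: countable_vertices.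
rewrite (@ge0_negligible_integral _ _ _ _ _ (cyl t x `\` [set w | X t.+1 w \in nbr (x t)])) //; last 3 first.
- exact: measurableD.
- by move=> w _; rewrite lee_fin.
- exact: cyl_leaves_null.
have f0 w : 0 <= (h (X (t + n.+1)%N w))%:E by rewrite lee_fin.
rewrite setDD (integral_split_values mc (mX t.+1) (fset_uniq (nbr (x t))) (mf setT) f0).
have fin : P v (cyl t x) \is a fin_num by exact: fin_num_measure.
rewrite (eq_big_seq (fun z => P v (cyl t x) * (((deg (x t))%:R^-1)%R * iter n (@avg R G) h z)%R%:E)).
  rewrite -(fineK fin); under eq_bigr do rewrite -EFinM.
  by rewrite sumEFin -mulr_sumr -mulr_sumr.
move=> z zn.
pose x' i := if i == t.+1 then z else x i.
have e i : (i <= t)%N -> x' i = x i by move=> it; rewrite /x' ltn_eqF.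
have cx : cyl t x `&` X t.+1 @^-1` [set z] = cyl t.+1 x'.
  rewrite cylS /x' eqxx; congr (_ `&` _).
  by apply/seteqP; split => w /= hh i it; rewrite hh ?e // -/(x' i) e.
rewrite cx addnS -addSn IH -cx cyl_extend step_nbr // (_ : x' t.+1 = z) ?/x' ?eqxx //.
by rewrite -muleA -EFinM.
Qed.

Lemma mean_sq_displacementE t : mean_sq_displacement P X v t =
  (iter t (@avg R G) (fun y => (gdist v y)%:R ^+ 2)%R v)%:E.
Proof.
rewrite /mean_sq_displacement unlock.
have mX s z : measurable (X s @^-1` [set z]) by exact: (srw_measurable srw).
have cG := countable_vertices lf Gc.
have mf D : measurable_fun D (fun w => ((gdist (X 0%N w) (X t w))%:R ^+ 2 : R)%R%:E).
  refine (@discrete_measurable (G * G)%type (fun w => (X 0%N w, X t w))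
    (fun p => ((gdist p.1 p.2)%:R ^+ 2)%R%:E) D _ _).
    by rewrite -setXTT; apply: countableX.
  move=> [a b]; rewrite (_ : _ @^-1` _ = X 0%N @^-1` [set a] `&` X t @^-1` [set b]).
    exact: measurableI.
  by apply/seteqP; split => w /= => [[<- <-]//|[-> ->]].
have s0 := srw_start srw v.
have n0 : P v (~` (X 0%N @^-1` [set v])) = 0.
  by rewrite probability_setC // s0 subee.
have f0 w : setT w -> 0 <= ((gdist (X 0%N w) (X t w))%:R ^+ 2 : R)%R%:E.
  by move=> _; rewrite lee_fin sqr_ge0.
rewrite (ge0_negligible_integral (measurableC (mX 0%N v)) measurableT (mf setT) f0 n0).
rewrite setTD setCK.
have e : X 0%N @^-1` [set v] = cyl 0 (fun=> v).
  apply/seteqP; split => w /=; last by move=> h; exact: h.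
  by move=> h i; rewrite leqn0 => /eqP->.
rewrite (eq_integral (fun w => ((gdist v (X (0 + t)%N w))%:R ^+ 2)%R%:E)); last first.
  by move=> w; rewrite inE /= => ->; rewrite add0n.
rewrite e (integral_cyl t 0 (fun=> v) (h := fun y => ((gdist v y)%:R ^+ 2)%R)); last first.
  by move=> y; exact: sqr_ge0.
by rewrite -e s0 mul1e.
Qed.

End Law.

(** * The dichotomy *)

(** A vertex without neighbour would be alone in its component. *)
Lemma infinite_connected_deg_gt0 (G : sgraph) : infinite_set [set: G] -> connected_graph G ->
  (forall x : G, finite_set (neighbors x)) -> forall x : G, (0 < deg x)%N.
Proof.
move=> Ginf Gc lf x; rewrite /deg cardfs_gt0; apply/negP => /eqP nx.
apply: Ginf; rewrite (_ : [set: G] = [set x]); first exact: finite_set1.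
apply/seteqP; split => // y _ /=.
have [n] := connected_inT Gc (I : setT y) (I : setT x).
case: n => [[]//|n [z [_ zx _]]].
have : z \in nbr x by rewrite in_nbr // adj_sym.
by rewrite /nbr nx.
Qed.

Theorem theorem1p9 (R : realType) (G : sgraph)
    (d : measure_display) (Omega : measurableType d)
    (P : G -> probability Omega R) (X : nat -> Omega -> G) :
  infinite_set [set: G] ->
  connected_graph G ->
  planar R G ->
  bounded_degree G ->
  is_srw P X ->
  (amenable R G /\ somewhere_at_most_diffusive P X) \/
  (~ amenable R G /\ ballistic P X).
Proof.
move=> Ginf Gc Gp [D degD] srw.
have lf (x : G) : finite_set (neighbors x) by have [] := degD x.
have deg_le (x : G) : (deg x <= D)%N by have [] := degD x.
have deg_gt0 := infinite_connected_deg_gt0 Ginf Gc lf.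
have [x0 _] : exists x : G, True.
  have [x _] := infinite_setN0 Ginf; by exists x.
have [am|nam] := pselect (amenable R G); [left|right]; split=> //.
  have /choice[root rootP] (C : set G) : exists r : G, forall x : G, C x -> C r.
    by have [[r Cr]|nC] := pselect (exists r, C r); [exists r|exists x0 => x Cx; case: nC; exists x].
  have [c c0 H] := @diffusive_iter R G Gc Gp lf deg_gt0 root rootP am (ex_intro _ x0 I).
  exists c; split => // t; have [x hx] := H t.
  apply: (@le_trans _ _ (mean_sq_displacement P X x t)).
    by apply: ereal_inf_lbound; exists x.
  by rewrite (mean_sq_displacementE lf deg_gt0 Gc srw) lee_fin.
have [h [h0 h2 gap]] := nonamenable_gap lf deg_gt0 nam.
have [c c0 H] := ballistic_iter lf deg_gt0 h0 h2 gap deg_le Gc.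
exists c; split => // v t.
by rewrite (mean_sq_displacementE lf deg_gt0 Gc srw) lee_fin.
Qed.
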